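(* For every integer $m\ge2$, as $N\to\infty$, \[ C_1(N)-m\,C_m(N)=(m-1)\frac{\pi}{16\sqrt[4]{54}}N^{-3/4}I_{-3/2}\!\left(\pi\sqrt{\tfrac{2N}{3}}\right)+O\!\left(N^{-5/4}e^{\pi\sqrt{2N/3}}\right), \] where $I_s$ is the modified Bessel function of the first kind.
   Context: For a positive integer $m$, an $m$-string in an ordinary partition is a collection of parts of sizes $m(1+k),m(3+k),\dots,m(2j-1+k)$ for a positive integer $j$ and an integer $0\le k\le j$; its weight is $1$ if $k=0$ or $k=j$, and $2$ otherwise. $C_m(n)$ is the sum over all partitions $\lambda$ of $n$ and all $m$-strings $\pi$ of $\lambda$ of the weight of $\pi$. Equivalently $\sum_{n\ge 0}C_m(n)q^n=h(q^m)/(q;q)_\infty$, where $(q;q)_\infty=\prod_{j\ge1}(1-q^j)$ and $h(q)=\sum_{n=1}^\infty\frac{(-1)^{n+1}q^{n(n+1)/2}}{1-q^n}$. *)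

(* Defs.v *)
From mathcomp Require Import ssreflect ssrfun ssrbool eqtype ssrnat seq fintype finfun bigop.

Set Implicit Arguments.
Unset Strict Implicit.
Unset Printing Implicit Defensive.

(* A partition of n is encoded by its multiplicity function:
   [mult i] is the number of parts of size [i.+1] (1 <= i.+1 <= n);
   the sizes must add up to n.  This is in bijection with the
   ordinary partitions of n. *)
Definition is_partition (n : nat) (mult : {ffun 'I_n -> 'I_n.+1}) : bool :=
  (\sum_(i < n) i.+1 * mult i)%N == n.

Definition has_part (n : nat) (mult : {ffun 'I_n -> 'I_n.+1}) (s : nat) : bool :=
  [exists i : 'I_n, (i.+1 == s) && (0 < mult i)%N].

Definition has_mstring (m n : nat) (mult : {ffun 'I_n -> 'I_n.+1}) (j k : nat) : bool :=
  [forall i : 'I_j, has_part mult (m * (2 * i + 1 + k))].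

Definition mstring_weight (j k : nat) : nat :=
  if (k == 0) || (k == j) then 1 else 2.

(* C_m(n): sum over partitions of n and over all m-strings (j >= 1,
   0 <= k <= j) contained in them of the weight.  Strings with j > n
   cannot occur in a partition of n (their part sizes sum to >= j > n),
   so restricting to 1 <= j <= n loses nothing. *)
Definition Cm (m n : nat) : nat :=
  (\sum_(mult : {ffun 'I_n -> 'I_n.+1} | is_partition mult)
     \sum_(1 <= j < n.+1) \sum_(0 <= k < j.+1)
        (if has_mstring m mult j k then mstring_weight j k else 0))%N.

From Stdlib Require Import Reals.
From Coquelicot Require Import Coquelicot.
Open Scope R_scope.

Fixpoint gauss_prod (x : R) (n : nat) : R :=
  match n with
  | O => x
  | S n' => gauss_prod x n' * (x + INR n)
  end.

(* Euler-Gauss limit formula, valid for every x not in {0,-1,-2,...}: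
   Gamma(x) = lim_n n! n^x / (x (x+1) ... (x+n)) *)
Definition Gamma (x : R) : R :=
  real (Lim_seq (fun n => INR (Factorial.fact n) * Rpower (INR n) x / gauss_prod x n)).

Definition BesselI (s x : R) : R :=
  Series (fun k => Rpower (x / 2) (2 * INR k + s) / (INR (Factorial.fact k) * Gamma (INR k + s + 1))).

(* Main.v *)
Require Import Defs.
From Stdlib Require Import Reals ZArith Lra Lia.
From mathcomp Require ssreflect ssrfun ssrbool eqtype ssrnat seq choice div fintype finfun bigop ssralg ssrint poly zify ssrZ.
Open Scope R_scope.

(* Write t = PI / sqrt (6 N), q = exp (-t + i y) and P(q) = 1 / (q;q)_oo. The number
   C_1(N) - m C_m(N) is the N-th coefficient of (h(q) - m h(q^m)) P(q), i.e. an integral over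
   |y| <= PI. On |y| <= t the first factor is (m - 1) / 8 + O(sqrt t): with q = exp (-tau),
   h(q) is the alternating sum of exp (-n^2 tau / 2) / (2 sinh (n tau / 2)), the simple poles
   1 / (n tau) cancel up to the Abel sum 1 - 2 + 3 - ... = 1/4, and the remainder has total
   variation O(sqrt t). P(q) / P(exp (-t)) is Gaussian of width t^(3/2), up to a relative
   error O(sqrt t), and it is exponentially small for |y| >= t. Finally
   log P(exp (-t)) = PI^2 / (6 t) + log (t / (2 PI)) / 2 + O(t), and only its first two
   derivatives enter, which are recovered by convexity. A relative error O(sqrt t) is
   precisely the claimed O(N^(-1/4)), and the Bessel function of order -3/2 is elementary.

   All infinite products are truncated at a large J, which does not change the coefficient. *)

(** No holomorphy is used: estimates are mean value inequalities along a real parameter (angle,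
    dilation factor or ray), and coefficients on the circle are identified by recurrences together
    with their decay at large negative indices. The modular transformation of the eta function is
    avoided as well: log P at t is compared with log P at 2 t, and the Wallis product supplies the
    constant 2 PI. Both h(q) and m h(q^m) blow up like the same multiple of 1 / tau; the limit (m -
    1) / 8 of their difference is (1/2) (1/4) (m - 1), the factor 1/2 coming from the derivative of
    exp (-n^2 s tau / 2) in s. The natural variable is s = sqrt t, of order N^(-1/4): the peak has
    width s^3, all errors are relative O(s), and in the end a main term s^4 is compared with an
    error s^5, both times exp (PI^2 / (3 s^2)). The range |y| <= t is the cone |Im tau| <= Re tau,
    on which |tau| and Re tau are comparable, so that complex summands obey the bounds of real
    ones. *)

Ltac req := match goal with |- ?a = ?b => change (@eq R a b) end.

(** * Finite real sums *)

Fixpoint rsum (f : nat -> R) (n : nat) : R :=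
  match n with O => 0 | S k => rsum f k + f k end.

Lemma rsum_S (f : nat -> R) (n : nat) : rsum f (S n) = rsum f n + f n.
Proof. reflexivity. Qed.

Lemma rsum_ext (f g : nat -> R) (n : nat) :
  (forall k, (k < n)%nat -> f k = g k) -> rsum f n = rsum g n.
Proof.
  induction n as [|n IH]; intros H; simpl; [easy|].
  rewrite IH, (H n) by (intros; apply H || lia; lia). easy.
Qed.

Lemma rsum_le (f g : nat -> R) (n : nat) :
  (forall k, (k < n)%nat -> f k <= g k) -> rsum f n <= rsum g n.
Proof.
  induction n as [|n IH]; intros H; simpl; [lra|].
  assert (rsum f n <= rsum g n) by (apply IH; intros; apply H; lia).
  assert (f n <= g n) by (apply H; lia). lra.
Qed.

Lemma rsum_plus (f g : nat -> R) (n : nat) :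
  rsum (fun k => f k + g k) n = rsum f n + rsum g n.
Proof. induction n as [|n IH]; simpl; [|rewrite IH]; ring. Qed.

Lemma rsum_scal (c : R) (f : nat -> R) (n : nat) :
  rsum (fun k => c * f k) n = c * rsum f n.
Proof. induction n as [|n IH]; simpl; [|rewrite IH]; ring. Qed.

Lemma rsum_const (c : R) (n : nat) : rsum (fun _ => c) n = INR n * c.
Proof. induction n as [|n IH]; [simpl; ring|]. rewrite S_INR. simpl rsum. rewrite IH. ring. Qed.

Lemma rsum_nonneg (f : nat -> R) (n : nat) :
  (forall k, (k < n)%nat -> 0 <= f k) -> 0 <= rsum f n.
Proof.
  intros H. replace 0 with (rsum (fun _ => 0) n).
  - now apply rsum_le.
  - rewrite rsum_const. ring.
Qed.

Lemma rsum_split (f : nat -> R) (n k : nat) :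
  rsum f (n + k) = rsum f n + rsum (fun i => f (n + i)%nat) k.
Proof.
  induction k as [|k IH].
  - rewrite Nat.add_0_r. simpl. ring.
  - rewrite Nat.add_succ_r. simpl. rewrite IH. ring.
Qed.

Lemma rsum_mono (f : nat -> R) (n k : nat) :
  (forall i, 0 <= f i) -> (n <= k)%nat -> rsum f n <= rsum f k.
Proof.
  intros H Hk. replace k with (n + (k - n))%nat by lia. rewrite rsum_split.
  assert (0 <= rsum (fun i => f (n + i)%nat) (k - n)) by (apply rsum_nonneg; auto). lra.
Qed.


(** * Strings in partitions *)

Module Comb.
Import HB.structures.
Import ssreflect ssrfun ssrbool eqtype ssrnat seq choice div fintype finfun bigop ssralg ssrint poly.
Import mathcomp.zify.zify.
Import GRing.Theory.
Set Implicit Arguments.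
Unset Strict Implicit.
Unset Printing Implicit Defensive.

Local Open Scope nat_scope.

(* Number of partitions of [M] into parts of size at most [k]. *)
Fixpoint pp (k M : nat) : nat :=
  match k with
  | 0 => M == 0
  | k'.+1 => \sum_(j < M.+1 | k'.+1 * j <= M) pp k' (M - k'.+1 * j)
  end.

Arguments pp : simpl never.

Lemma ppS k M : pp k.+1 M =
  \sum_(0 <= j < M.+1 | k.+1 * j <= M) pp k (M - k.+1 * j).
Proof. by rewrite big_mkord. Qed.

(** Multiplicities above [M] violate the side condition; enlarging the range gives sums for
    different [M] a common one. *)
Lemma pp_widen k M B : M <= B -> pp k.+1 M =
  \sum_(0 <= j < B.+1 | k.+1 * j <= M) pp k (M - k.+1 * j).
Proof.
move=> MB; rewrite ppS [RHS](@big_cat_nat _ _ _ M.+1) //=.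
rewrite [X in _ + X]big_nat_cond [X in _ + X]big1 ?addn0 // => j.
by move=> /andP[/andP[Mj _]] H; nia.
Qed.

(** Multiplicity 0 uses no part [k.+1]; in all other cases one such part is removed. This is the
    coefficient form of multiplying the generating product by 1 - q^(k+1). *)
Lemma pp_rec k M : pp k.+1 M =
  pp k M + (if k.+1 <= M then pp k.+1 (M - k.+1) else 0).
Proof.
rewrite ppS big_mkcond big_ltn // muln0 subn0 /=; congr (_ + _).
case: ifP => kM; last first.
  rewrite big_nat_cond big1 // => j /andP[/andP[j0 _] _].
  by case: leqP => // H; nia.
rewrite (@pp_widen _ _ M.-1); last by lia.
rewrite big_add1 prednK; last by lia.
rewrite [RHS]big_mkcond /=; apply: eq_bigr => j _.
have -> : (k.+1 * j.+1 <= M) = (k.+1 * j <= M - k.+1) by apply/idP/idP; nia.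
by case: ifP => // _; congr pp; nia.
Qed.

(** A part larger than [M] cannot occur. This is why truncating the product at any [J >= N] leaves
    the coefficient of q^N unchanged. *)
Lemma pp_stable k M : M <= k -> pp k M = pp M M.
Proof.
elim: k => [|k IH]; first by rewrite leqn0 => /eqP ->.
rewrite leq_eqVlt => /orP[/eqP -> //|]; rewrite ltnS => Mk.
by rewrite pp_rec IH // leqNgt ltnS Mk addn0.
Qed.

Fixpoint tri (n : nat) : nat := match n with 0 => 0 | n'.+1 => tri n' + n'.+1 end.

Section Count.
Variables (B : nat) (c : nat -> nat).
Local Open Scope ring_scope.

Let Q k : {poly nat} :=
  \prod_(i < k) \sum_(j < B.+1) (if (c i <= j)%N then 'X^(i.+1 * j) else 0).
Let s k := (\sum_(i < k) c i * i.+1)%N.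

(* Forcing parts into a partition ([c] bounds the multiplicities from below) leaves an arbitrary partition of the rest. *)
Lemma coef_restricted_prod k M : (M <= B)%N ->
  (Q k)`_M = (if s k <= M then pp k (M - s k) else 0)%N.
Proof.
elim: k M => [|k IH] M leMB.
  rewrite /Q /s !big_ord0 coef1 subn0 leq0n /pp; by case: (M == 0)%N.
have sE : s k.+1 = (s k + c k * k.+1)%N by rewrite /s big_ord_recr.
have -> : (Q k.+1)`_M = (\sum_(0 <= j < B.+1 | (c k <= j) && (k.+1 * j + s k <= M))
   pp k (M - k.+1 * j - s k))%N.
  rewrite big_mkord /Q big_ord_recr /= -/(Q k) mulr_sumr coef_sum.
  rewrite [RHS]big_mkcond; apply: eq_bigr => j _.
  case: ifP => cj /=; last by rewrite mulr0 coef0.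
  rewrite coefMXn; case: ltnP => Hj.
    by rewrite ifF //; lia.
  rewrite IH; last by lia.
  by rewrite leq_subRL.
case: leqP => Hs; last first.
  by apply: big1 => j /andP[cj]; rewrite sE in Hs; nia.
have ckM : (c k <= M)%N by rewrite sE in Hs; nia.
rewrite (@pp_widen _ _ (B - c k)); last by rewrite sE; nia.
rewrite (@big_cat_nat _ _ _ (c k)) //=; last by lia.
rewrite big_nat_cond big1 ?add0n; last first.
  by move=> j /andP[/andP[_ jc]] /andP[cj _]; lia.
rewrite -{1}[c k]add0n big_addn -subSn; last by lia.
apply: eq_big => [j|j _].
  by rewrite leq_addl /= sE; apply/idP/idP; nia.
by congr pp; rewrite sE; nia.
Qed.

(** Distributivity: choosing one monomial in each factor is choosing a multiplicity function, which
    contributes to the coefficient exactly when it respects [c] and its parts add up to [B]. *)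
Lemma card_bounded_below : (\sum_(f : {ffun 'I_B -> 'I_B.+1} |
   is_partition f && [forall i : 'I_B, c i <= f i]) 1)%N =
   (if s B <= B then pp B (B - s B) else 0)%N.
Proof.
rewrite -coef_restricted_prod // /Q bigA_distr_bigA coef_sum /= big_mkcond /=.
apply: eq_bigr => f _.
case: (boolP [forall i : 'I_B, (c i <= f i)%N]) => [/forallP Hf|].
  rewrite (eq_bigr (fun i : 'I_B => 'X^(i.+1 * f i))); last by move=> i _; rewrite Hf.
  rewrite andbT /is_partition -expr_sum coefXn eq_sym.
  by case: eqP.
rewrite negb_forall => /existsP[i /negbTE Hi].
by rewrite andbF (bigD1 i) //= Hi mul0r coef0.
Qed.
End Count.

(** The sizes in a string are distinct and add up to m j (j + k), so containing it means having
    multiplicity at least 1 at each of them; [card_bounded_below] applies with their indicator as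
    lower bound. *)
Lemma card_mstring (m n j k : nat) : 0 < m ->
  \sum_(f : {ffun 'I_n -> 'I_n.+1} | is_partition f && has_mstring m f j k) 1 =
  if m * (j * (j + k)) <= n then pp n (n - m * (j * (j + k))) else 0.
Proof.
move=> m0.
pose S (i : nat) := m * (2 * i + 1 + k).
have sumS : \sum_(i < j) S i = m * (j * (j + k)).
  elim: j => [|j IH]; first by rewrite big_ord0 mul0n muln0.
  by rewrite big_ord_recr /= IH /S; nia.
(* A size exceeding [n] has no index in ['I_n], so a lower bound could not record it; in that case
   both sides are 0. *)
case: (boolP [forall i : 'I_j, S i <= n]) => [/forallP HS|]; last first.
  rewrite negb_forall => /existsP[i]; rewrite -ltnNge => Hi.
  have Hbig : n < m * (j * (j + k)).
    by rewrite -sumS (bigD1 i) //=; apply: leq_trans Hi _; apply: leq_addr.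
  rewrite leqNgt Hbig /= big1 // => f /andP[_ /forallP /(_ i) /existsP[x /andP[/eqP Hx _]]].
  by have := ltn_ord x; rewrite /S in Hi; lia.
pose c (i : nat) := \sum_(i' < j) (i.+1 == S i').
have sumc : \sum_(i < n) c i * i.+1 = m * (j * (j + k)).
  rewrite -sumS /c (eq_bigr (fun i : 'I_n => \sum_(i' < j) (i.+1 == S i') * i.+1)); last first.
    by move=> i _; rewrite big_distrl.
  rewrite exchange_big /=; apply: eq_bigr => i' _.
  have lt : (S i').-1 < n by have := HS i'; rewrite {1 2}/S; nia.
  have E : (S i').-1.+1 = S i' by rewrite prednK // /S; nia.
  rewrite (bigD1 (Ordinal lt)) //= E eqxx mul1n big1 ?addn0 // => i.
  move=> /negP Hi; case: eqP => // Ei; case: Hi; apply/eqP/val_inj => /=; lia.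
rewrite -sumc -(card_bounded_below n c); apply: eq_bigl => f; congr (_ && _).
apply/forallP/forallP => H i.
- have c1 : c i <= 1.
    rewrite /c; case: (boolP [exists i' : 'I_j, i.+1 == S i']) => [/existsP[i' /eqP Hi']|].
      rewrite (bigD1 i') //= big1 ?addn0 ?leq_b1 // => i2 /negP ne.
      by case: eqP => // E2; case: ne; apply/eqP/val_inj => /=; rewrite Hi' /S in E2; nia.
    rewrite negb_exists => /forallP ne; rewrite big1 // => i' _.
    by rewrite (negbTE (ne i')).
  case: (posnP (f i)) => [fi0|]; last exact: leq_trans.
  rewrite /c big1 // => i' _; case: eqP => // E.
  have /existsP[x /andP[/eqP Ex fx]] := H i'.
  have Exi : x = i by apply: val_inj; move: E; rewrite /S -Ex => -[].
  by rewrite Exi fi0 in fx.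
- have lt : (S i).-1 < n by have := HS i; rewrite {1 2}/S; nia.
  have E : (S i).-1.+1 = S i by rewrite prednK // /S; nia.
  apply/existsP; exists (Ordinal lt); rewrite /= E eqxx /=.
  apply: leq_trans (H (Ordinal lt)); rewrite /c (bigD1 i) //= E eqxx; exact: leq_addr.
Qed.

Lemma Cm_pp (m n : nat) : 0 < m -> Cm m n =
  \sum_(1 <= j < n.+1) \sum_(0 <= k < j.+1) mstring_weight j k *
    (if m * (j * (j + k)) <= n then pp n (n - m * (j * (j + k))) else 0).
Proof.
move=> m0; rewrite /Cm exchange_big /=; apply: eq_bigr => j _.
rewrite exchange_big /=; apply: eq_bigr => k _.
rewrite -card_mstring // big_distrr /= -big_mkcondr /=.
by apply: eq_bigr => f _; rewrite muln1.
Qed.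

(* A string (j, k) has weight m j b with b = j + k in [j, 2j]. Over all ordered pairs
   (c, b) the string weights symmetrise to sgn(2b - c), twice; the terms with c even
   cancel by antisymmetry, and those with c odd are the terms n = c (if 2b > c) and
   n = 2b (if 2b < c) of the alternating sum. *)
Section StringSum.
Local Open Scope ring_scope.
Variables (N : nat) (g : nat -> int).
Hypothesis gN : forall S, (N < S)%N -> g S = 0.

(** [X = 2 * Y] exceeds every [b = j + k <= 2 * N], and it is even, so that sums below [X] split
    into even and odd indices below [Y]. *)
Let Y := N.+1.
Let X := Y.*2.
Let P (b : bool) : int := if b then 1 else 0.
Let sg (x y : nat) : int := P (y < x)%N - P (x < y)%N.
Let w (j b : nat) : int :=
  if (b == j) || (b == 2 * j)%N then 1 else if (j < b < 2 * j)%N then 2 else 0.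

Let sum_by_pairs :
  \sum_(1 <= j < N.+1) \sum_(0 <= k < j.+1) (mstring_weight j k)%:Z * g (j * (j + k)) =
  \sum_(1 <= j < X) \sum_(1 <= b < X) w j b * g (j * b).
Proof.
rewrite [RHS](@big_cat_nat _ _ _ N.+1) //=; last by rewrite /X /Y; lia.
rewrite [X in _ = _ + X]big_nat_cond [X in _ = _ + X]big1 ?addr0; last first.
  move=> j /andP[/andP[Nj _] _]; rewrite big_nat_cond big1 // => b /andP[/andP[b1 _] _].
  by rewrite gN ?mulr0 //; nia.
apply: eq_big_nat => j /andP[j1 jN].
rewrite [RHS](@big_cat_nat _ _ _ j) //=; last by rewrite /X /Y; lia.
rewrite [X in _ = X + _]big_nat_cond [X in _ = X + _]big1 ?add0r; last first.
  move=> b /andP[/andP[b1 bj] _].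
  rewrite /w ifF; last by apply/negbTE; lia.
  by rewrite ifF ?mul0r //; apply/negbTE; lia.
rewrite [RHS](@big_cat_nat _ _ _ (j.+1 + j)) //=; [|by lia|by rewrite /X /Y; lia].
rewrite [X in _ = _ + X]big_nat_cond [X in _ = _ + X]big1 ?addr0; last first.
  move=> b /andP[/andP[b1 bj] _].
  rewrite /w ifF; last by apply/negbTE; lia.
  by rewrite ifF ?mul0r //; apply/negbTE; lia.
rewrite -[X in _ = \sum_(X <= b < _) _]add0n big_addn addnK.
apply: eq_big_nat => k /andP[_ kj].
rewrite [(k + j)%N]addnC; congr (_ * _); rewrite /w /mstring_weight.
have -> : (j + k == j)%N = (k == 0)%N by apply/eqP/eqP; lia.
have -> : (j + k == 2 * j)%N = (k == j)%N by apply/eqP/eqP; lia.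
case: (k =P 0%N) => //= k0; case: (k =P j) => //= kj'.
by rewrite ifT //; lia.
Qed.

Let symmetrised :
  \sum_(1 <= j < X) \sum_(1 <= b < X) w j b * g (j * b) =
  \sum_(1 <= c < X) \sum_(1 <= b < X) sg (2 * b)%N c * g (c * b).
Proof.
set L := LHS; set T := RHS.
have L2 : L = \sum_(1 <= j < X) \sum_(1 <= b < X) w b j * g (j * b).
  rewrite /L exchange_big_nat /=; apply: eq_bigr => j _; apply: eq_bigr => b _.
  by congr (_ * g _); apply: mulnC.
have T2 : T = \sum_(1 <= c < X) \sum_(1 <= b < X) sg (2 * c)%N b * g (c * b).
  rewrite /T exchange_big_nat /=; apply: eq_bigr => j _; apply: eq_bigr => b _.
  by congr (_ * g _); apply: mulnC.
(* Once each sum is added to its copy with exchanged variables, the weights agree pair by pair: 2 if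
   c < 2 b and b < 2 c, 1 if one variable is twice the other, and 0 otherwise. *)
suff : L + L = T + T by lia.
rewrite {2}L2 {2}T2 /L /T -!big_split /=.
apply: eq_big_nat => c /andP[c1 _].
rewrite -!big_split /=.
apply: eq_big_nat => b /andP[b1 _].
rewrite -!mulrDl; congr (_ * _); rewrite /w /sg /P.
by do ![case: eqP => /= ?]; do ![case: ifP => /= ?]; lia.
Qed.

Let sum_even_odd (F : nat -> int) (m : nat) :
  \sum_(0 <= c < m.*2) F c = \sum_(0 <= c < m) F c.*2 + \sum_(0 <= c < m) F c.*2.+1.
Proof.
elim: m => [|m IH]; first by rewrite !big_geq // addr0.
by rewrite doubleS !big_nat_recr //= IH -addrA addrACA.
Qed.

Let odd_part :
  \sum_(1 <= c < X) \sum_(1 <= b < X) sg (2 * b)%N c * g (c * b) =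
  \sum_(1 <= c < X) \sum_(1 <= b < X) P (odd c) * sg (2 * b)%N c * g (c * b).
Proof.
apply/eqP; rewrite -subr_eq0 -sumrB; apply/eqP.
(* Discarding [b >= Y], where [g] vanishes, gives c / 2 and [b] the same range, as the antisymmetry
   below requires. *)
transitivity (\sum_(0 <= c < X) P (0 < c)%N * P (~~ odd c) * \sum_(1 <= b < Y) sg (2 * b)%N c * g (c * b)).
  rewrite [RHS]big_ltn // [X in _ = X + _]mul0r add0r.
  apply: eq_big_nat => c /andP[c1 _].
  rewrite c1 /P mul1r -sumrB mulr_sumr [LHS](@big_cat_nat _ _ _ Y) //=; last by rewrite /X; lia.
  rewrite [X in _ + X]big_nat_cond [X in _ + X]big1 ?addr0; last first.
    move=> b /andP[/andP[Yb _] _]; rewrite gN ?mulr0 ?subr0 //; rewrite /Y in Yb; nia.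
  by apply: eq_bigr => b _; case: (odd c) => /=; rewrite !(mul1r, mul0r) ?subrr ?subr0.
rewrite sum_even_odd [X in _ + X]big1 ?addr0; last first.
  by move=> c _; rewrite /= odd_double /= /P mulr0 mul0r.
rewrite big_ltn // {1}/P !mul0r add0r.
pose h c b : int := (P (c < b)%N - P (b < c)%N) * g (2 * c * b).
transitivity (\sum_(1 <= c < Y) \sum_(1 <= b < Y) h c b).
  apply: eq_big_nat => c /andP[c1 _].
  rewrite odd_double double_gt0 c1 /P !mul1r; apply: eq_bigr => b _.
  by rewrite /h /sg -!muln2 ![(_ * 2)%N]mulnC !ltn_pmul2l.
set S := LHS.
have : S = - S.
  rewrite {1}/S exchange_big_nat /= /S -sumrN; apply: eq_bigr => c _.
  rewrite -sumrN; apply: eq_bigr => b _; rewrite /h -mulrN mulrN -mulNr opprB.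
  by congr (_ * g _); lia.
by lia.
Qed.

Lemma tri_double n : (2 * tri n = n * n.+1)%N.
Proof. by elim: n => [//|n IH] /=; rewrite mulnDr IH; lia. Qed.

Let sum_truncate (F : nat -> int) (m m' : nat) : (m <= m')%N ->
  (forall i, (m <= i)%N -> F i = 0) -> \sum_(0 <= i < m') F i = \sum_(0 <= i < m) F i.
Proof.
move=> mm' H; rewrite (@big_cat_nat _ _ _ m) //= [X in _ + X]big_nat_cond.
by rewrite [X in _ + X]big1 ?addr0 // => i /andP[/andP[/H]].
Qed.

(** For [n = 2 * a + 1] one has tri n + n l = n (l + a + 1), and [b = l + a + 1] runs over the
    integers with 2 b > n. *)
Let inner_odd n : (n < X)%N -> odd n ->
  \sum_(0 <= l < N.+1) g (tri n + n * l) =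
  \sum_(1 <= b < X) P (n < 2 * b)%N * g (n * b).
Proof.
move=> nX on; have En := odd_double_half n; rewrite on in En.
pose a := n./2; have {}En : n = a.*2.+1 by rewrite -En.
have E l : (tri n + n * l = n * (l + a.+1))%N by have := tri_double n; rewrite En; nia.
under eq_bigr do rewrite E.
rewrite [RHS](@big_cat_nat _ _ _ a.+1) //=; last by lia.
rewrite [X in _ = X + _]big_nat_cond [X in _ = X + _]big1 ?add0r; last first.
  move=> b /andP[/andP[_ ba] _].
  by rewrite /P ifF ?mul0r //; apply/negbTE; rewrite En -leqNgt; lia.
rewrite -[X in _ = \sum_(X <= b < _) _]add0n big_addn.
rewrite -(@sum_truncate _ N.+1 X); [|by rewrite /X /Y; lia|by move=> i Hi; rewrite gN //; nia].
rewrite -(@sum_truncate _ (X - a.+1) X); [|by lia|]; last first.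
  move=> i Hi; rewrite gN ?mulr0 //; rewrite /X /Y in Hi; nia.
by apply: eq_bigr => l _; rewrite /P ifT ?mul1r //; lia.
Qed.

(** Here tri (2 e) + 2 e l = e (2 (l + e) + 1), whose cofactor runs over the odd integers above 2
    e. *)
Let inner_even e : (0 < e < Y)%N ->
  \sum_(0 <= l < N.+1) g (tri e.*2 + e.*2 * l) =
  \sum_(1 <= c < X) P (odd c) * (P (2 * e < c)%N * g (e * c)).
Proof.
move=> /andP[e0 eY].
have E l : (tri e.*2 + e.*2 * l = e * (l + e).*2.+1)%N by have := tri_double e.*2; nia.
under eq_bigr do rewrite E.
transitivity (\sum_(0 <= c < X) P (odd c) * (P (2 * e < c)%N * g (e * c))); last first.
  by rewrite big_ltn // [X in X + _]mul0r add0r.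
rewrite sum_even_odd [X in _ = X + _]big1 ?add0r; last by move=> c _; rewrite odd_double mul0r.
rewrite [RHS](@big_cat_nat _ _ _ e) //=; last by lia.
rewrite [X in _ = X + _]big_nat_cond [X in _ = X + _]big1 ?add0r; last first.
  move=> c /andP[/andP[_ ce] _].
  by rewrite [P (_ < _)%N]/P ifF ?mul0r ?mulr0 //; apply/negbTE; lia.
rewrite -[X in _ = \sum_(X <= b < _) _]add0n big_addn.
rewrite (@sum_truncate _ (Y - e) N.+1); [|by rewrite /Y; lia|]; last first.
  by move=> i Hi; rewrite gN //; rewrite /Y in Hi; nia.
apply: eq_bigr => l _; rewrite /P /= odd_double /= mul1r ifT ?mul1r //; lia.
Qed.

Lemma string_sum :
  \sum_(1 <= j < N.+1) \sum_(0 <= k < j.+1) (mstring_weight j k)%:Z * g (j * (j + k)) =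
  \sum_(1 <= n < N.+1) (-1) ^+ n.+1 * \sum_(0 <= l < N.+1) g (tri n + n * l).
Proof.
rewrite sum_by_pairs symmetrised odd_part.
pose U n := \sum_(0 <= l < N.+1) g (tri n + n * l).
have -> : \sum_(1 <= n < N.+1) (-1) ^+ n.+1 * U n = \sum_(1 <= n < X) (-1) ^+ n.+1 * U n.
  rewrite [RHS](@big_cat_nat _ _ _ N.+1) //=; last by rewrite /X /Y; lia.
  rewrite [X in _ = _ + X]big_nat_cond [X in _ = _ + X]big1 ?addr0 //.
  move=> n /andP[/andP[Nn _] _]; rewrite /U big1 ?mulr0 // => l _.
  by rewrite gN //; have := tri_double n; nia.
pose V e := \sum_(1 <= c < X) P (odd c) * (P (2 * e < c)%N * g (e * c)).
(* The pairs with 2 b > c feed the odd indices n, where (-1)^(n+1) = 1; those with 2 b < c feed the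
   even ones, where it is -1. *)
transitivity (\sum_(1 <= n < X) P (odd n) * \sum_(1 <= b < X) P (n < 2 * b)%N * g (n * b)
   - \sum_(1 <= e < X) V e).
  rewrite /V [X in _ = _ - X]exchange_big_nat /= -sumrB; apply: eq_bigr => c _.
  rewrite mulr_sumr -sumrB; apply: eq_bigr => b _.
  rewrite /sg -mulrA mulrBl mulrBr; by congr (_ - _ * (_ * g _)); apply: mulnC.
have -> : \sum_(1 <= e < X) V e = \sum_(0 <= n < X) P (0 < n)%N * P (~~ odd n) * U n.
  rewrite sum_even_odd [X in _ = _ + X]big1 ?addr0; last first.
    by move=> c _; rewrite /= odd_double /= /P mulr0 mul0r.
  rewrite [RHS]big_ltn // [X in _ = X + _]mul0r add0r.
  rewrite [LHS](@big_cat_nat _ _ _ Y) //=; last by rewrite /X; lia.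
  rewrite [X in _ + X]big_nat_cond [X in _ + X]big1 ?addr0; last first.
    move=> e /andP[/andP[Ye _] _]; rewrite /V big_nat_cond big1 // => c /andP[/andP[_ cX] _].
    by rewrite [P (_ < _)%N]/P ifF ?mul0r ?mulr0 //; apply/negbTE; rewrite /X in cX; lia.
  apply: eq_big_nat => e /andP[e1 eY].
  rewrite /V /U inner_even ?e1 // double_gt0 e1 odd_double !mul1r.
  by [].
rewrite [X in _ - X]big_ltn // [X in _ - (X + _)]mul0r add0r -sumrB.
apply: eq_big_nat => n /andP[n1 nX].
rewrite n1 [P true]/P mul1r exprS; case: (boolP (odd n)) => on.
  by rewrite -inner_odd // /P mul0r subr0 mul1r -signr_odd on expr1 mulrNN mulr1 mul1r.
by rewrite /P mul0r sub0r mul1r -signr_odd (negbTE on) expr0 mulr1 mulN1r.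
Qed.

End StringSum.

(** * From integer sums to real sums *)

Section RealBridge.
Import ssrZ.
Local Open Scope ring_scope.

Definition toR (x : int) : Rdefinitions.R := IZR (Z_of_int x).

Lemma toRD x y : toR (x + y) = Rplus (toR x) (toR y).
Proof. by rewrite /toR rmorphD -plus_IZR. Qed.

Lemma toRM x y : toR (x * y) = Rmult (toR x) (toR y).
Proof. by rewrite /toR rmorphM -mult_IZR. Qed.

Lemma toR_nat n : toR (Posz n) = INR n.
Proof. by rewrite INR_IZR_INZ. Qed.

Lemma toR_sign n : toR ((-1) ^+ n) = pow (-1) n.
Proof. by elim: n => [|n IH] //; rewrite exprS toRM IH. Qed.

Lemma toR_sum (F : nat -> int) n : toR (\sum_(0 <= i < n) F i) = rsum (fun i => toR (F i)) n.
Proof.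
elim: n => [|n IH]; first by rewrite big_geq.
by rewrite big_nat_recr //= toRD IH.
Qed.
End RealBridge.

(** The extension by 0 to negative indices makes the recurrence [pz_rec] valid at every integer, so
    that coefficients on the circle can be compared by descending to minus infinity. *)
Definition pz (J : nat) (z : Z) : Rdefinitions.R :=
  if Z.ltb z 0 then R0 else INR (pp J (Z.to_nat z)).

Lemma pz_neg J z : Z.lt z 0 -> pz J z = R0.
Proof. by rewrite /pz; case: Z.ltb_spec => //; lia. Qed.

Lemma pz_0 z : pz 0 z = if Z.eqb z 0 then R1 else R0.
Proof.
rewrite /pz /pp; case: Z.ltb_spec => Hz; case: Z.eqb_spec => // Hz'; try lia.
  by rewrite Hz'.
by case: eqP => // H; lia.
Qed.

Lemma pz_rec J z : Rminus (pz J.+1 z) (pz J.+1 (Z.sub z (Z.of_nat J.+1))) = pz J z.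
Proof.
rewrite /pz; case: Z.ltb_spec => Hz.
  case: Z.ltb_spec => H; last by lia.
  by rewrite Rminus_0_r.
rewrite pp_rec plus_INR; case: Z.ltb_spec => H.
  by rewrite ifF; [rewrite /= Rplus_0_r Rminus_0_r|apply/negbTE; lia].
rewrite ifT; last by lia.
rewrite (_ : Z.to_nat (Z.sub z (Z.of_nat J.+1)) = (Z.to_nat z - J.+1)%N); last by lia.
by rewrite /Rminus Rplus_assoc Rplus_opp_r Rplus_0_r.
Qed.

(* The coefficient of q^z in q^(m n(n+1)/2) / ((1 - q^(m n)) (q;q)_J). *)
Definition hterm (J m n : nat) (z : Z) : Rdefinitions.R :=
  rsum (fun l => pz J (Z.sub z (Z.of_nat (m * (tri n + n * l))))) (Z.to_nat z).+1.

Lemma Cm_hterm (m N J : nat) : Peano.lt 0 m -> Peano.le N J ->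
  INR (Cm m N) = rsum (fun i => Rmult (pow (-1) i) (hterm J m i.+1 (Z.of_nat N))) N.
Proof.
move=> /ltP m0 /leP NJ; rewrite Cm_pp //.
(* [g S] counts the partitions of what is left of [N] once a string with total size [m * S] is
   removed. *)
pose g S : int := if (m * S <= N)%N then Posz (pp N (N - m * S)) else Posz 0.
have gN S : (N < S)%N -> g S = 0%R.
  by move=> H; rewrite /g ifF //; apply/negbTE; nia.
have gE S : toR (g S) = pz J (Z.sub (Z.of_nat N) (Z.of_nat (m * S))).
  rewrite /g /pz; case: Z.ltb_spec => H.
    by rewrite ifF //; lia.
  rewrite ifT; last by lia.
  rewrite toR_nat; congr (INR _).
  rewrite (_ : Z.to_nat _ = N - m * S); last by lia.
  by rewrite !pp_stable //; lia.
rewrite -toR_nat; set L := Posz _.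
have -> : L = (\sum_(1 <= j < N.+1) \sum_(0 <= k < j.+1) (mstring_weight j k)%:Z * g (j * (j + k))%N)%R.
  rewrite /L -[Posz _]natz natr_sum; apply: eq_bigr => j _.
  rewrite natr_sum; apply: eq_bigr => k _.
  by rewrite natrM !natz /g; case: ifP.
rewrite string_sum // big_add1 /= toR_sum; apply: rsum_ext => i _.
rewrite toRM toR_sum toR_sign /hterm Nat2Z.id.
(* [string_sum] starts at n = 1 with sign (-1)^(n+1); for n = i + 1 the exponent is i + 2. *)
have -> : pow (-1) i.+2 = pow (-1) i by simpl; Lra.lra.
congr (Rmult _ _).
by apply: rsum_ext => l _; apply: gE.
Qed.
End Comb.

From Coquelicot Require Import Coquelicot.
Import Comb (pz, pz_neg, pz_0, pz_rec, hterm, tri, Cm_hterm).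

Lemma rsum_sum_n (f : nat -> R) (n : nat) : sum_n f n = rsum f (S n).
Proof.
  induction n as [|n IH].
  - rewrite sum_O. simpl. ring.
  - rewrite sum_Sn, IH. reflexivity.
Qed.

Lemma is_derive_eq (f : R -> R) (x l l' : R) : is_derive f x l -> l = l' -> is_derive f x l'.
Proof. intros H E. now rewrite <- E. Qed.

Lemma RInt_FTC (F f : R -> R) (a b : R) :
  (forall x, is_derive F x (f x)) -> (forall x, continuous f x) ->
  RInt f a b = F b - F a.
Proof.
  intros HF Hf. apply is_RInt_unique.
  apply (is_RInt_derive F f); intros; auto.
Qed.

Lemma ex_RInt_cont (f : R -> R) (a b : R) : (forall x, continuous f x) -> ex_RInt f a b.
Proof. intros H. apply (ex_RInt_continuous f). auto. Qed.

Lemma cont_derive (f : R -> R) (x : R) : ex_derive f x -> continuous f x.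
Proof. apply (ex_derive_continuous f). Qed.

Lemma MVT_le (f f' : R -> R) (a b : R) : a <= b ->
  (forall x, a <= x <= b -> is_derive f x (f' x)) ->
  exists c, a <= c <= b /\ f b - f a = f' c * (b - a).
Proof.
  intros Hab H. destruct (MVT_gen f a b f') as [c [Hc E]];
    rewrite ?Rmin_left, ?Rmax_right in * by lra.
  - intros x Hx. apply H. lra.
  - intros x Hx. apply continuity_pt_filterlim, (cont_derive f). exists (f' x). now apply H.
  - now exists c.
Qed.

Lemma RInt_lincomb (a b : R) (f g : R -> R) (c d : R) :
  (forall x, continuous f x) -> (forall x, continuous g x) ->
  RInt (fun x => c * f x + d * g x) a b = c * RInt f a b + d * RInt g a b.
Proof.
  intros Hf Hg. apply is_RInt_unique.
  apply (is_RInt_plus (V := R_NormedModule) (fun x => c * f x) (fun x => d * g x)).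
  - apply (is_RInt_scal (V := R_NormedModule) f). apply (RInt_correct (V := R_CompleteNormedModule)), ex_RInt_cont; auto.
  - apply (is_RInt_scal (V := R_NormedModule) g). apply (RInt_correct (V := R_CompleteNormedModule)), ex_RInt_cont; auto.
Qed.

Lemma RInt_mono (f g : R -> R) (a b : R) : a <= b ->
  (forall x, continuous f x) -> (forall x, continuous g x) ->
  (forall x, a < x < b -> f x <= g x) -> RInt f a b <= RInt g a b.
Proof. intros Hab Hf Hg H. apply RInt_le; auto using ex_RInt_cont. Qed.

(** * Wallis integrals and the Basel sum *)

(** These integrals serve three times: they telescope the sum of 1 / k^2, they produce the constant
    in ln (t / (2 PI)), and they evaluate Gamma at 1/2. *)
Definition wallis (n : nat) : R := RInt (fun x => cos x ^ n) 0 (PI / 2).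

Lemma continuous_cos_pow (n : nat) (x : R) : continuous (fun y => cos y ^ n) x.
Proof. apply cont_derive. auto_derive. auto. Qed.

Lemma sin2_cos2' (x : R) : sin x * sin x = 1 - cos x * cos x.
Proof. generalize (sin2_cos2 x). unfold Rsqr. lra. Qed.

(** The integrand below is the derivative of sin x cos^(n+1) x, which vanishes at 0 and at PI /
    2. *)
Lemma wallis_rec (n : nat) : (INR n + 2) * wallis (S (S n)) = (INR n + 1) * wallis n.
Proof.
  assert (H : RInt (fun x => (INR n + 2) * cos x ^ (S (S n)) + (- (INR n + 1)) * cos x ^ n) 0 (PI / 2) = 0).
  { rewrite (RInt_FTC (fun x => sin x * cos x ^ (S n))).
    - rewrite sin_0, cos_PI2. simpl. ring.
    - intros x. auto_derive; auto.
      replace (match n with O => 1 | S _ => INR n + 1 end) with (INR n + 1) by (destruct n; simpl; ring).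
      simpl pow. generalize (sin2_cos2' x). intros E.
      transitivity (cos x * cos x * cos x ^ n - (INR n + 1) * (sin x * sin x) * cos x ^ n); [ring|rewrite E; ring].
    - intros x. apply cont_derive. auto_derive. auto. }
  rewrite RInt_lincomb in H by (intros; apply continuous_cos_pow).
  unfold wallis. lra.
Qed.

Lemma wallis_0 : wallis 0 = PI / 2.
Proof.
  unfold wallis. rewrite (RInt_FTC (fun x => x)).
  - ring.
  - intros x. simpl. auto_derive; auto.
  - intros x. apply continuous_cos_pow.
Qed.

Lemma wallis_1 : wallis 1 = 1.
Proof.
  unfold wallis. rewrite (RInt_FTC sin).
  - rewrite sin_PI2, sin_0. ring.
  (* [req] restates at type [R] an equality that may be typed in a convertible structure carrier, so
     that [ring] recognises it. *)
  - intros x. auto_derive; auto. req. ring.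
  - intros x. apply continuous_cos_pow.
Qed.

Lemma wallis_pos (n : nat) : 0 < wallis n.
Proof.
  assert (H : 0 < wallis n /\ 0 < wallis (S n)).
  { induction n as [|n [IH1 IH2]].
    - rewrite wallis_0, wallis_1. generalize PI_RGT_0. lra.
    - split; auto. generalize (wallis_rec n). generalize (pos_INR n). nra. }
  apply H.
Qed.

Lemma wallis_decr (n : nat) : wallis (S n) <= wallis n.
Proof.
  apply RInt_mono; try (intros; apply continuous_cos_pow).
  - generalize PI_RGT_0; lra.
  - intros x Hx. simpl.
    assert (0 <= cos x) by (apply cos_ge_0; lra).
    assert (cos x <= 1) by apply COS_bound.
    assert (0 <= cos x ^ n) by (apply pow_le; lra). nra.
Qed.

(** The recurrence makes the product independent of [n]; with [wallis_decr] it confines the square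
    of [wallis n] between PI / (2 (n + 1)) and PI / (2 n). *)
Lemma wallis_prod (n : nat) : (INR n + 1) * (wallis n * wallis (S n)) = PI / 2.
Proof.
  induction n as [|n IH].
  - rewrite wallis_0, wallis_1. simpl. ring.
  - rewrite S_INR. generalize (wallis_rec n). intros H. rewrite <- IH.
    transitivity (wallis (S n) * ((INR n + 2) * wallis (S (S n)))); [ring|rewrite H; ring].
Qed.

Lemma wallis_sqr_lower (n : nat) : PI / 2 <= (INR n + 1) * wallis n ^ 2.
Proof.
  rewrite <- (wallis_prod n). generalize (wallis_decr n) (wallis_pos n) (pos_INR n). intros.
  apply Rmult_le_compat_l; [lra|]. simpl. nra.
Qed.

Lemma wallis_sqr_upper (n : nat) : (INR n + 1) * wallis (S n) ^ 2 <= PI / 2.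
Proof.
  rewrite <- (wallis_prod n). generalize (wallis_decr n) (wallis_pos (S n)) (pos_INR n). intros.
  apply Rmult_le_compat_l; [lra|]. simpl. nra.
Qed.

Definition wallis2 (n : nat) : R := RInt (fun x => x ^ 2 * cos x ^ (2 * n)) 0 (PI / 2).

Lemma continuous_wallis2 (n : nat) (x : R) : continuous (fun y => y ^ 2 * cos y ^ n) x.
Proof. apply cont_derive. auto_derive. auto. Qed.

(** For [a = 2 * n] and [c = n + 1] the coefficient of the mixed term x cos sin vanishes, and
    integration relates [wallis] and [wallis2] alone. *)
Lemma is_derive_basel (a : nat) (c x : R) :
  is_derive (fun x => x * cos x ^ S (S a) + c * x ^ 2 * cos x ^ S a * sin x) x
    (cos x ^ S (S a) + (2 * c - INR a - 2) * x * cos x ^ S a * sin x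
     + c * x ^ 2 * ((INR a + 2) * cos x ^ S (S a) - (INR a + 1) * cos x ^ a)).
Proof.
  auto_derive; auto.
  replace (match a with O => 1 | S _ => INR a + 1 end) with (INR a + 1) by (destruct a; simpl; ring).
  simpl pow. generalize (sin2_cos2' x). intros E. set (p := cos x ^ a).
  match goal with |- ?l = ?r =>
    transitivity (r - c * x * x * (INR a + 1) * p * (sin x * sin x - (1 - cos x * cos x))) end.
  - ring.
  - rewrite E. ring.
Qed.

(* Matsuoka: dividing by [wallis (2 * n)] makes this a telescoping sum for 1/n^2. *)
Lemma wallis2_rec (n : nat) :
  wallis (2 * S n) = INR (S n) * (2 * INR (S n) - 1) * wallis2 n - 2 * INR (S n) ^ 2 * wallis2 (S n).
Proof.
  assert (H : RInt (fun x => 1 * cos x ^ (2 * S n) + 1 * (2 * INR (S n) ^ 2 * (x ^ 2 * cos x ^ (2 * S n)) + - (INR (S n) * (2 * INR (S n) - 1)) * (x ^ 2 * cos x ^ (2 * n)))) 0 (PI / 2) = 0).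
  { replace (2 * S n)%nat with (S (S (2 * n))) by lia.
    rewrite (RInt_FTC (fun x => x * cos x ^ S (S (2 * n)) + INR (S n) * x ^ 2 * cos x ^ S (2 * n) * sin x)).
    - rewrite sin_0, cos_PI2. rewrite !pow_i by lia. req. ring.
    - intros x. eapply is_derive_eq; [apply is_derive_basel|].
      rewrite S_INR, mult_INR. simpl (INR 2). ring.
    - intros x. apply cont_derive. auto_derive. auto. }
  rewrite RInt_lincomb in H.
  - rewrite RInt_lincomb in H by (intros; apply continuous_wallis2).
    unfold wallis, wallis2. lra.
  - intros; apply continuous_cos_pow.
  - intros x. apply cont_derive. auto_derive. auto.
Qed.

Lemma wallis2_0 : wallis2 0 = PI ^ 3 / 24.
Proof.
  unfold wallis2. rewrite (RInt_FTC (fun x => x ^ 3 / 3)).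
  - req. field.
  - intros x. auto_derive; auto. simpl. field.
  - intros x. apply (continuous_wallis2 (2 * 0)).
Qed.

Lemma wallis2_pos (n : nat) : 0 <= wallis2 n.
Proof.
  unfold wallis2. replace 0 with (RInt (fun x : R => 0 * (x ^ 2 * cos x ^ (2 * n))) 0 (PI / 2)) at 1.
  - apply RInt_mono.
    + generalize PI_RGT_0; lra.
    + intros x. apply cont_derive. auto_derive. auto.
    + intros; apply continuous_wallis2.
    + intros x Hx. rewrite Rmult_0_l. apply Rmult_le_pos; [nra|].
      apply pow_le, cos_ge_0; lra.
  - replace 0 with (0 * 0 + 0 * 0) at 3 by ring.
    transitivity (RInt (fun x => 0 * (x ^ 2 * cos x ^ (2 * n)) + 0 * (x ^ 2 * cos x ^ (2 * n))) 0 (PI / 2)).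
    + apply RInt_ext. intros. req. ring.
    + rewrite RInt_lincomb by (intros; apply continuous_wallis2). req. ring.
Qed.

Lemma x_cos_le_sin (x : R) : 0 <= x <= PI -> x * cos x <= sin x.
Proof.
  intros Hx.
  destruct (Req_dec x 0) as [->|Hn]; [rewrite sin_0; lra|].
  destruct (MVT_le (fun y => sin y - y * cos y) (fun y => y * sin y) 0 x) as [c [Hc Hd]].
  - lra.
  - intros y _. auto_derive; auto. req. ring.
  - rewrite sin_0 in Hd.
    assert (0 <= c * sin c) by (apply Rmult_le_pos; [lra|apply sin_ge_0; lra]). nra.
Qed.

(** Squaring x cos x <= sin x gives x^2 cos^2 x <= 1 - cos^2 x; multiplied by cos^(2 n) x, the right
    side integrates to a difference of Wallis integrals. *)
Lemma wallis2_upper (n : nat) : wallis2 (S n) <= wallis (2 * n) - wallis (2 * S n).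
Proof.
  unfold wallis. 
  apply Rle_trans with (RInt (fun x => 1 * cos x ^ (2 * n) + -1 * cos x ^ (2 * S n)) 0 (PI / 2)).
  - apply RInt_mono.
    + generalize PI_RGT_0; lra.
    + intros; apply continuous_wallis2.
    + intros x. apply cont_derive. auto_derive. auto.
    + intros x Hx. replace (2 * S n)%nat with (S (S (2 * n))) by lia.
      assert (0 <= cos x) by (apply cos_ge_0; lra).
      assert (0 <= cos x ^ (2 * n)) by (apply pow_le; lra).
      assert (x * cos x <= sin x) by (apply x_cos_le_sin; lra).
      generalize (sin2_cos2' x). intros E.
      assert ((x * cos x) * (x * cos x) <= sin x * sin x) by (apply Rmult_le_compat; nra).
      simpl pow. set (c := cos x ^ (2 * n)) in *.
      replace (cos x ^ (n + (n + 0))) with c by (unfold c; f_equal; lia). nra.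
  - rewrite RInt_lincomb by (intros; apply continuous_cos_pow). lra.
Qed.

Lemma basel_partial (n : nat) :
  rsum (fun k => / INR (S k) ^ 2) n = PI ^ 2 / 6 - 2 * (wallis2 n / wallis (2 * n)).
Proof.
  induction n as [|n IH].
  - simpl rsum. rewrite wallis2_0. simpl (2 * 0)%nat. rewrite wallis_0. field. apply PI_neq0.
  - rewrite rsum_S, IH.
    assert (H1 := wallis2_rec n). assert (H2 := wallis_rec (2 * n)).
    replace (S (S (2 * n))) with (2 * S n)%nat in H2 by lia.
    rewrite mult_INR in H2. simpl (INR 2) in H2.
    assert (P1 := wallis_pos (2 * n)). assert (P2 := wallis_pos (2 * S n)).
    assert (Hn : 0 < INR (S n)) by (apply lt_0_INR; lia).
    assert (E : wallis (2 * n) = 2 * INR (S n) * wallis (2 * S n) / (2 * INR (S n) - 1)).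
    { rewrite S_INR in *. generalize (pos_INR n). intros. field_simplify_eq; lra. }
    assert (Hd : 2 * INR (S n) - 1 <> 0) by (rewrite S_INR; generalize (pos_INR n); lra).
    rewrite E.
    replace (wallis2 n) with ((wallis (2 * S n) + 2 * INR (S n) ^ 2 * wallis2 (S n)) / (INR (S n) * (2 * INR (S n) - 1))).
    + field. repeat split; lra.
    + rewrite H1. field. split; lra.
Qed.

Lemma basel_upper (n : nat) : rsum (fun k => / INR (S k) ^ 2) n <= PI ^ 2 / 6.
Proof.
  rewrite basel_partial. 
  assert (0 <= wallis2 n / wallis (2 * n)).
  { apply Rdiv_le_0_compat; [apply wallis2_pos|apply wallis_pos]. }
  lra.
Qed.

(** The defect in [basel_partial] is controlled by [wallis2_upper] and [wallis_rec]. The explicit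
    rate matters: [logPinf_crude] balances it against the number of terms. *)
Lemma basel_lower (n : nat) :
  PI ^ 2 / 6 - 2 / INR (S n) <= rsum (fun k => / INR (S k) ^ 2) (S n).
Proof.
  rewrite basel_partial.
  assert (H2 := wallis_rec (2 * n)).
  replace (S (S (2 * n))) with (2 * S n)%nat in H2 by lia.
  rewrite mult_INR in H2. simpl (INR 2) in H2.
  assert (P2 := wallis_pos (2 * S n)). assert (P1 := wallis_pos (2 * n)).
  assert (H := wallis2_upper n).
  assert (Hn := pos_INR n).
  assert (wallis2 (S n) / wallis (2 * S n) <= / INR (S n)).
  { apply Rmult_le_reg_r with (wallis (2 * S n)); [easy|].
    unfold Rdiv. rewrite Rmult_assoc, Rinv_l, Rmult_1_r by lra.
    apply Rle_trans with (1 := H). rewrite S_INR.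
    apply Rmult_le_reg_l with (INR n + 1); [lra|].
    rewrite <- Rmult_assoc, Rinv_r, Rmult_1_l by lra. nra. }
  lra.
Qed.

Lemma tri_INR (n : nat) : INR (tri n) = INR n * (INR n + 1) / 2.
Proof.
  induction n as [|n IH]; [simpl; field|].
  change (tri (S n)) with (tri n + S n)%nat. rewrite plus_INR, IH, !S_INR. field.
Qed.

Lemma hterm_neg (J m n : nat) (z : Z) : (z < 0)%Z -> hterm J m n z = 0.
Proof.
  intros Hz. unfold hterm. replace (Z.to_nat z) with 0%nat by lia. simpl.
  rewrite pz_neg by lia. ring.
Qed.

Lemma hterm_extend (J m n B : nat) (z : Z) : (0 < m)%nat -> (0 < n)%nat -> (Z.to_nat z <= B)%nat ->
  hterm J m n z = rsum (fun l => pz J (z - Z.of_nat (m * (tri n + n * l)))) (S B).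
Proof.
  intros Hm Hn HB. unfold hterm.
  replace (S B) with (S (Z.to_nat z) + (B - Z.to_nat z))%nat by lia.
  rewrite rsum_split.
  replace (rsum (fun i => _) (B - Z.to_nat z)) with 0; [rewrite Rplus_0_r; reflexivity|].
  symmetry. rewrite (rsum_ext _ (fun _ => 0)).
  - rewrite rsum_const. ring.
  - intros k _. apply pz_neg.
    assert (Z.to_nat z < m * (tri n + n * (S (Z.to_nat z) + k)))%nat by nia. lia.
Qed.

(** Raising [l] by one shifts the index by m n, so only the term l = 0 survives: the coefficient
    form of multiplying by 1 - q^(m n). *)
Lemma hterm_rec (J m n : nat) (z : Z) : (0 < m)%nat -> (0 < n)%nat ->
  hterm J m n z - hterm J m n (z - Z.of_nat (m * n)) = pz J (z - Z.of_nat (m * tri n)).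
Proof.
  intros Hm Hn.
  rewrite (hterm_extend J m n (S (Z.to_nat z)) z) by lia.
  rewrite (hterm_extend J m n (Z.to_nat z) (z - _)) by lia.
  change (S (S (Z.to_nat z))) with (1 + S (Z.to_nat z))%nat. rewrite rsum_split.
  simpl rsum at 1. rewrite Nat.mul_0_r, Nat.add_0_r, Rplus_0_l.
  rewrite (rsum_ext (fun i => pz J (z - Z.of_nat (m * (tri n + n * (1 + i))))) 
     (fun l => pz J (z - Z.of_nat (m * n) - Z.of_nat (m * (tri n + n * l))))).
  - ring.
  - intros k _. f_equal. lia.
Qed.

(** * Complex-valued functions of a real variable *)

Definition cis (x : R) : C := (cos x, sin x).
Definition Cexp (z : C) : C := (exp (Re z) * cos (Im z), exp (Re z) * sin (Im z)).

Lemma C_eq (z w : C) : Re z = Re w -> Im z = Im w -> z = w.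
Proof. destruct z, w; simpl; intros; congruence. Qed.

Lemma Cexp_plus (z w : C) : Cexp (z + w) = (Cexp z * Cexp w)%C.
Proof.
  destruct z as [a b], w as [c d]. unfold Cexp, Cmult, Cplus. simpl.
  rewrite exp_plus, cos_plus, sin_plus. f_equal; ring.
Qed.

Lemma Cexp_0 : Cexp 0 = 1.
Proof. unfold Cexp. simpl. rewrite exp_0, cos_0, sin_0. apply C_eq; simpl; ring. Qed.

Lemma Cmod_pair (a b : R) : Cmod (a, b) = sqrt (a ^ 2 + b ^ 2).
Proof. reflexivity. Qed.

Lemma Cmod_Cexp (z : C) : Cmod (Cexp z) = exp (Re z).
Proof.
  unfold Cexp. rewrite Cmod_pair. set (e := exp _).
  replace ((e * cos (Im z)) ^ 2 + (e * sin (Im z)) ^ 2) with (e ^ 2 * ((sin (Im z))² + (cos (Im z))²))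
    by (unfold Rsqr; ring).
  rewrite sin2_cos2, Rmult_1_r. apply sqrt_pow2. left. apply exp_pos.
Qed.

Lemma Cexp_neq_0 (z : C) : Cexp z <> 0.
Proof.
  intros H. assert (E := Cmod_Cexp z). rewrite H, Cmod_0 in E. generalize (exp_pos (Re z)). lra.
Qed.

Lemma Cmod_sqr (z : C) : Cmod z ^ 2 = Re z ^ 2 + Im z ^ 2.
Proof.
  destruct z as [a b]. rewrite Cmod_pair. simpl Re. simpl Im. rewrite pow2_sqrt; [easy|nra].
Qed.

Lemma Re_le_Cmod (z : C) : Rabs (Re z) <= Cmod z.
Proof.
  generalize (Cmod_sqr z) (Cmod_ge_0 z). intros. apply Rabs_le. nra.
Qed.

Lemma Cmod_le_Re_Im (z : C) : Cmod z <= Rabs (Re z) + Rabs (Im z).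
Proof.
  generalize (Cmod_sqr z) (Cmod_ge_0 z) (Rabs_pos (Re z)) (Rabs_pos (Im z))
    (pow2_abs (Re z)) (pow2_abs (Im z)). intros. nra.
Qed.

Lemma Cmod_triangle_minus (z w : C) : Cmod (z - w) <= Cmod z + Cmod w.
Proof. unfold Cminus. rewrite <- (Cmod_opp w). apply Cmod_triangle. Qed.

Lemma Cmod_triangle_inv (z w : C) : Cmod z - Cmod w <= Cmod (z - w).
Proof.
  assert (Cmod z <= Cmod (z - w) + Cmod w); [|lra].
  replace z with ((z - w) + w)%C at 1 by ring. apply Cmod_triangle.
Qed.

Lemma Cmod_neq_0 (z : C) : 0 < Cmod z -> z <> 0.
Proof. intros H E. rewrite E, Cmod_0 in H. lra. Qed.

(** Complex functions are differentiated only in a real variable, component by component; complex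
    differentiability is never involved. *)
Definition cder (f : R -> C) (x : R) (l : C) : Prop :=
  is_derive (fun y => Re (f y)) x (Re l) /\ is_derive (fun y => Im (f y)) x (Im l).

Lemma cder_eq (f : R -> C) (x : R) (l l' : C) : cder f x l -> l = l' -> cder f x l'.
Proof. intros H E. now rewrite <- E. Qed.

Lemma cder_const (c : C) (x : R) : cder (fun _ => c) x 0.
Proof. split; apply (is_derive_const (K := R_AbsRing) (V := R_NormedModule)). Qed.

Lemma cder_plus (f g : R -> C) (x : R) (l k : C) :
  cder f x l -> cder g x k -> cder (fun y => f y + g y)%C x (l + k).
Proof. intros [H1 H2] [H3 H4]. split; simpl; now apply (is_derive_plus (K := R_AbsRing) (V := R_NormedModule)). Qed.

Lemma cder_opp (f : R -> C) (x : R) (l : C) : cder f x l -> cder (fun y => - f y)%C x (- l).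
Proof. intros [H1 H2]. split; simpl; now apply (is_derive_opp (K := R_AbsRing) (V := R_NormedModule)). Qed.

Lemma cder_minus (f g : R -> C) (x : R) (l k : C) :
  cder f x l -> cder g x k -> cder (fun y => f y - g y)%C x (l - k).
Proof. intros H1 H2. apply cder_plus; [easy|now apply cder_opp]. Qed.

Lemma is_derive_mult' (f g : R -> R) (x l k : R) :
  is_derive f x l -> is_derive g x k -> is_derive (fun y => f y * g y) x (l * g x + f x * k).
Proof. intros H1 H2. apply (is_derive_mult f g); auto. intros; apply Rmult_comm. Qed.

Lemma cder_mult (f g : R -> C) (x : R) (l k : C) :
  cder f x l -> cder g x k -> cder (fun y => f y * g y)%C x (l * g x + f x * k).
Proof.
  intros [H1 H2] [H3 H4]. split.
  - eapply is_derive_eq.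
    + apply (is_derive_minus (K := R_AbsRing) (V := R_NormedModule)); apply is_derive_mult'; eassumption.
    + unfold minus, plus, opp; unfold Re, Im; simpl. req. ring.
  - eapply is_derive_eq.
    + apply (is_derive_plus (K := R_AbsRing) (V := R_NormedModule)); apply is_derive_mult'; eassumption.
    + unfold plus; unfold Re, Im; simpl. req. ring.
Qed.

Lemma cder_RtoC (f : R -> R) (x l : R) : is_derive f x l -> cder (fun y => RtoC (f y)) x (RtoC l).
Proof. intros H. split; simpl; [easy|apply (is_derive_const (K := R_AbsRing) (V := R_NormedModule))]. Qed.

Lemma cder_scal (c : C) (f : R -> C) (x : R) (l : C) : cder f x l -> cder (fun y => c * f y)%C x (c * l).
Proof.
  intros H. eapply cder_eq; [apply cder_mult; [apply cder_const|exact H]|]. simpl. ring.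
Qed.

Lemma cder_Cexp (f : R -> C) (x : R) (l : C) :
  cder f x l -> cder (fun y => Cexp (f y)) x (l * Cexp (f x)).
Proof.
  intros [H1 H2].
  assert (He : is_derive (fun y => exp (Re (f y))) x (Re l * exp (Re (f x)))).
  { apply (is_derive_comp exp); [|exact H1]. auto_derive; auto. apply Rmult_1_l. }
  assert (Hc : is_derive (fun y => cos (Im (f y))) x (Im l * - sin (Im (f x)))).
  { apply (is_derive_comp cos); [|exact H2]. auto_derive; auto. apply Rmult_1_l. }
  assert (Hs : is_derive (fun y => sin (Im (f y))) x (Im l * cos (Im (f x)))).
  { apply (is_derive_comp sin); [|exact H2]. auto_derive; auto. apply Rmult_1_l. }
  split; simpl; (eapply is_derive_eq; [apply is_derive_mult'; eassumption|]); unfold Re, Im; simpl; req; ring.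
Qed.

Lemma cder_inv (f : R -> C) (x : R) (l : C) : f x <> 0 ->
  cder f x l -> cder (fun y => / f y)%C x (- l / (f x * f x)).
Proof.
  intros Hn [H1 H2].
  assert (Hd : Re (f x) ^ 2 + Im (f x) ^ 2 <> 0).
  { rewrite <- Cmod_sqr. apply pow_nonzero. intros H. now apply Hn, Cmod_eq_0. }
  assert (Hi : is_derive (fun y => / (Re (f y) ^ 2 + Im (f y) ^ 2)) x
    (- (2 * Re (f x) * Re l + 2 * Im (f x) * Im l) / (Re (f x) ^ 2 + Im (f x) ^ 2) ^ 2)).
  { apply (is_derive_inv (fun y => Re (f y) ^ 2 + Im (f y) ^ 2)); [|easy].
    apply (is_derive_plus (K := R_AbsRing) (V := R_NormedModule)).
    - eapply is_derive_eq; [apply (is_derive_pow _ 2); exact H1|]. simpl. ring.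
    - eapply is_derive_eq; [apply (is_derive_pow _ 2); exact H2|]. simpl. ring. }
  assert (Hd' : Re (f x) * Re (f x) + Im (f x) * Im (f x) <> 0) by (intros E; apply Hd; rewrite <- E; ring).
  split.
  - eapply is_derive_eq.
    + apply is_derive_mult'; [exact H1|exact Hi].
    + clear H1 H2 Hi. cbv beta. unfold Re, Im in *. destruct (f x) as [a b], l as [c d]. simpl in *. req. field. split; nra.
  - apply (is_derive_ext (fun y => (- Im (f y)) * / (Re (f y) ^ 2 + Im (f y) ^ 2))).
    { intros y. reflexivity. }
    eapply is_derive_eq.
    + apply is_derive_mult'; [apply (is_derive_opp (K := R_AbsRing) (V := R_NormedModule)); exact H2|exact Hi].
    + clear H1 H2 Hi. cbv beta. unfold opp, Re, Im in *. destruct (f x) as [a b], l as [c d]. simpl in *. req. field. split; nra.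
Qed.

(* The mean value inequality, reduced to the real mean value theorem by projecting on the direction of the increment. *)
Lemma cder_mean_value (f f' : R -> C) (a b M : R) : a <= b ->
  (forall x, a <= x <= b -> cder f x (f' x)) ->
  (forall x, a <= x <= b -> Cmod (f' x) <= M) -> Cmod (f b - f a) <= M * (b - a).
Proof.
  intros Hab Hf HM. set (w := (f b - f a)%C).
  destruct (MVT_le (fun x => Re w * Re (f x) + Im w * Im (f x))
    (fun x => Re w * Re (f' x) + Im w * Im (f' x)) a b Hab) as [c [Hc E]].
  - intros x Hx. destruct (Hf x Hx).
    apply (is_derive_plus (K := R_AbsRing) (V := R_NormedModule)); now apply (is_derive_scal (fun y => _)).
  - assert (E' : Cmod w ^ 2 = (Re w * Re (f' c) + Im w * Im (f' c)) * (b - a)).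
    { rewrite <- E, Cmod_sqr. unfold w, Re, Im. simpl. ring. }
    assert (H : Re w * Re (f' c) + Im w * Im (f' c) <= Cmod w * Cmod (f' c)).
    { replace (Re w * Re (f' c) + Im w * Im (f' c)) with (Re (Cconj w * f' c)) by (unfold Re, Im; simpl; ring).
      rewrite <- (Cmod_conj w), <- Cmod_mult. eapply Rle_trans; [apply Rle_abs|apply Re_le_Cmod]. }
    assert (H2 := HM c Hc). assert (H3 := Cmod_ge_0 w).
    destruct (Req_dec (Cmod w) 0) as [E0|N0].
    + rewrite E0. apply Rmult_le_pos; [|lra]. generalize (Cmod_ge_0 (f' c)). lra.
    + apply Rmult_le_reg_l with (Cmod w); [lra|].
      apply Rle_trans with (Cmod w * Cmod (f' c) * (b - a)).
      * replace (Cmod w * Cmod w) with (Cmod w ^ 2) by ring. rewrite E'.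
        apply Rmult_le_compat_r; lra.
      * rewrite Rmult_assoc. apply Rmult_le_compat_l; [lra|]. apply Rmult_le_compat_r; lra.
Qed.

Fixpoint csum (f : nat -> C) (n : nat) : C :=
  match n with O => RtoC 0 | S k => (csum f k + f k)%C end.

Fixpoint cprod (f : nat -> C) (n : nat) : C :=
  match n with O => RtoC 1 | S k => (cprod f k * f k)%C end.

Lemma csum_ext (f g : nat -> C) (n : nat) :
  (forall k, (k < n)%nat -> f k = g k) -> csum f n = csum g n.
Proof.
  induction n as [|n IH]; intros H; simpl; [easy|].
  rewrite IH, (H n) by (intros; apply H || lia; lia). easy.
Qed.

Lemma csum_plus (f g : nat -> C) (n : nat) : csum (fun k => f k + g k)%C n = (csum f n + csum g n)%C.
Proof. induction n as [|n IH]; simpl; [|rewrite IH]; ring. Qed.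

Lemma csum_scal (c : C) (f : nat -> C) (n : nat) : csum (fun k => c * f k)%C n = (c * csum f n)%C.
Proof. induction n as [|n IH]; simpl; [|rewrite IH]; ring. Qed.

Lemma csum_minus (f g : nat -> C) (n : nat) : csum (fun k => f k - g k)%C n = (csum f n - csum g n)%C.
Proof. induction n as [|n IH]; simpl; [|rewrite IH]; ring. Qed.

Lemma csum_split (f : nat -> C) (n k : nat) :
  csum f (n + k) = (csum f n + csum (fun i => f (n + i)%nat) k)%C.
Proof.
  induction k as [|k IH].
  - rewrite Nat.add_0_r. simpl. ring.
  - rewrite Nat.add_succ_r. simpl. rewrite IH. ring.
Qed.

Lemma csum_RtoC (f : nat -> R) (n : nat) : csum (fun k => RtoC (f k)) n = RtoC (rsum f n).
Proof. induction n as [|n IH]; simpl; [easy|]. now rewrite IH, RtoC_plus. Qed.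

Lemma Cmod_csum (f : nat -> C) (n : nat) : Cmod (csum f n) <= rsum (fun k => Cmod (f k)) n.
Proof.
  induction n as [|n IH]; simpl; [rewrite Cmod_0; lra|].
  eapply Rle_trans; [apply Cmod_triangle|]. lra.
Qed.

Lemma Cmod_cprod (f : nat -> C) (g : nat -> R) (n : nat) :
  (forall k, (k < n)%nat -> Cmod (f k) <= exp (g k)) ->
  Cmod (cprod f n) <= exp (rsum g n).
Proof.
  induction n as [|n IH]; intros H; simpl.
  - rewrite Cmod_1, exp_0. lra.
  - rewrite Cmod_mult, exp_plus. apply Rmult_le_compat; try apply Cmod_ge_0; auto.
Qed.

(** Its purpose is the continuity, hence integrability, of real and imaginary parts. *)
Definition cdiff (f : R -> C) : Prop := forall x, exists l, cder f x l.

Lemma cdiff_const (c : C) : cdiff (fun _ => c).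
Proof. intros x. exists 0. apply cder_const. Qed.

Lemma cdiff_plus (f g : R -> C) : cdiff f -> cdiff g -> cdiff (fun x => f x + g x)%C.
Proof. intros Hf Hg x. destruct (Hf x), (Hg x). eexists. apply cder_plus; eassumption. Qed.

Lemma cdiff_minus (f g : R -> C) : cdiff f -> cdiff g -> cdiff (fun x => f x - g x)%C.
Proof. intros Hf Hg x. destruct (Hf x), (Hg x). eexists. apply cder_minus; eassumption. Qed.

Lemma cdiff_mult (f g : R -> C) : cdiff f -> cdiff g -> cdiff (fun x => f x * g x)%C.
Proof. intros Hf Hg x. destruct (Hf x), (Hg x). eexists. apply cder_mult; eassumption. Qed.

Lemma cdiff_inv (f : R -> C) : cdiff f -> (forall x, f x <> 0) -> cdiff (fun x => / f x)%C.
Proof. intros Hf Hn x. destruct (Hf x). eexists. apply cder_inv; eauto. Qed.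

Lemma cdiff_div (f g : R -> C) : cdiff f -> cdiff g -> (forall x, g x <> 0) -> cdiff (fun x => f x / g x)%C.
Proof. intros. apply cdiff_mult; [|apply cdiff_inv]; assumption. Qed.

Lemma cdiff_Cexp (f : R -> C) : cdiff f -> cdiff (fun x => Cexp (f x)).
Proof. intros Hf x. destruct (Hf x). eexists. apply cder_Cexp; eassumption. Qed.

Lemma cdiff_csum (f : nat -> R -> C) (n : nat) : (forall k, cdiff (f k)) -> cdiff (fun x => csum (fun k => f k x) n).
Proof. intros H. induction n as [|n IH]; simpl; [apply cdiff_const|now apply cdiff_plus]. Qed.

Lemma cdiff_cprod (f : nat -> R -> C) (n : nat) : (forall k, cdiff (f k)) -> cdiff (fun x => cprod (fun k => f k x) n).
Proof. intros H. induction n as [|n IH]; simpl; [apply cdiff_const|now apply cdiff_mult]. Qed.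

Lemma cdiff_cont_Re (f : R -> C) : cdiff f -> forall x, continuous (fun y => Re (f y)) x.
Proof. intros H x. destruct (H x) as [l [Hl _]]. apply (cont_derive (fun y => Re (f y))). now exists (Re l). Qed.

Lemma cdiff_cont_Im (f : R -> C) : cdiff f -> forall x, continuous (fun y => Im (f y)) x.
Proof. intros H x. destruct (H x) as [l [_ Hl]]. apply (cont_derive (fun y => Im (f y))). now exists (Im l). Qed.

Definition ctau (t y : R) : C := (t, - y).

Lemma cder_tau (t x : R) : cder (ctau t) x (0, -1).
Proof.
  split; simpl.
  - apply (is_derive_const (K := R_AbsRing) (V := R_NormedModule)).
  - auto_derive; auto.
Qed.

Lemma cdiff_tau (t : R) : cdiff (ctau t).
Proof. intros x. eexists. apply cder_tau. Qed.

(* [qpow tau x] is [q^x] for [q = exp (-tau)]. *)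
Definition qpow (tau : C) (x : R) : C := Cexp (RtoC (- x) * tau).

Lemma Cmod_qpow (tau : C) (x : R) : Cmod (qpow tau x) = exp (- x * Re tau).
Proof. unfold qpow. rewrite Cmod_Cexp. f_equal. destruct tau. unfold Re, Im. simpl. ring. Qed.

Lemma exp_lt_1 (x : R) : x < 0 -> exp x < 1.
Proof. intros. rewrite <- exp_0. now apply exp_increasing. Qed.

Lemma exp_le_mono (x y : R) : x <= y -> exp x <= exp y.
Proof. intros [H| ->]; [left; now apply exp_increasing|right; easy]. Qed.

Lemma one_minus_qpow_lower (tau : C) (x : R) : 1 - exp (- x * Re tau) <= Cmod (1 - qpow tau x).
Proof. rewrite <- Cmod_qpow. generalize (Cmod_triangle_inv 1 (qpow tau x)). rewrite Cmod_1. easy. Qed.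

Lemma one_minus_qpow_neq_0 (tau : C) (x : R) : 0 < x -> 0 < Re tau -> (1 - qpow tau x)%C <> 0.
Proof.
  intros Hx Ht. apply Cmod_neq_0. eapply Rlt_le_trans; [|apply one_minus_qpow_lower].
  assert (exp (- x * Re tau) < 1) by (apply exp_lt_1; nra). lra.
Qed.

Lemma cdiff_qpow (t x : R) : cdiff (fun y => qpow (ctau t y) x).
Proof. apply cdiff_Cexp, cdiff_mult; [apply cdiff_const|apply cdiff_tau]. Qed.

Lemma qpow_cis (t x y : R) : qpow (ctau t y) x = (exp (- x * t) * cis (x * y))%C.
Proof.
  unfold qpow, Cexp, cis. apply C_eq; unfold Re, Im; simpl.
  - rewrite !Rmult_0_l, !Rminus_0_r. do 2 f_equal; ring.
  - rewrite !Rmult_0_l, !Rplus_0_r. do 2 f_equal; ring.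
Qed.

Lemma cis_plus (x y : R) : cis (x + y) = (cis x * cis y)%C.
Proof. unfold cis, Cmult. simpl. rewrite cos_plus, sin_plus. f_equal; ring. Qed.

Lemma Cmod_cis (x : R) : Cmod (cis x) = 1.
Proof.
  unfold cis. rewrite Cmod_pair. replace (cos x ^ 2 + sin x ^ 2) with ((sin x)² + (cos x)²) by (unfold Rsqr; ring).
  now rewrite sin2_cos2, sqrt_1.
Qed.

Lemma cder_cis (c x : R) : cder (fun y => cis (c * y)) x (Ci * c * cis (c * x)).
Proof.
  split; unfold cis, Re, Im; simpl; auto_derive; auto; req; ring.
Qed.

Lemma cdiff_cis (c : R) : cdiff (fun y => cis (c * y)).
Proof. intros x. eexists. apply cder_cis. Qed.

(** * Coefficient extraction *)

(* The [n]-th coefficient of the Laurent series of [g] on the circle [|q| = exp (-t)], [q = exp (-t + i y)]; [g] is given as a function of the angle. *)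
Definition coef (t : R) (n : Z) (g : R -> C) : R :=
  exp (t * IZR n) / (2 * PI) * RInt (fun y => Re (g y * cis (- IZR n * y))) (- PI) PI.

Lemma coef_integrand_cont (n : Z) (g : R -> C) : cdiff g ->
  forall x, continuous (fun y => Re (g y * cis (- IZR n * y))) x.
Proof. intros H. apply cdiff_cont_Re, cdiff_mult; [easy|apply cdiff_cis]. Qed.

Lemma coef_lincomb (t : R) (n : Z) (a b : R) (f g : R -> C) : cdiff f -> cdiff g ->
  coef t n (fun y => a * f y + b * g y)%C = a * coef t n f + b * coef t n g.
Proof.
  intros Hf Hg. unfold coef.
  rewrite (RInt_ext _ (fun y => a * Re (f y * cis (- IZR n * y)) + b * Re (g y * cis (- IZR n * y)))).
  - rewrite RInt_lincomb by (now apply coef_integrand_cont). ring.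
  - intros y _. unfold Re, Im. simpl. req. ring.
Qed.

Lemma coef_ext (t : R) (n : Z) (f g : R -> C) : (forall y, f y = g y) -> coef t n f = coef t n g.
Proof. intros H. unfold coef. f_equal. apply RInt_ext. intros. now rewrite H. Qed.

Lemma coef_0 (t : R) (n : Z) : coef t n (fun _ => RtoC 0) = 0.
Proof.
  rewrite (coef_ext _ _ _ (fun y => 0 * RtoC 0 + 0 * RtoC 0)%C) by (intros; ring).
  rewrite coef_lincomb by apply cdiff_const. ring.
Qed.

Lemma coef_sum (t : R) (n : Z) (a : nat -> R) (f : nat -> R -> C) (k : nat) : (forall i, cdiff (f i)) ->
  coef t n (fun y => csum (fun i => a i * f i y)%C k) = rsum (fun i => a i * coef t n (f i)) k.
Proof.
  intros H. induction k as [|k IH]; simpl; [apply coef_0|].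
  rewrite <- IH.
  rewrite (coef_ext _ _ _ (fun y => 1 * csum (fun i => a i * f i y) k + a k * f k y)%C) by (intros; ring).
  rewrite coef_lincomb; [ring| |easy].
  apply (cdiff_csum (fun i y => a i * f i y)%C). intros i. apply cdiff_mult; [apply cdiff_const|easy].
Qed.

(** On the circle q^s = e^(-s t) e^(i s y): the phase lowers the frequency by s, and the modulus
    turns the normalising factor e^(t n) into e^(t (n - s)). *)
Lemma coef_qpow_mult (t : R) (n : Z) (s : nat) (g : R -> C) : cdiff g ->
  coef t n (fun y => qpow (ctau t y) (INR s) * g y)%C = coef t (n - Z.of_nat s) g.
Proof.
  intros Hg. unfold coef. rewrite minus_IZR, <- INR_IZR_INZ.
  transitivity (exp (t * IZR n) / (2 * PI) * RInt (fun y => scal (exp (- INR s * t)) (Re (g y * cis (- (IZR n - INR s) * y)))) (- PI) PI).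
  - f_equal. apply RInt_ext. intros y _. rewrite qpow_cis.
    replace (- (IZR n - INR s) * y) with (INR s * y + - IZR n * y) by ring. rewrite cis_plus.
    unfold scal, Re, Im; simpl. unfold mult; simpl. req. ring.
  - rewrite (RInt_scal (V := R_CompleteNormedModule) (fun y => Re (g y * cis (- (IZR n - INR s) * y)))).
    + unfold scal; simpl; unfold mult; simpl.
      replace (t * (IZR n - INR s)) with (t * IZR n + - INR s * t) by ring. rewrite exp_plus. 
      field. apply PI_neq0.
    + apply ex_RInt_cont. intros x.
      apply (cdiff_cont_Re (fun y => g y * cis (- (IZR n - INR s) * y))%C).
      apply cdiff_mult; [easy|apply cdiff_cis].
Qed.

Lemma coef_1 (t : R) (n : Z) : coef t n (fun _ => RtoC 1) = if Z.eqb n 0 then 1 else 0.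
Proof.
  unfold coef. assert (Hpi := PI_RGT_0).
  rewrite (RInt_ext _ (fun y => cos (IZR n * y))).
  2:{ intros y _. unfold cis, Re. simpl. rewrite Rmult_1_l, Rmult_0_l, Rminus_0_r.
      rewrite Ropp_mult_distr_l_reverse. apply cos_neg. }
  destruct (Z.eqb_spec n 0) as [->|Hn].
  - rewrite (RInt_ext _ (fun _ => 1)).
    + rewrite RInt_const. unfold scal; simpl; unfold mult; simpl. rewrite Rmult_0_r, exp_0. field. lra.
    + intros y _. rewrite Rmult_0_l. apply cos_0.
  - assert (Hn' : IZR n <> 0) by now apply IZR_neq.
    rewrite (RInt_FTC (fun y => sin (IZR n * y) / IZR n)).
    + assert (E : sin (IZR n * PI) = 0) by (apply sin_eq_0_1; now exists n).
      replace (IZR n * - PI) with (- (IZR n * PI)) by ring. rewrite sin_neg, E. field. lra.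
    + intros y. auto_derive; auto. req. field. easy.
    + intros y. apply (cont_derive (fun z => cos (IZR n * z))). auto_derive. auto.
Qed.

(** As [M] is independent of [n], the factor e^(t n) forces decay when n tends to minus infinity. *)
Lemma coef_bound (t : R) (g : R -> C) : cdiff g ->
  exists M, forall n, Rabs (coef t n g) <= exp (t * IZR n) * M.
Proof.
  intros Hg. assert (Hpi := PI_RGT_0).
  exists (/ (2 * PI) * RInt (fun y => Rabs (Re (g y)) + Rabs (Im (g y))) (- PI) PI).
  intros n. unfold coef, Rdiv. rewrite !Rabs_mult.
  rewrite (Rabs_right (exp _)) by (left; apply exp_pos).
  rewrite (Rabs_right (/ _)) by (left; apply Rinv_0_lt_compat; lra).
  rewrite Rmult_assoc. apply Rmult_le_compat_l; [left; apply exp_pos|].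
  apply Rmult_le_compat_l; [left; apply Rinv_0_lt_compat; lra|].
  assert (C1 := cdiff_cont_Re g Hg). assert (C2 := cdiff_cont_Im g Hg).
  assert (C3 : forall x, continuous (fun y => Rabs (Re (g y)) + Rabs (Im (g y))) x).
  { intros x. apply (continuous_plus (V := R_NormedModule)).
    - apply (continuous_comp (fun y => Re (g y)) Rabs); [apply C1|apply continuous_Rabs].
    - apply (continuous_comp (fun y => Im (g y)) Rabs); [apply C2|apply continuous_Rabs]. }
  assert (C4 := coef_integrand_cont n g Hg).
  eapply Rle_trans; [apply abs_RInt_le; [lra|now apply ex_RInt_cont]|].
  apply RInt_mono; auto; [lra| |].
  - intros x. apply (continuous_comp _ Rabs); [apply C4|apply continuous_Rabs].
  - intros y _. eapply Rle_trans; [apply Re_le_Cmod|]. rewrite Cmod_mult, Cmod_cis, Rmult_1_r.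
    apply Cmod_le_Re_Im.
Qed.

(* The two sequences differ by a [k]-periodic sequence, which tends to [0] at [-oo]. *)
Lemma coef_geometric (t : R) (k : nat) (g G : R -> C) (b b' : Z -> R) : 0 < t -> (0 < k)%nat ->
  cdiff g -> cdiff G -> (forall y, G y - qpow (ctau t y) (INR k) * G y = g y)%C ->
  (forall n, coef t n g = b n) -> (forall n, b' n - b' (n - Z.of_nat k)%Z = b n) ->
  (forall n, (n < 0)%Z -> b' n = 0) -> forall n, coef t n G = b' n.
Proof.
  intros Ht Hk Hg HG E Eb Eb' Hneg n.
  assert (Hrec : forall n, coef t n G - coef t (n - Z.of_nat k) G = b n).
  { intros z. rewrite <- Eb.
    rewrite (coef_ext t z g (fun y => 1 * G y + (-1) * (qpow (ctau t y) (INR k) * G y))%C).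
    - rewrite coef_lincomb, coef_qpow_mult; auto; [ring|].
      apply cdiff_mult; [apply cdiff_qpow|easy].
    - intros y. rewrite <- E. ring. }
  assert (Hper : forall j, coef t n G - b' n = coef t (n - Z.of_nat (j * k)) G - b' (n - Z.of_nat (j * k))%Z).
  { induction j as [|j IH].
    - simpl. now rewrite Z.sub_0_r.
    - rewrite IH. assert (H1 := Hrec (n - Z.of_nat (j * k))%Z). assert (H2 := Eb' (n - Z.of_nat (j * k))%Z).
      replace (n - Z.of_nat (S j * k))%Z with (n - Z.of_nat (j * k) - Z.of_nat k)%Z by lia. lra. }
  destruct (coef_bound t G HG) as [M HM].
  (* After [i >= j] periods the index is negative, where [b'] is 0 and the coefficient carries a
     factor exp (-t i k) <= 1 / (1 + t j). A fixed number whose product with 1 + t j stays bounded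
     for all [j] must be 0. *)
  assert (Hle : forall j : nat, Rabs (coef t n G - b' n) * (1 + t * INR j) <= Rabs M * exp (t * IZR n)).
  { intros j. set (i := (j + Z.to_nat n + 1)%nat).
    rewrite (Hper i). rewrite (Hneg (n - Z.of_nat (i * k))%Z) by nia. rewrite Rminus_0_r.
    assert (H := HM (n - Z.of_nat (i * k))%Z).
    rewrite minus_IZR, <- INR_IZR_INZ, Rmult_minus_distr_l in H. unfold Rminus in H. rewrite exp_plus in H.
    assert (Hexp : exp (- (t * INR (i * k))) * (1 + t * INR j) <= 1).
    { apply Rmult_le_reg_l with (exp (t * INR (i * k))); [apply exp_pos|].
      rewrite <- Rmult_assoc, <- exp_plus. rewrite Rplus_opp_r, exp_0, Rmult_1_l, Rmult_1_r.
      assert (INR j <= INR (i * k)) by (apply le_INR; unfold i; nia).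
      eapply Rle_trans; [|left; apply exp_ineq1].
      - nra.
      - assert (0 < INR (i * k)) by (apply lt_0_INR; unfold i; nia). nra. }
    assert (P1 := exp_pos (t * IZR n)). assert (P2 := exp_pos (- (t * INR (i * k)))).
    assert (P3 := Rle_abs M). assert (P4 := pos_INR j). assert (P5 := Rabs_pos M).
    assert (P6 : 0 <= 1 + t * INR j) by nra.
    eapply Rle_trans; [apply Rmult_le_compat_r; [easy|exact H]|].
    apply Rle_trans with (exp (t * IZR n) * Rabs M * (exp (- (t * INR (i * k))) * (1 + t * INR j))).
    - replace (exp (t * IZR n) * Rabs M * (exp (- (t * INR (i * k))) * (1 + t * INR j))) with
       (exp (t * IZR n) * exp (- (t * INR (i * k))) * Rabs M * (1 + t * INR j)) by ring.
      apply Rmult_le_compat_r; [easy|]. apply Rmult_le_compat_l; [nra|easy].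
    - rewrite (Rmult_comm (Rabs M)). rewrite <- (Rmult_1_r (_ * Rabs M)) at 2.
      apply Rmult_le_compat_l; [nra|easy]. }
  destruct (Req_dec (coef t n G - b' n) 0) as [|Hne]; [lra|exfalso].
  assert (Hd := Rabs_pos_lt _ Hne). set (d := Rabs _) in *.
  destruct (INR_archimed (d * t) (Rabs M * exp (t * IZR n))) as [j Hj]; [nra|].
  specialize (Hle j). nra.
Qed.

Definition partition_gf (J : nat) (tau : C) : C := cprod (fun j => / (1 - qpow tau (INR (S j))))%C J.

(* h(q^m) truncated after [N] terms; the others do not contribute to the coefficient of q^N. *)
Definition string_gf (m N : nat) (tau : C) : C :=
  csum (fun i => RtoC ((-1) ^ i) * (qpow tau (INR (m * tri (S i))) / (1 - qpow tau (INR (m * S i)))))%C N.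

Lemma one_minus_qpow_neq_0_nat (t y : R) (k : nat) : 0 < t -> (0 < k)%nat -> (1 - qpow (ctau t y) (INR k))%C <> 0.
Proof. intros Ht Hk. apply one_minus_qpow_neq_0; [now apply lt_0_INR|easy]. Qed.

Lemma cdiff_one_minus_qpow (t x : R) : cdiff (fun y => 1 - qpow (ctau t y) x)%C.
Proof. apply cdiff_minus; [apply cdiff_const|apply cdiff_qpow]. Qed.

Lemma cdiff_partition_gf (t : R) (J : nat) : 0 < t -> cdiff (fun y => partition_gf J (ctau t y)).
Proof.
  intros Ht. apply (cdiff_cprod (fun j y => / (1 - qpow (ctau t y) (INR (S j))))%C). intros j.
  apply cdiff_inv; [apply cdiff_one_minus_qpow|]. intros y. apply one_minus_qpow_neq_0_nat; auto; lia.
Qed.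

(** The factors enter one at a time through [coef_geometric], so no infinite series is integrated
    term by term. *)
Lemma coef_partition_gf (t : R) (J : nat) (n : Z) : 0 < t ->
  coef t n (fun y => partition_gf J (ctau t y)) = pz J n.
Proof.
  intros Ht. revert n. induction J as [|J IH]; intros n.
  - unfold partition_gf. simpl. rewrite coef_1. now rewrite pz_0.
  - apply (coef_geometric t (S J) (fun y => partition_gf J (ctau t y)) _ (pz J)); auto.
    + lia.
    + now apply cdiff_partition_gf.
    + now apply cdiff_partition_gf.
    + intros y. unfold partition_gf. cbn [cprod]. field. apply one_minus_qpow_neq_0_nat; auto; lia.
    + intros z. apply pz_rec.
    + intros z Hz. now apply pz_neg.
Qed.

Lemma coef_hterm (t : R) (J m k : nat) (n : Z) : 0 < t -> (0 < m)%nat -> (0 < k)%nat ->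
  coef t n (fun y => qpow (ctau t y) (INR (m * tri k)) / (1 - qpow (ctau t y) (INR (m * k))) * partition_gf J (ctau t y))%C
  = hterm J m k n.
Proof.
  intros Ht Hm Hk. assert (Hd := cdiff_partition_gf t J Ht).
  apply (coef_geometric t (m * k) (fun y => qpow (ctau t y) (INR (m * tri k)) * partition_gf J (ctau t y))%C _
    (fun z => pz J (z - Z.of_nat (m * tri k)))); auto.
  - nia.
  - apply cdiff_mult; [apply cdiff_qpow|easy].
  - apply cdiff_mult; [apply cdiff_div|easy].
    + apply cdiff_qpow.
    + apply cdiff_one_minus_qpow.
    + intros y. apply one_minus_qpow_neq_0_nat; auto; nia.
  - intros y. field. apply one_minus_qpow_neq_0_nat; auto; nia.
  - intros z. rewrite coef_qpow_mult by easy. now apply coef_partition_gf.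
  - intros z. now apply hterm_rec.
  - intros z Hz. now apply hterm_neg.
Qed.

Lemma cdiff_string_term (t : R) (m k : nat) : 0 < t -> (0 < m)%nat -> (0 < k)%nat ->
  cdiff (fun y => qpow (ctau t y) (INR (m * tri k)) / (1 - qpow (ctau t y) (INR (m * k))))%C.
Proof.
  intros Ht Hm Hk. apply cdiff_div; [apply cdiff_qpow|apply cdiff_one_minus_qpow|].
  intros y. apply one_minus_qpow_neq_0_nat; auto; nia.
Qed.

Lemma cdiff_string_gf (t : R) (m N : nat) : 0 < t -> (0 < m)%nat -> cdiff (fun y => string_gf m N (ctau t y)).
Proof.
  intros Ht Hm. apply (cdiff_csum (fun i y => RtoC ((-1) ^ i) * (qpow (ctau t y) (INR (m * tri (S i))) / (1 - qpow (ctau t y) (INR (m * S i)))))%C).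
  intros i. apply cdiff_mult; [apply cdiff_const|]. apply cdiff_string_term; auto; lia.
Qed.

Lemma csum_mult_r (f : nat -> C) (c : C) (n : nat) : (csum f n * c)%C = csum (fun k => f k * c)%C n.
Proof. induction n as [|n IH]; simpl; [|rewrite <- IH]; ring. Qed.

Lemma Cm_coef (t : R) (m N J : nat) : 0 < t -> (0 < m)%nat -> (N <= J)%nat ->
  INR (Cm m N) = coef t (Z.of_nat N) (fun y => string_gf m N (ctau t y) * partition_gf J (ctau t y))%C.
Proof.
  intros Ht Hm HN. rewrite (Cm_hterm Hm HN).
  rewrite (coef_ext _ _ _ (fun y => csum (fun i => RtoC ((-1) ^ i) *
    (qpow (ctau t y) (INR (m * tri (S i))) / (1 - qpow (ctau t y) (INR (m * S i))) * partition_gf J (ctau t y))) N)%C).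
  - rewrite (coef_sum t (Z.of_nat N) (fun i => (-1) ^ i) (fun i y =>
     qpow (ctau t y) (INR (m * tri (S i))) / (1 - qpow (ctau t y) (INR (m * S i))) * partition_gf J (ctau t y))%C).
    + apply rsum_ext. intros k _. rewrite coef_hterm; auto. lia.
    + intros i. apply cdiff_mult; [apply cdiff_string_term; auto; lia|now apply cdiff_partition_gf].
  - intros y. unfold string_gf. rewrite csum_mult_r. apply csum_ext. intros k _. ring.
Qed.

Lemma Cm_diff_coef (t : R) (m N J : nat) : 0 < t -> (0 < m)%nat -> (N <= J)%nat ->
  INR (Cm 1 N) - INR m * INR (Cm m N) = coef t (Z.of_nat N)
    (fun y => (string_gf 1 N (ctau t y) - INR m * string_gf m N (ctau t y)) * partition_gf J (ctau t y))%C.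
Proof.
  intros Ht Hm HN. rewrite (Cm_coef t 1 N J), (Cm_coef t m N J) by (auto; lia).
  symmetry. rewrite (coef_ext _ _ _ (fun y => 1 * (string_gf 1 N (ctau t y) * partition_gf J (ctau t y))
    + (- INR m)%R * (string_gf m N (ctau t y) * partition_gf J (ctau t y)))%C).
  - rewrite coef_lincomb.
    + ring.
    + apply cdiff_mult; [apply cdiff_string_gf; auto; lia|now apply cdiff_partition_gf].
    + apply cdiff_mult; [apply cdiff_string_gf; auto; lia|now apply cdiff_partition_gf].
  - intros y. rewrite RtoC_opp. ring.
Qed.

(** * The alternating sum h near q = 1 *)

Lemma exp_ge_cubic (x : R) : 0 <= x -> 1 + x + x ^ 2 / 2 + x ^ 3 / 6 <= exp x.
Proof.
  intros Hx. eapply Rle_trans; [|apply (exp_ge_taylor x 3 Hx)]. simpl. right. field.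
Qed.

(** Reduces a bound for a polynomial times a decaying exponential to a polynomial lower bound for
    [exp x], often [exp_ge_cubic]. *)
Lemma exp_neg_le (x y K : R) : 0 < y -> K <= y * exp x -> K * exp (- x) <= y.
Proof.
  intros Hy H. rewrite exp_Ropp. apply Rmult_le_reg_r with (exp x); [apply exp_pos|].
  rewrite Rmult_assoc, Rinv_l by (generalize (exp_pos x); lra). lra.
Qed.

Lemma two_sinh_ge (x : R) : 0 <= x -> 2 * x <= exp x - exp (- x).
Proof.
  intros Hx.
  destruct (MVT_le (fun y => exp y - exp (- y)) (fun y => exp y + exp (- y)) 0 x Hx) as [c [Hc E]].
  - intros y _. auto_derive; auto. req. ring.
  - rewrite Ropp_0, exp_0 in E.
    assert (2 <= exp c + exp (- c)).
    { rewrite exp_Ropp. assert (H3 := exp_pos c). assert (0 <= (exp c - 1) ^ 2) by apply pow2_ge_0.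
      apply Rmult_le_reg_r with (exp c); [easy|]. rewrite Rmult_plus_distr_r, Rinv_l by lra. nra. }
    nra.
Qed.

(** Comparison with the integral of a / (1 + a x^2), whose primitive is sqrt a atan (sqrt a x): the
    term i = 0 costs [a], the others at most sqrt a PI / 2. This is the source of the errors O(sqrt
    t) for h. *)
Lemma rsum_lorentz (a : R) (N : nat) : 0 < a ->
  rsum (fun i => a / (1 + a * INR i ^ 2)) N <= a + 2 * sqrt a.
Proof.
  intros Ha. assert (Hs := sqrt_lt_R0 a Ha). assert (Es := sqrt_sqrt a (Rlt_le _ _ Ha)).
  assert (H : forall k, rsum (fun i => a / (1 + a * INR i ^ 2)) (S k) <= a + sqrt a * atan (sqrt a * INR k)).
  { induction k as [|k IH].
    - simpl. rewrite Rmult_0_r, atan_0. right. field.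
    - rewrite rsum_S.
      destruct (MVT_le (fun x => sqrt a * atan (sqrt a * x)) (fun x => a / (1 + a * x ^ 2)) (INR k) (INR (S k))) as [c [Hc E]].
      + rewrite S_INR. lra.
      + intros x _.
        replace (a / (1 + a * x ^ 2)) with (sqrt a * sqrt a / (1 + sqrt a * sqrt a * x ^ 2)) by (now rewrite Es).
        auto_derive; auto. req. field. generalize (pow2_ge_0 (sqrt a * x)); nra.
      + replace (INR (S k) - INR k) with 1 in E by (rewrite S_INR; ring).
        assert (a / (1 + a * INR (S k) ^ 2) <= a / (1 + a * c ^ 2)); [|lra].
        assert (0 <= INR k) by apply pos_INR.
        assert (0 <= c ^ 2) by (apply pow_le; lra). assert (c ^ 2 <= INR (S k) ^ 2) by (apply pow_incr; lra).
        apply Rmult_le_compat_l; [lra|]. apply Rinv_le_contravar; [nra|]. apply Rplus_le_compat_l, Rmult_le_compat_l; lra. }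
  destruct N as [|N]; [simpl; lra|].
  eapply Rle_trans; [apply H|].
  assert (B := atan_bound (sqrt a * INR N)). generalize PI_4. nra.
Qed.

Lemma cder_shift (f : R -> C) (c x : R) (l : C) : cder f (x + c) l -> cder (fun y => f (y + c)) x l.
Proof.
  intros [H1 H2].
  split; [apply (is_derive_comp (fun y => Re (f y)) (fun y => y + c) x (Re l) 1) in H1 |
          apply (is_derive_comp (fun y => Im (f y)) (fun y => y + c) x (Im l) 1) in H2].
  all: try (auto_derive; auto; fail).
  - eapply is_derive_eq; [exact H1|]. unfold scal; simpl; unfold mult; simpl. ring.
  - eapply is_derive_eq; [exact H2|]. unfold scal; simpl; unfold mult; simpl. ring.
Qed.

Lemma RtoC_neq_0 (x : R) : x <> 0 -> RtoC x <> 0.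
Proof. intros H E. apply H. now apply RtoC_inj. Qed.

Definition cdelta (f : R -> C) (x : R) : C := (f (x + 1)%R - f x)%C.

Lemma cder_cdelta (f f' : R -> C) (x : R) : (forall y, cder f y (f' y)) -> cder (cdelta f) x (cdelta f' x).
Proof. intros H. apply cder_minus; [apply cder_shift|]; apply H. Qed.

Lemma Cmod_cdelta (f f' : R -> C) (a M : R) : (forall y, cder f y (f' y)) ->
  (forall x, a <= x <= a + 1 -> Cmod (f' x) <= M) -> Cmod (cdelta f a) <= M.
Proof.
  intros Hf HM. assert (H := cder_mean_value f f' a (a + 1) M).
  unfold cdelta. replace M with (M * (a + 1 - a)) by ring. apply H; auto. lra.
Qed.

Lemma Cmod_cdelta3 (f f1 f2 f3 : R -> C) (a M : R) :
  (forall y, cder f y (f1 y)) -> (forall y, cder f1 y (f2 y)) -> (forall y, cder f2 y (f3 y)) ->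
  (forall x, a <= x -> Cmod (f3 x) <= M) -> Cmod (cdelta (cdelta (cdelta f)) a) <= M.
Proof.
  intros H1 H2 H3 HM.
  apply (Cmod_cdelta _ (cdelta (cdelta f1))).
  { intros y. apply cder_cdelta. intros z. now apply cder_cdelta. }
  intros x Hx. apply (Cmod_cdelta _ (cdelta f2)).
  { intros y. now apply cder_cdelta. }
  intros y Hy. apply (Cmod_cdelta _ f3); auto. intros z Hz. apply HM. lra.
Qed.

Definition calt (f : nat -> C) (N : nat) : C := csum (fun i => RtoC ((-1) ^ i) * f i)%C N.

Lemma calt_ext (f g : nat -> C) (N : nat) : (forall k, (k < N)%nat -> f k = g k) -> calt f N = calt g N.
Proof. intros H. apply csum_ext. intros k Hk. now rewrite H. Qed.

(** Summation by parts against the alternating signs: up to endpoint terms, the summand is replaced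
    by its difference. *)
Lemma calt_step (f : nat -> C) (N : nat) :
  (2 * calt f N = f O - RtoC ((-1) ^ N) * f N - calt (fun i => f (S i) - f i) N)%C.
Proof.
  unfold calt. induction N as [|N IH].
  - simpl. ring.
  - simpl csum. rewrite Cmult_plus_distr_l, IH. simpl pow. rewrite RtoC_mult. ring.
Qed.

Lemma Cmod_sign (n : nat) : Cmod (RtoC ((-1) ^ n)) = 1.
Proof. rewrite Cmod_R. apply pow_1_abs. Qed.

Lemma Cmod_calt (f : nat -> C) (N : nat) : Cmod (calt f N) <= rsum (fun i => Cmod (f i)) N.
Proof.
  eapply Rle_trans; [apply Cmod_csum|]. apply rsum_le. intros k _.
  rewrite Cmod_mult, Cmod_sign. lra.
Qed.

Lemma Cmod_calt_variation (f : nat -> C) (N : nat) :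
  2 * Cmod (calt f N) <= Cmod (f O) + Cmod (f N) + rsum (fun i => Cmod (f (S i) - f i)) N.
Proof.
  replace 2 with (Cmod 2) by (rewrite Cmod_R; apply Rabs_right; lra).
  rewrite <- Cmod_mult, calt_step.
  eapply Rle_trans; [apply Cmod_triangle_minus|].
  apply Rplus_le_compat; [|apply Cmod_calt].
  eapply Rle_trans; [apply Cmod_triangle_minus|]. rewrite Cmod_mult, Cmod_sign. lra.
Qed.

(* Euler's transformation, three steps. *)
Lemma calt_euler3 (F : R -> C) (N : nat) :
  let D := cdelta F in let D2 := cdelta D in let D3 := cdelta D2 in
  8 * Cmod (calt (fun i => F (INR i)) N - (F 0 / 2 - D 0 / 4 + D2 0 / 8))
  <= 4 * Cmod (F (INR N)) + 2 * Cmod (D (INR N)) + Cmod (D2 (INR N)) + rsum (fun i => Cmod (D3 (INR i))) N.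
Proof.
  intros D D2 D3.
  assert (E : forall G : R -> C, (2 * calt (fun i => G (INR i)) N = G 0 - RtoC ((-1) ^ N) * G (INR N) - calt (fun i => cdelta G (INR i)) N)%C).
  { intros G. rewrite calt_step. simpl (INR 0). f_equal. apply calt_ext. intros k _. unfold cdelta. now rewrite S_INR. }
  assert (E1 := E F). assert (E2 := E D). assert (E3 := E D2). fold D D2 D3 in E1, E2, E3.
  replace 8 with (Cmod 8) at 1 by (rewrite Cmod_R; apply Rabs_right; lra).
  rewrite <- Cmod_mult.
  replace (8 * (calt (fun i => F (INR i)) N - (F 0 / 2 - D 0 / 4 + D2 0 / 8)))%C with
    (- (RtoC ((-1) ^ N) * (4 * F (INR N) - 2 * D (INR N) + D2 (INR N))) - calt (fun i => D3 (INR i)) N)%C.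
  - eapply Rle_trans; [apply Cmod_triangle_minus|]. apply Rplus_le_compat; [|apply Cmod_calt].
    rewrite Cmod_opp, Cmod_mult, Cmod_sign, Rmult_1_l.
    eapply Rle_trans; [apply Cmod_triangle|]. apply Rplus_le_compat_r.
    eapply Rle_trans; [apply Cmod_triangle_minus|]. rewrite !Cmod_mult, !Cmod_R, !Rabs_right by lra. lra.
  - set (s := calt (fun i => F (INR i)) N) in *. set (s1 := calt (fun i => D (INR i)) N) in *.
    set (s2 := calt (fun i => D2 (INR i)) N) in *. set (s3 := calt (fun i => D3 (INR i)) N) in *.
    set (e := RtoC ((-1) ^ N)) in *.
    replace s3 with (D2 0 - e * D2 (INR N) - 2 * s2)%C by (rewrite E3; ring).
    replace (2 * s2)%C with (2 * (D 0 - e * D (INR N) - 2 * s1))%C by (rewrite E2; ring).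
    replace (2 * s1)%C with (2 * (F 0 - e * F (INR N) - 2 * s))%C by (rewrite E1; ring).
    field.
Qed.

(** * Alternating sums of x exp (-x^2 w) for w in a cone *)

Definition gauss (w : C) (x : R) : C := Cexp (RtoC (- x ^ 2) * w).

Lemma Cmod_gauss (w : C) (x : R) : Cmod (gauss w x) = exp (- x ^ 2 * Re w).
Proof. unfold gauss. rewrite Cmod_Cexp. f_equal. unfold Re. simpl. ring. Qed.

Lemma cder_gauss (w : C) (p : R -> C) (p' : C) (x : R) : cder p x p' ->
  cder (fun y => p y * gauss w y)%C x ((p' - RtoC (2 * x) * w * p x) * gauss w x).
Proof.
  intros H. eapply cder_eq.
  - apply cder_mult; [exact H|]. apply cder_Cexp.
    apply (cder_mult (fun y => RtoC (- y ^ 2)) (fun _ => w) x (RtoC (- (2 * x))) 0); [|apply cder_const].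
    apply cder_RtoC. auto_derive; auto. req. ring.
  - unfold gauss. cbv beta. rewrite (RtoC_opp (2 * x)). ring.
Qed.

Lemma Cmod_Cexp_minus_1 (z : C) : Re z <= 0 -> Cmod (Cexp z - 1) <= Cmod z.
Proof.
  intros Hz. replace (Cexp z - 1)%C with (Cexp (RtoC 1 * z) - Cexp (RtoC 0 * z))%C.
  - replace (Cmod z) with (Cmod z * (1 - 0)) by ring.
    apply (cder_mean_value (fun s => Cexp (RtoC s * z)) (fun s => z * Cexp (RtoC s * z))%C); [lra| |].
    + intros x _. eapply cder_eq.
      * apply cder_Cexp. apply (cder_mult (fun s => RtoC s) (fun _ => z)); [|apply cder_const].
        apply cder_RtoC. apply (is_derive_id (K := R_AbsRing)).
      * unfold one; simpl. ring.
    + intros x Hx. rewrite Cmod_mult, Cmod_Cexp. rewrite <- (Rmult_1_r (Cmod z)) at 2.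
      apply Rmult_le_compat_l; [apply Cmod_ge_0|]. rewrite <- exp_0. apply exp_le_mono.
      unfold Re in *. simpl. nra.
  - rewrite Cmult_1_l, Cmult_0_l, Cexp_0. reflexivity.
Qed.

(** On this cone absolute values can be traded for real parts, and the real part is what governs the
    decay of the Gaussian. *)
Lemma Cmod_cone (w : C) : Rabs (Im w) <= Re w -> Cmod w <= 2 * Re w.
Proof.
  intros H. eapply Rle_trans; [apply Cmod_le_Re_Im|].
  assert (0 <= Re w) by (generalize (Rabs_pos (Im w)); lra). rewrite (Rabs_right (Re w)) by lra. lra.
Qed.

(** Up to a factor Re w, the first polynomial times e^(-y) majorises the third derivative of x exp
    (-w x^2), with y = Re w x^2 and |w| <= 2 Re w. The factor 1 + y makes room for a Lorentzian; 400
    is dictated by the cubic term, 64 <= 400 / 6. *)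
Lemma poly_exp_bound (y : R) : 0 <= y -> (12 + 96 * y + 64 * y ^ 2) * (1 + y) * exp (- y) <= 400.
Proof.
  intros Hy. apply exp_neg_le; [lra|]. generalize (exp_ge_cubic y Hy).
  assert (0 <= y ^ 2) by (apply pow_le; lra). assert (0 <= y ^ 3) by (apply pow_le; lra). intros. simpl in *. nra.
Qed.

Definition xgauss (w : C) (x : R) : C := (RtoC x * gauss w x)%C.

(** The third derivative has size Re w on a range of length 1 / sqrt (Re w), so its values sum to
    O(sqrt (Re w)). Stopping at the second derivative would give only O(1), whence three
    differences. *)
Lemma Cmod_delta3_xgauss (w : C) (a : R) : 0 < Re w -> Rabs (Im w) <= Re w -> 0 <= a ->
  Cmod (cdelta (cdelta (cdelta (xgauss w))) a) <= 400 * (Re w / (1 + Re w * a ^ 2)).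
Proof.
  intros Hw Hc Ha.
  apply (Cmod_cdelta3 _ (fun x => (1 - RtoC (2 * x ^ 2) * w) * gauss w x)%C
    (fun x => (- RtoC (6 * x) * w + RtoC (4 * x ^ 3) * (w * w)) * gauss w x)%C
    (fun x => (- (6 * w) + RtoC (24 * x ^ 2) * (w * w) - RtoC (8 * x ^ 4) * (w * w * w)) * gauss w x)%C).
  - intros y. eapply cder_eq.
    + apply cder_gauss. apply cder_RtoC. apply (is_derive_id (K := R_AbsRing)).
    + unfold one; simpl. f_equal. rewrite !RtoC_mult. ring.
  - intros y. eapply cder_eq.
    + apply cder_gauss. apply cder_minus; [apply cder_const|].
      apply (cder_mult (fun y => RtoC (2 * y ^ 2)) (fun _ => w) y (RtoC (4 * y)) 0); [|apply cder_const].
      apply cder_RtoC. auto_derive; auto. req. ring.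
    + f_equal. rewrite !RtoC_mult, !RtoC_pow. simpl. ring.
  - intros y. eapply cder_eq.
    + apply cder_gauss. apply cder_plus.
      * apply (cder_mult (fun y => - RtoC (6 * y))%C (fun _ => w) y (- RtoC 6) 0); [|apply cder_const].
        apply cder_opp, cder_RtoC. auto_derive; auto. req. ring.
      * apply (cder_mult (fun y => RtoC (4 * y ^ 3)) (fun _ => (w * w)%C) y (RtoC (12 * y ^ 2)) 0); [|apply cder_const].
        apply cder_RtoC. auto_derive; auto. req. ring.
    + f_equal. rewrite !RtoC_mult, !RtoC_pow. simpl. ring.
  - intros x Hx. rewrite Cmod_mult, Cmod_gauss.
    assert (Hw2 := Cmod_cone w Hc). assert (P0 := Cmod_ge_0 w).
    set (y := Re w * x ^ 2). assert (Hy : 0 <= y) by (apply Rmult_le_pos; [lra|apply pow2_ge_0]).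
    assert (B : Cmod (- (6 * w) + RtoC (24 * x ^ 2) * (w * w) - RtoC (8 * x ^ 4) * (w * w * w)) <= Re w * (12 + 96 * y + 64 * y ^ 2)).
    { eapply Rle_trans; [apply Cmod_triangle_minus|].
      eapply Rle_trans; [apply Rplus_le_compat_r, Cmod_triangle|].
      rewrite Cmod_opp, !Cmod_mult, !Cmod_R.
      assert (X2 : 0 <= x ^ 2) by apply pow2_ge_0. assert (X4 : 0 <= x ^ 4) by (replace (x ^ 4) with (x ^ 2 * x ^ 2) by ring; nra).
      rewrite !Rabs_right by nra.
      assert (W2 : Cmod w * Cmod w <= 2 * Re w * (2 * Re w)) by (apply Rmult_le_compat; lra).
      assert (W3 : Cmod w * Cmod w * Cmod w <= 2 * Re w * (2 * Re w) * (2 * Re w)) by (apply Rmult_le_compat; nra).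
      replace (Re w * (12 + 96 * y + 64 * y ^ 2)) with (6 * (2 * Re w) + 24 * x ^ 2 * (2 * Re w * (2 * Re w)) + 8 * x ^ 4 * (2 * Re w * (2 * Re w) * (2 * Re w))) by (unfold y; ring).
      apply Rplus_le_compat; [apply Rplus_le_compat|]; [lra| |]; (apply Rmult_le_compat_l; [nra|easy]). }
    replace (- x ^ 2 * Re w) with (- y) by (unfold y; ring).
    apply Rle_trans with (400 * (Re w / (1 + y))).
    + apply Rmult_le_reg_r with (1 + y); [lra|].
      replace (400 * (Re w / (1 + y)) * (1 + y)) with (Re w * 400) by (field; lra).
      generalize (poly_exp_bound y Hy) (exp_pos (- y)). intros.
      apply Rle_trans with (Re w * ((12 + 96 * y + 64 * y ^ 2) * (1 + y) * exp (- y))); [|nra].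
      replace (Re w * ((12 + 96 * y + 64 * y ^ 2) * (1 + y) * exp (- y))) with ((Re w * (12 + 96 * y + 64 * y ^ 2)) * exp (- y) * (1 + y)) by ring.
      apply Rmult_le_compat_r; [lra|]. apply Rmult_le_compat_r; lra.
    + apply Rmult_le_compat_l; [lra|]. apply Rmult_le_compat_l; [lra|].
      assert (a ^ 2 <= x ^ 2) by (apply pow_incr; lra). assert (0 <= a ^ 2) by (apply pow2_ge_0).
      apply Rinv_le_contravar; unfold y; nra.
Qed.

Lemma calt_S (f : nat -> C) (N : nat) : calt f (S N) = (f O - calt (fun i => f (S i)) N)%C.
Proof.
  unfold calt. change (S N) with (1 + N)%nat. rewrite csum_split.
  replace (csum (fun i => RtoC ((-1) ^ (1 + i)) * f (1 + i)%nat)%C N) with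
   (csum (fun i => RtoC (-1) * (RtoC ((-1) ^ i) * f (S i)))%C N).
  - rewrite csum_scal. simpl. ring.
  - apply csum_ext. intros k _. simpl. rewrite RtoC_mult. ring.
Qed.

Lemma Cmod_xgauss (w : C) (x M : R) : 0 < Re w -> 0 < M -> M <= x -> Cmod (xgauss w x) <= / (M * Re w).
Proof.
  intros Hw HM Hx. unfold xgauss. rewrite Cmod_mult, Cmod_R, Cmod_gauss, Rabs_right by lra.
  replace (- x ^ 2 * Re w) with (- (x ^ 2 * Re w)) by ring. apply exp_neg_le.
  - apply Rinv_0_lt_compat. nra.
  - apply Rle_trans with (/ (M * Re w) * (x * (M * Re w))).
    + right. field. lra.
    + apply Rmult_le_compat_l; [left; apply Rinv_0_lt_compat; nra|].
      eapply Rle_trans; [|apply exp_ineq1_le]. assert (x * M <= x ^ 2) by nra. nra.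
Qed.

(** Euler's terms at 0 are 0, gauss w 1 and 2 gauss w 2 - 2 gauss w 1, close to 0, 1 and 0. This
    gives -1/4 for the sum started at 0, and 1/4 after the sign change of [calt_S]. The last error
    term pays for the endpoint [N]. *)
Lemma alternating_xgauss (w : C) (N : nat) : 0 < Re w -> Rabs (Im w) <= Re w -> (0 < N)%nat ->
  Cmod (calt (fun i => xgauss w (INR (S i))) N - RtoC (1 / 4)) <= 100 * sqrt (Re w) + 53 * Re w + 2 / (INR N * Re w).
Proof.
  intros Hw Hc HN. set (F := xgauss w). set (a := Re w) in *.
  assert (HN' : 0 < INR N) by now apply lt_0_INR.
  assert (HM : INR N <= INR (S N)) by (rewrite S_INR; lra).
  assert (T : forall x, INR N <= x -> Cmod (F x) <= / (INR N * a)) by (intros; now apply Cmod_xgauss).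
  assert (H := calt_euler3 F (S N)). cbv zeta in H.
  assert (HF0 : F 0 = 0) by (unfold F, xgauss; ring).
  assert (TD : forall x, INR N <= x -> Cmod (cdelta F x) <= 2 * / (INR N * a)).
  { intros x Hx. eapply Rle_trans; [apply Cmod_triangle_minus|].
    assert (H1 := T x Hx). assert (H2 := T (x + 1)). lra. }
  assert (TD2 : Cmod (cdelta (cdelta F) (INR (S N))) <= 4 * / (INR N * a)).
  { eapply Rle_trans; [apply Cmod_triangle_minus|].
    assert (H1 := TD (INR (S N)) HM). assert (H2 := TD (INR (S N) + 1)). lra. }
  assert (TD1 := TD (INR (S N)) HM). assert (T1 := T (INR (S N)) HM).
  assert (S3 : rsum (fun i => Cmod (cdelta (cdelta (cdelta F)) (INR i))) (S N) <= 400 * (a + 2 * sqrt a)).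
  { eapply Rle_trans; [apply rsum_le; intros k _; apply Cmod_delta3_xgauss; auto; apply pos_INR|].
    rewrite rsum_scal. apply Rmult_le_compat_l; [lra|]. now apply rsum_lorentz. }
  rewrite calt_S in H. simpl (INR 0) in H. rewrite HF0 in H.
  set (s := calt (fun i => F (INR (S i))) N) in *.
  set (B := (0 - s - (0 / 2 - cdelta F 0 / 4 + cdelta (cdelta F) 0 / 8))%C) in *.
  assert (HB : Cmod B <= 3 / 2 * / (INR N * a) + 50 * (a + 2 * sqrt a)).
  { assert (0 < / (INR N * a)) by (apply Rinv_0_lt_compat; nra). lra. }
  assert (G1 : Cmod (gauss w 1 - 1) <= 2 * a).
  { eapply Rle_trans; [apply Cmod_Cexp_minus_1; unfold Re in *; simpl; fold a; nra|].
    rewrite Cmod_mult, Cmod_R. replace (Rabs _) with 1 by (rewrite Rabs_left by lra; ring).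
    rewrite Rmult_1_l. now apply Cmod_cone. }
  assert (G2 : Cmod (gauss w 2 - 1) <= 8 * a).
  { eapply Rle_trans; [apply Cmod_Cexp_minus_1; unfold Re in *; simpl; fold a; nra|].
    rewrite Cmod_mult, Cmod_R. replace (Rabs _) with 4 by (rewrite Rabs_left by lra; ring).
    generalize (Cmod_cone w Hc). fold a. lra. }
  replace (s - RtoC (1 / 4))%C with (- B + (RtoC (1 / 2) * (gauss w 1 - 1) - RtoC (1 / 4) * (gauss w 2 - 1)))%C.
  - eapply Rle_trans; [apply Cmod_triangle|]. rewrite Cmod_opp.
    assert (Cmod (RtoC (1 / 2) * (gauss w 1 - 1) - RtoC (1 / 4) * (gauss w 2 - 1)) <= 3 * a).
    { eapply Rle_trans; [apply Cmod_triangle_minus|]. rewrite !Cmod_mult, !Cmod_R, !Rabs_right by lra. lra. }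
    assert (0 < / (INR N * a)) by (apply Rinv_0_lt_compat; nra). unfold Rdiv at 1. lra.
  - unfold B, cdelta, F, xgauss. rewrite Rplus_0_l. replace (1 + 1)%R with 2 by ring.
    rewrite !RtoC_div by lra. field.
Qed.

Lemma cder_csum (f : nat -> R -> C) (f' : nat -> C) (x : R) (n : nat) :
  (forall k, (k < n)%nat -> cder (f k) x (f' k)) -> cder (fun y => csum (fun k => f k y) n) x (csum f' n).
Proof.
  induction n as [|n IH]; intros H; simpl; [apply cder_const|].
  apply cder_plus; [apply IH; intros; apply H|apply H]; lia.
Qed.

(* The part of h coming from the pole of 1 / (2 sinh (z/2)) = 1 / z + crho z. *)
Definition lambert_main (N : nat) (w : C) : C := calt (fun i => RtoC (/ INR (S i)) * gauss w (INR (S i)))%C N.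

(* Differentiating in the dilation factor s, 1 <= s <= m, removes the denominators n. *)
Lemma lambert_main_diff (tau : C) (m N : nat) :
  0 < Re tau -> Rabs (Im tau) <= Re tau -> (1 <= m)%nat -> (0 < N)%nat ->
  Cmod ((lambert_main N (tau / 2) - lambert_main N (INR m * (tau / 2))) / tau - RtoC ((INR m - 1) / 8))
  <= (50 * sqrt (INR m * Re tau) + 27 * (INR m * Re tau) + 2 / (INR N * Re tau)) * (INR m - 1).
Proof.
  intros Ht Hc Hm HN. set (t := Re tau) in *.
  assert (Htau : tau <> 0) by (intros E; unfold t in Ht; rewrite E in Ht; simpl in Ht; lra).
  assert (Hm' : 1 <= INR m) by (apply (le_INR 1); lia).
  assert (HN' : 0 < INR N) by now apply lt_0_INR.
  (* Differentiating exp (-n^2 s tau / 2) / n in s gives -(tau / 2) n exp (-n^2 s tau / 2), so the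
     division by tau leaves no pole; with the term s / 8, the derivative of [g] is half of the
     alternating sum minus 1/4. *)
  pose (g := fun s : R => (- (lambert_main N (RtoC s * (tau / 2)) / tau) - RtoC (s / 8))%C).
  replace ((lambert_main N (tau / 2) - lambert_main N (INR m * (tau / 2))) / tau - RtoC ((INR m - 1) / 8))%C with (g (INR m) - g 1)%C.
  2:{ unfold g. rewrite Cmult_1_l. rewrite !RtoC_div, RtoC_minus by lra. field. repeat split; auto; apply RtoC_neq_0; lra. }
  apply (cder_mean_value g (fun s => RtoC (1 / 2) * (calt (fun i => xgauss (RtoC s * (tau / 2)) (INR (S i))) N - RtoC (1 / 4)))%C); [lra| |].
  - intros s _. unfold g. eapply cder_eq.
    + apply cder_minus.
      * apply cder_opp. apply (cder_mult _ (fun _ => / tau)%C); [|apply cder_const].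
        unfold lambert_main, calt. apply (cder_csum (fun i s => RtoC ((-1) ^ i) * (RtoC (/ INR (S i)) * gauss (RtoC s * (tau / 2)) (INR (S i))))%C
           (fun i => RtoC ((-1) ^ i) * (RtoC (/ INR (S i)) * (RtoC (- INR (S i) ^ 2) * (tau / 2) * gauss (RtoC s * (tau / 2)) (INR (S i)))))%C).
        intros k _. apply cder_scal, cder_scal. unfold gauss. apply (cder_Cexp (fun s => RtoC (- INR (S k) ^ 2) * (RtoC s * (tau / 2)))%C).
        apply cder_scal. eapply cder_eq.
        -- apply (cder_mult (fun s => RtoC s) (fun _ => tau / 2)%C); [|apply cder_const].
           apply cder_RtoC. apply (is_derive_id (K := R_AbsRing)).
        -- unfold one; simpl. ring.
      * apply cder_RtoC. apply (is_derive_eq _ _ (1 / 8)); [auto_derive; auto; req; field|reflexivity].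
    + rewrite (csum_ext _ (fun i => (- (tau / 2)) * (RtoC ((-1) ^ i) * xgauss (RtoC s * (tau / 2)) (INR (S i))))%C).
      * rewrite csum_scal. fold (calt (fun i => xgauss (RtoC s * (tau / 2)) (INR (S i))) N).
        rewrite !RtoC_div by lra. field. repeat split; auto; apply RtoC_neq_0; lra.
      * intros k _. unfold xgauss. assert (Hk : 0 < INR (S k)) by (apply lt_0_INR; lia).
        replace (RtoC (- INR (S k) ^ 2)) with (- (RtoC (INR (S k)) * RtoC (INR (S k))))%C
          by (rewrite <- RtoC_mult, <- RtoC_opp; f_equal; ring).
        rewrite RtoC_inv by lra. field. apply RtoC_neq_0; lra.
  - intros s Hs. rewrite Cmod_mult, Cmod_R, Rabs_right by lra.
    set (w := (RtoC s * (tau / 2))%C).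
    assert (Rw : Re w = s * t / 2) by (unfold w, t, Re, Im; destruct tau; simpl; field).
    assert (Iw : Im w = s * Im tau / 2) by (unfold w, t, Re, Im; destruct tau; simpl; field).
    assert (H := alternating_xgauss w N). rewrite Rw, Iw in H.
    assert (Hst : t <= s * t <= INR m * t) by nra.
    assert (B := H ltac:(nra)). clear H.
    assert (H2 : Rabs (s * Im tau / 2) <= s * t / 2).
    { unfold Rdiv. rewrite !Rabs_mult, (Rabs_right s), (Rabs_right (/ 2)) by lra.
      apply Rmult_le_compat_r; [lra|]. apply Rmult_le_compat_l; lra. }
    specialize (B H2 HN). 
    assert (S1 : sqrt (s * t / 2) <= sqrt (INR m * t)) by (apply sqrt_le_1; nra).
    assert (S2 : 2 / (INR N * (s * t / 2)) <= 4 / (INR N * t)).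
    { replace (2 / (INR N * (s * t / 2))) with (4 * / (INR N * (s * t))) by (field; repeat split; nra).
      apply Rmult_le_compat_l; [lra|]. apply Rinv_le_contravar; nra. }
    replace (4 / (INR N * t)) with (2 * (2 / (INR N * t))) in S2 by (field; nra). lra.
Qed.

(** * Taylor bounds for hyperbolic functions and for the regular part [crho] *)

Lemma RtoC_2 : RtoC 2 = (1 + 1)%C.
Proof. now rewrite <- RtoC_plus. Qed.

(** Differentiability along rays through 0 is all that the mean value inequality on the segment from
    0 to z requires. *)
Definition holo_along (f f' : C -> C) : Prop :=
  forall (z : C) (s : R), cder (fun y => f (RtoC y * z)%C) s (z * f' (RtoC s * z)%C)%C.

Lemma cder_ray (z : C) (s : R) : cder (fun y => RtoC y * z)%C s z.
Proof.
  eapply cder_eq.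
  - apply (cder_mult (fun y => RtoC y) (fun _ => z)); [apply cder_RtoC, (is_derive_id (K := R_AbsRing))|apply cder_const].
  - unfold one; simpl. ring.
Qed.

Lemma holo_along_bound (f f' : C -> C) (z : C) (M : R) : holo_along f f' -> f 0 = 0 ->
  (forall s, 0 <= s <= 1 -> Cmod (f' (RtoC s * z)%C) <= M) -> Cmod (f z) <= Cmod z * M.
Proof.
  intros Hf H0 HM.
  assert (H := cder_mean_value (fun y => f (RtoC y * z)%C) (fun s => z * f' (RtoC s * z))%C 0 1 (Cmod z * M)).
  cbv beta in H. rewrite Cmult_1_l, Cmult_0_l, H0 in H.
  replace (f z - 0)%C with (f z) in H by ring.
  replace (Cmod z * M * (1 - 0)) with (Cmod z * M) in H by ring.
  apply H; [lra|intros; apply Hf|].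
  intros s Hs. rewrite Cmod_mult. apply Rmult_le_compat_l; [apply Cmod_ge_0|auto].
Qed.

Lemma Cmod_scale_le (s : R) (z : C) : 0 <= s <= 1 -> Cmod (RtoC s * z) <= Cmod z.
Proof. intros Hs. rewrite Cmod_mult, Cmod_R, Rabs_right by lra. generalize (Cmod_ge_0 z). nra. Qed.

(** Twice sinh and, next, twice cosh; thus 1 - e^(-z) = e^(-z/2) csh (z / 2) without a numerical
    factor. *)
Definition csh (z : C) : C := (Cexp z - Cexp (- z))%C.
Definition cch (z : C) : C := (Cexp z + Cexp (- z))%C.

Lemma cder_Cexp_ray (z : C) (s : R) : cder (fun y => Cexp (RtoC y * z)) s (z * Cexp (RtoC s * z)).
Proof. apply (cder_Cexp (fun y => RtoC y * z)%C), cder_ray. Qed.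

Lemma cder_Cexp_ray_opp (z : C) (s : R) : cder (fun y => Cexp (- (RtoC y * z))) s (- z * Cexp (- (RtoC s * z))).
Proof. apply (cder_Cexp (fun y => - (RtoC y * z))%C), cder_opp, cder_ray. Qed.

Lemma holo_csh : holo_along csh cch.
Proof.
  intros z s. eapply cder_eq; [apply cder_minus; [apply cder_Cexp_ray|apply cder_Cexp_ray_opp]|]. unfold cch. ring.
Qed.

Lemma holo_cch : holo_along cch csh.
Proof.
  intros z s. eapply cder_eq; [apply cder_plus; [apply cder_Cexp_ray|apply cder_Cexp_ray_opp]|]. unfold csh. ring.
Qed.

Lemma holo_minus (f f' g g' : C -> C) : holo_along f f' -> holo_along g g' ->
  holo_along (fun z => f z - g z)%C (fun z => f' z - g' z)%C.
Proof.
  intros Hf Hg z s. eapply cder_eq.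
  - apply (cder_minus (fun y => f (RtoC y * z)%C) (fun y => g (RtoC y * z)%C)); [apply Hf|apply Hg].
  - ring.
Qed.

Lemma holo_const (c : C) : holo_along (fun _ => c) (fun _ => 0).
Proof. intros z s. eapply cder_eq; [apply cder_const|]. ring. Qed.

Lemma holo_2z : holo_along (fun z => 2 * z)%C (fun _ => 2).
Proof. intros z s. eapply cder_eq; [apply cder_scal, cder_ray|]. ring. Qed.

Lemma holo_sqr : holo_along (fun z => z * z)%C (fun z => 2 * z)%C.
Proof. intros z s. eapply cder_eq; [apply cder_mult; apply cder_ray|]. rewrite RtoC_2. ring. Qed.

(** Each exponential is at most e <= 3. The constant 6 passes unchanged through the Taylor chain
    below, where each estimate integrates the preceding one along a ray. *)
Lemma cch_bound (z : C) : Cmod z <= 1 -> Cmod (cch z) <= 6.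
Proof.
  intros Hz. eapply Rle_trans; [apply Cmod_triangle|]. rewrite !Cmod_Cexp.
  assert (H := Re_le_Cmod z). apply Rabs_le_between in H.
  assert (exp (Re z) <= 3) by (eapply Rle_trans; [|apply exp_le_3]; apply exp_le_mono; lra).
  assert (exp (Re (- z)) <= 3) by (eapply Rle_trans; [|apply exp_le_3]; apply exp_le_mono; unfold Re in *; simpl; lra).
  lra.
Qed.

Lemma csh_0 : csh 0 = 0.
Proof. unfold csh. replace (- (0))%C with (RtoC 0) by ring. ring. Qed.

Lemma cch_0 : cch 0 = 2.
Proof. unfold cch. replace (- (0))%C with (RtoC 0) by ring. rewrite Cexp_0, RtoC_2. ring. Qed.

Lemma csh_taylor1 (z : C) : Cmod z <= 1 -> Cmod (csh z) <= 6 * Cmod z.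
Proof.
  intros Hz. rewrite Rmult_comm. apply (holo_along_bound _ _ _ _ holo_csh csh_0).
  intros s Hs. apply cch_bound. eapply Rle_trans; [now apply Cmod_scale_le|easy].
Qed.

Lemma cch_taylor2 (z : C) : Cmod z <= 1 -> Cmod (cch z - 2) <= 6 * Cmod z ^ 2.
Proof.
  intros Hz. replace (6 * Cmod z ^ 2) with (Cmod z * (6 * Cmod z)) by ring.
  apply (holo_along_bound (fun z => cch z - 2)%C (fun z => csh z - 0)%C).
  - apply holo_minus; [apply holo_cch|apply holo_const].
  - rewrite cch_0. ring.
  - intros s Hs. assert (H := Cmod_scale_le s z Hs). replace (csh (s * z) - 0)%C with (csh (s * z)) by ring.
    eapply Rle_trans; [apply csh_taylor1; lra|]. lra.
Qed.

Lemma csh_taylor3 (z : C) : Cmod z <= 1 -> Cmod (csh z - 2 * z) <= 6 * Cmod z ^ 3.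
Proof.
  intros Hz. replace (6 * Cmod z ^ 3) with (Cmod z * (6 * Cmod z ^ 2)) by ring.
  apply (holo_along_bound (fun z => csh z - 2 * z)%C (fun z => cch z - 2)%C).
  - apply (holo_minus csh cch); [apply holo_csh|apply holo_2z].
  - rewrite csh_0. ring.
  - intros s Hs. assert (H := Cmod_scale_le s z Hs).
    eapply Rle_trans; [apply cch_taylor2; lra|]. apply Rmult_le_compat_l; [lra|].
    apply pow_incr. split; [apply Cmod_ge_0|easy].
Qed.

Lemma cch_taylor4 (z : C) : Cmod z <= 1 -> Cmod (cch z - 2 - z * z) <= 6 * Cmod z ^ 4.
Proof.
  intros Hz. replace (6 * Cmod z ^ 4) with (Cmod z * (6 * Cmod z ^ 3)) by ring.
  apply (holo_along_bound (fun z => cch z - 2 - z * z)%C (fun z => csh z - 0 - 2 * z)%C).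
  - apply (holo_minus (fun z => cch z - 2)%C (fun z => csh z - 0)%C); [|apply holo_sqr].
    apply holo_minus; [apply holo_cch|apply holo_const].
  - rewrite cch_0. ring.
  - intros s Hs. assert (H := Cmod_scale_le s z Hs).
    replace (csh (s * z) - 0 - 2 * (s * z))%C with (csh (s * z) - 2 * (s * z))%C by ring.
    eapply Rle_trans; [apply csh_taylor3; lra|]. apply Rmult_le_compat_l; [lra|].
    apply pow_incr. split; [apply Cmod_ge_0|easy].
Qed.

Lemma Re_half (z : C) : Re (z / 2) = Re z / 2.
Proof. unfold Re. simpl. field. Qed.

Lemma Cmod_half (z : C) : Cmod (z / 2) = Cmod z / 2.
Proof. rewrite Cmod_div by (apply RtoC_neq_0; lra). rewrite Cmod_R, Rabs_right by lra. reflexivity. Qed.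

Lemma csh_half_lower (z : C) : 0 <= Re z -> Re z <= Cmod (csh (z / 2)) /\ Cmod (cch (z / 2)) <= Cmod (csh (z / 2)) + 2.
Proof.
  intros Hz. set (x := Re z / 2).
  assert (H1 : exp x - exp (- x) <= Cmod (csh (z / 2))).
  { unfold x. rewrite <- Re_half, <- Cmod_Cexp. replace (- Re (z / 2)) with (Re (- (z / 2))) by reflexivity.
    rewrite <- (Cmod_Cexp (- (z / 2))). apply Cmod_triangle_inv. }
  assert (H2 : Cmod (cch (z / 2)) <= exp x + exp (- x)).
  { unfold x. rewrite <- Re_half, <- Cmod_Cexp. replace (- Re (z / 2)) with (Re (- (z / 2))) by reflexivity.
    rewrite <- (Cmod_Cexp (- (z / 2))). apply Cmod_triangle. }
  assert (Hx : 0 <= x) by (unfold x; lra).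
  assert (exp (- x) <= 1) by (rewrite <- exp_0; apply exp_le_mono; lra).
  split; [|lra].
  generalize (two_sinh_ge x Hx). unfold x in *. lra.
Qed.

Definition crho (z : C) : C := (/ csh (z / 2) - / z)%C.
Definition crho' (z : C) : C := (/ (z * z) - cch (z / 2) / (2 * (csh (z / 2) * csh (z / 2))))%C.

Section Cone.
Variable z : C.
Hypotheses (Hz : 0 < Re z) (Hc : Rabs (Im z) <= Re z).

Lemma cone_facts : z <> 0 /\ csh (z / 2) <> 0 /\ 0 < Cmod z /\ Cmod z / 2 <= Cmod (csh (z / 2)).
Proof.
  assert (H := Cmod_cone z Hc). destruct (csh_half_lower z) as [H1 _]; [lra|].
  assert (H2 := Re_le_Cmod z). rewrite Rabs_right in H2 by lra.
  repeat split; try lra; apply Cmod_neq_0; lra.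
Qed.

(** For |z| <= 1 the numerator z - csh (z / 2) is of third order, while the denominator is at least
    |z|^2 / 2; for |z| > 1 both terms of [crho] are bounded. *)
Lemma crho_bound : Cmod (crho z) <= 3 * Cmod z.
Proof.
  destruct cone_facts as [N1 [N2 [P L]]].
  destruct (Rle_dec (Cmod z) 1) as [Hs|Hl].
  - assert (T := csh_taylor3 (z / 2)). rewrite Cmod_half in T.
    replace (csh (z / 2) - 2 * (z / 2))%C with (csh (z / 2) - z)%C in T by field.
    assert (E : crho z = (- (csh (z / 2) - z) / (csh (z / 2) * z))%C) by (unfold crho; field; auto).
    rewrite E, Cmod_div, Cmod_opp, Cmod_mult by (apply Cmult_neq_0; auto).
    assert (T' := T ltac:(lra)).
    apply Rmult_le_reg_r with (Cmod (csh (z / 2)) * Cmod z); [nra|].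
    unfold Rdiv at 1. rewrite Rmult_assoc, Rinv_l, Rmult_1_r by nra.
    eapply Rle_trans; [exact T'|].
    assert (Cmod z * Cmod z * (Cmod z / 2) <= Cmod z * Cmod z * Cmod (csh (z / 2))) by (apply Rmult_le_compat_l; nra).
    replace (6 * (Cmod z / 2) ^ 3) with (3 / 2 * (Cmod z * Cmod z * (Cmod z / 2))) by field.
    assert (0 <= Cmod z * Cmod z * (Cmod z / 2)) by (repeat apply Rmult_le_pos; lra). nra.
  - unfold crho. eapply Rle_trans; [apply Cmod_triangle_minus|]. rewrite !Cmod_inv by auto.
    assert (/ Cmod z <= 1) by (rewrite <- Rinv_1; apply Rinv_le_contravar; lra).
    assert (/ Cmod (csh (z / 2)) <= 2) by (apply Rle_trans with (/ (1 / 2)); [apply Rinv_le_contravar; lra|lra]). lra.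
Qed.

(** Near 0 the double poles cancel: csh (z / 2)^2 = cch z - 2 turns the numerator over a common
    denominator into 2 (cch z - 2 - z^2) - z^2 (cch (z / 2) - 2), of fourth order like the
    denominator. *)
Lemma crho'_bound : Cmod (crho' z) <= 27.
Proof.
  destruct cone_facts as [N1 [N2 [P L]]].
  assert (N3 : (csh (z / 2) * csh (z / 2))%C <> 0) by (apply Cmult_neq_0; auto).
  assert (N4 : (z * z)%C <> 0) by (apply Cmult_neq_0; auto).
  set (S := Cmod (csh (z / 2))) in *.
  destruct (Rle_dec (Cmod z) 1) as [Hs|Hl].
  - assert (E : crho' z = ((2 * (cch z - 2 - z * z) - z * z * (cch (z / 2) - 2)) / (2 * (z * z) * (csh (z / 2) * csh (z / 2))))%C).
    { unfold crho'. assert (E2 : (csh (z / 2) * csh (z / 2) = cch z - 2)%C).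
      { unfold csh, cch. replace (Cexp z) with (Cexp (z / 2) * Cexp (z / 2))%C by (rewrite <- Cexp_plus; f_equal; field).
        replace (Cexp (- z)) with (Cexp (- (z / 2)) * Cexp (- (z / 2)))%C by (rewrite <- Cexp_plus; f_equal; field).
        assert (E3 : (Cexp (z / 2) * Cexp (- (z / 2)) = 1)%C) by (rewrite <- Cexp_plus, <- Cexp_0; f_equal; ring).
        transitivity (Cexp (z / 2) * Cexp (z / 2) + Cexp (- (z / 2)) * Cexp (- (z / 2)) - 2 * (Cexp (z / 2) * Cexp (- (z / 2))))%C; [rewrite RtoC_2; ring|rewrite E3; ring]. }
      rewrite E2 in *. field. auto. }
    rewrite E, Cmod_div.
    2:{ apply Cmult_neq_0; [apply Cmult_neq_0; [apply RtoC_neq_0; lra|]|]; auto. }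
    rewrite !Cmod_mult, Cmod_R, Rabs_right by lra. fold S.
    assert (B1 := cch_taylor4 z Hs). assert (B2 := cch_taylor2 (z / 2)). rewrite Cmod_half in B2. specialize (B2 ltac:(lra)).
    set (r := Cmod z) in *.
    assert (D : 0 < 2 * (r * r) * (S * S)) by (repeat apply Rmult_lt_0_compat; lra).
    apply Rmult_le_reg_r with (2 * (r * r) * (S * S)); [easy|].
    unfold Rdiv at 1. rewrite Rmult_assoc, Rinv_l, Rmult_1_r by lra.
    eapply Rle_trans; [apply Cmod_triangle_minus|]. rewrite !Cmod_mult, Cmod_R, Rabs_right by lra. fold r.
    assert (H1 : r * r * Cmod (cch (z / 2) - 2) <= r * r * (6 * (r / 2) ^ 2)) by (apply Rmult_le_compat_l; nra).
    assert (H2 : r / 2 * (r / 2) <= S * S) by (apply Rmult_le_compat; lra).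
    assert (H3 : 54 * (r * r) * (r / 2 * (r / 2)) <= 54 * (r * r) * (S * S)) by (apply Rmult_le_compat_l; nra).
    replace (r * r * (6 * (r / 2) ^ 2)) with (3 / 2 * r ^ 4) in H1 by field.
    replace (54 * (r * r) * (r / 2 * (r / 2))) with (27 / 2 * r ^ 4) in H3 by field. lra.
  - unfold crho'. eapply Rle_trans; [apply Cmod_triangle_minus|].
    rewrite Cmod_inv by exact N4. rewrite Cmod_div by (apply Cmult_neq_0; [apply RtoC_neq_0; lra|exact N3]).
    rewrite !Cmod_mult.
    rewrite Cmod_R, Rabs_right by lra. fold S. destruct (csh_half_lower z) as [_ H2]; [lra|]. fold S in H2.
    assert (/ (Cmod z * Cmod z) <= 1) by (rewrite <- Rinv_1; apply Rinv_le_contravar; nra).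
    assert (H3 : Cmod (cch (z / 2)) / (2 * (S * S)) <= (S + 2) / (2 * (S * S))).
    { apply Rmult_le_compat_r; [|easy]. left. apply Rinv_0_lt_compat. nra. }
    assert (H4 : (S + 2) / (2 * (S * S)) <= 10).
    { apply Rmult_le_reg_r with (2 * (S * S)); [nra|]. unfold Rdiv. rewrite Rmult_assoc, Rinv_l by nra. nra. }
    lra.
Qed.
End Cone.

Lemma cder_ext (f g : R -> C) (x : R) (l : C) : (forall y, f y = g y) -> cder f x l -> cder g x l.
Proof.
  intros H [H1 H2]. split.
  - apply (is_derive_ext (fun y => Re (f y))); [intros; now rewrite H|easy].
  - apply (is_derive_ext (fun y => Im (f y))); [intros; now rewrite H|easy].
Qed.

Lemma exp_le_1 (x : R) : x <= 0 -> exp x <= 1.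
Proof. intros Hx. rewrite <- exp_0. now apply exp_le_mono. Qed.

Section Remainder.
Variable sigma : C.
Hypotheses (Hpos : 0 < Re sigma) (Hcone : Rabs (Im sigma) <= Re sigma).

Let a := Re sigma.

Lemma Re_scale (x : R) (z : C) : Re (RtoC x * z) = x * Re z.
Proof. unfold Re. simpl. ring. Qed.

Lemma Im_scale (x : R) (z : C) : Im (RtoC x * z) = x * Im z.
Proof. unfold Im. simpl. ring. Qed.

Let scaled_cone (x : R) : 0 < x -> 0 < Re (RtoC x * sigma) /\ Rabs (Im (RtoC x * sigma)) <= Re (RtoC x * sigma).
Proof.
  intros Hx. rewrite Re_scale, Im_scale, Rabs_mult, (Rabs_right x) by lra. split; nra.
Qed.

Definition remainder_term (x : R) : C := (crho (RtoC x * sigma) * gauss (sigma / 2) x)%C.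

Lemma cder_remainder_term (x : R) : 0 < x ->
  cder remainder_term x ((sigma * crho' (RtoC x * sigma) - RtoC (2 * x) * (sigma / 2) * crho (RtoC x * sigma)) * gauss (sigma / 2) x)%C.
Proof.
  intros Hx. destruct (scaled_cone x Hx) as [H1 H2]. destruct (cone_facts _ H1 H2) as [N1 [N2 _]].
  assert (E : forall y, (RtoC y * sigma / 2 = RtoC y * (sigma / 2))%C) by (intros; field).
  apply cder_gauss. unfold crho.
  apply (cder_ext (fun y => / csh (RtoC y * (sigma / 2)) - / (RtoC y * sigma))%C).
  { intros y. now rewrite <- E. }
  rewrite E in N2. eapply cder_eq.
  - apply cder_minus; apply cder_inv; [exact N2|apply holo_csh|exact N1|apply cder_ray].
  - unfold crho'. rewrite E. field. repeat split; [exact N2| |]; intros E'; apply N1; rewrite E'; ring.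
Qed.

Lemma Cmod_remainder_term (x : R) : 0 < x -> Cmod (remainder_term x) <= 6 * (x * a) * exp (- (x ^ 2 * a / 2)).
Proof.
  intros Hx. destruct (scaled_cone x Hx) as [H1 H2]. unfold remainder_term.
  rewrite Cmod_mult, Cmod_gauss, Re_half. fold a.
  replace (- x ^ 2 * (a / 2)) with (- (x ^ 2 * a / 2)) by field.
  apply Rmult_le_compat_r; [left; apply exp_pos|].
  eapply Rle_trans; [now apply crho_bound|]. assert (H := Cmod_cone _ H2). rewrite Re_scale in H. fold a in H. lra.
Qed.

(** The Gaussian decay in y = a x^2 is weakened to a Lorentzian so that [rsum_lorentz] applies. *)
Lemma Cmod_remainder_deriv (x : R) : 0 < x ->
  Cmod ((sigma * crho' (RtoC x * sigma) - RtoC (2 * x) * (sigma / 2) * crho (RtoC x * sigma)) * gauss (sigma / 2) x)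
  <= 200 * (a / (1 + a * x ^ 2)).
Proof.
  intros Hx. destruct (scaled_cone x Hx) as [H1 H2].
  rewrite Cmod_mult, Cmod_gauss, Re_half. fold a.
  set (y := a * x ^ 2). assert (Hy : 0 <= y) by (apply Rmult_le_pos; [unfold a; lra|apply pow2_ge_0]).
  replace (- x ^ 2 * (a / 2)) with (- (y / 2)) by (unfold y; field).
  assert (S := Cmod_cone _ Hcone). fold a in S. assert (S0 := Cmod_ge_0 sigma).
  assert (B : Cmod (sigma * crho' (RtoC x * sigma) - RtoC (2 * x) * (sigma / 2) * crho (RtoC x * sigma)) <= a * (54 + 12 * y)).
  { eapply Rle_trans; [apply Cmod_triangle_minus|]. rewrite !Cmod_mult, Cmod_R, Rabs_right by lra.
    rewrite Cmod_half. assert (B1 := crho'_bound _ H1 H2). assert (B2 := crho_bound _ H1 H2).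
    rewrite Cmod_mult, Cmod_R, Rabs_right in B2 by lra.
    assert (Cmod sigma * Cmod (crho' (RtoC x * sigma)) <= 2 * a * 27) by (apply Rmult_le_compat; auto; apply Cmod_ge_0).
    assert (2 * x * (Cmod sigma / 2) * Cmod (crho (RtoC x * sigma)) <= 2 * x * (2 * a / 2) * (3 * (x * (2 * a)))).
    { apply Rmult_le_compat; [nra|apply Cmod_ge_0| |].
      - apply Rmult_le_compat_l; lra.
      - eapply Rle_trans; [exact B2|]. apply Rmult_le_compat_l; [lra|]. apply Rmult_le_compat_l; lra. }
    replace (a * (54 + 12 * y)) with (2 * a * 27 + 2 * x * (2 * a / 2) * (3 * (x * (2 * a)))) by (unfold y; field). lra. }
  assert (P : (54 + 12 * y) * (1 + y) * exp (- (y / 2)) <= 200).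
  { apply exp_neg_le; [lra|]. assert (Hy2 : 0 <= y / 2) by lra. generalize (exp_ge_cubic (y / 2) Hy2).
    assert (0 <= y ^ 2) by (apply pow_le; lra). assert (0 <= y ^ 3) by (apply pow_le; lra). intros. simpl in *. nra. }
  apply Rmult_le_reg_r with (1 + y); [lra|].
  replace (200 * (a / (1 + y)) * (1 + y)) with (a * 200) by (field; lra).
  apply Rle_trans with (a * ((54 + 12 * y) * (1 + y) * exp (- (y / 2)))); [|apply Rmult_le_compat_l; [unfold a; lra|easy]].
  replace (a * ((54 + 12 * y) * (1 + y) * exp (- (y / 2)))) with (a * (54 + 12 * y) * exp (- (y / 2)) * (1 + y)) by ring.
  apply Rmult_le_compat_r; [lra|]. apply Rmult_le_compat_r; [left; apply exp_pos|easy].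
Qed.

(** Without a pole the summand has a derivative of size [a] on a range of length 1 / sqrt a, so that
    a single summation by parts suffices, in contrast to the pole part. *)
Lemma remainder_sum_bound (N : nat) : (0 < N)%nat ->
  Cmod (calt (fun i => remainder_term (INR (S i))) N) <= 103 * a + 200 * sqrt a + 6 / INR N.
Proof.
  intros HN. assert (HN' : 0 < INR N) by now apply lt_0_INR.
  assert (V := Cmod_calt_variation (fun i => remainder_term (INR (S i))) N). cbv beta in V.
  assert (Ha : 0 < a) by (unfold a; lra).
  assert (B1 : Cmod (remainder_term (INR 1)) <= 6 * a).
  { simpl (INR 1). eapply Rle_trans; [apply Cmod_remainder_term; lra|].
    assert (exp (- (1 ^ 2 * a / 2)) <= 1) by (apply exp_le_1; lra). nra. }
  assert (B2 : Cmod (remainder_term (INR (S N))) <= 12 / INR N).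
  { assert (Hx : INR N <= INR (S N)) by (rewrite S_INR; lra). set (x := INR (S N)) in *.
    eapply Rle_trans; [apply Cmod_remainder_term; lra|].
    apply Rle_trans with (12 / x); [|apply Rmult_le_compat_l; [lra|apply Rinv_le_contravar; lra]].
    apply exp_neg_le; [apply Rdiv_lt_0_compat; lra|].
    apply Rle_trans with (12 / x * (x ^ 2 * a / 2)).
    - right. field. lra.
    - apply Rmult_le_compat_l; [left; apply Rdiv_lt_0_compat; lra|].
      eapply Rle_trans; [|apply exp_ineq1_le]. lra. }
  assert (B3 : rsum (fun i => Cmod (remainder_term (INR (S (S i))) - remainder_term (INR (S i)))) N <= 200 * (a + 2 * sqrt a)).
  { eapply Rle_trans; [|apply Rmult_le_compat_l; [lra|apply (rsum_lorentz a N Ha)]].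
    rewrite <- rsum_scal. apply rsum_le. intros k _.
    assert (Hk := pos_INR k).
    replace (200 * (a / (1 + a * INR k ^ 2))) with (200 * (a / (1 + a * INR k ^ 2)) * (INR (S (S k)) - INR (S k))) by (rewrite !S_INR; ring).
    eapply cder_mean_value.
    - rewrite !S_INR. lra.
    - intros x Hx. apply cder_remainder_term. rewrite S_INR in Hx. lra.
    - intros x Hx. rewrite S_INR in Hx. eapply Rle_trans; [apply Cmod_remainder_deriv; lra|].
      apply Rmult_le_compat_l; [lra|]. apply Rmult_le_compat_l; [lra|].
      assert (INR k ^ 2 <= x ^ 2) by (apply pow_incr; lra). assert (0 <= INR k ^ 2) by apply pow2_ge_0.
      apply Rinv_le_contravar; nra. }
  replace (6 / INR N) with (12 / INR N / 2) by (field; lra). lra.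
Qed.
End Remainder.

(** In k (k + 1) / 2 = k^2 / 2 + k / 2 the first part gives the Gaussian and the second symmetrises
    the denominator, which is e^(-z/2) csh (z / 2) for z = k m tau. *)
Lemma string_term_decompose (tau : C) (m k : nat) : 0 < Re tau -> Rabs (Im tau) <= Re tau -> (0 < m)%nat -> (0 < k)%nat ->
  let sigma := (RtoC (INR m) * tau)%C in
  (qpow tau (INR (m * tri k)) / (1 - qpow tau (INR (m * k))) =
   / sigma * (RtoC (/ INR k) * gauss (sigma / 2) (INR k)) + remainder_term sigma (INR k))%C.
Proof.
  intros Ht Hc Hm Hk sigma.
  assert (Hm' : 0 < INR m) by now apply lt_0_INR. assert (Hk' : 0 < INR k) by now apply lt_0_INR.
  assert (Hs1 : 0 < Re (RtoC (INR k) * sigma)).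
  { unfold sigma. rewrite !Re_scale. repeat apply Rmult_lt_0_compat; easy. }
  assert (Hs2 : Rabs (Im (RtoC (INR k) * sigma)) <= Re (RtoC (INR k) * sigma)).
  { unfold sigma. rewrite !Re_scale, !Im_scale, !Rabs_mult, !(Rabs_right (INR _)) by lra.
    repeat apply Rmult_le_compat_l; lra. }
  destruct (cone_facts _ Hs1 Hs2) as [N1 [N2 _]].
  assert (Nk : RtoC (INR k) <> 0) by (apply RtoC_neq_0; lra).
  assert (Nm : RtoC (INR m) <> 0) by (apply RtoC_neq_0; lra).
  assert (Nt : tau <> 0) by (intros E; rewrite E in Ht; simpl in Ht; lra).
  unfold remainder_term, crho. set (z := (RtoC (INR k) * sigma)%C) in *.
  assert (E1 : qpow tau (INR (m * tri k)) = (gauss (sigma / 2) (INR k) * Cexp (- (z / 2)))%C).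
  { unfold qpow, gauss. rewrite <- Cexp_plus. f_equal. rewrite mult_INR, tri_INR. unfold z, sigma.
    apply C_eq; unfold Re, Im; simpl; field. }
  assert (E2 : (1 - qpow tau (INR (m * k)) = Cexp (- (z / 2)) * csh (z / 2))%C).
  { unfold csh.
    replace (Cexp (- (z / 2)) * (Cexp (z / 2) - Cexp (- (z / 2))))%C with
      (Cexp (- (z / 2)) * Cexp (z / 2) - Cexp (- (z / 2)) * Cexp (- (z / 2)))%C by ring.
    rewrite <- !Cexp_plus. unfold qpow. f_equal.
    - rewrite <- Cexp_0. f_equal. ring.
    - f_equal. rewrite mult_INR. unfold z, sigma. apply C_eq; unfold Re, Im; simpl; field. }
  rewrite E1, E2, RtoC_inv by lra. unfold z in *. field. repeat split; auto; try apply Cexp_neq_0.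
  unfold sigma. now apply Cmult_neq_0.
Qed.

Lemma string_gf_decompose (tau : C) (m N : nat) : 0 < Re tau -> Rabs (Im tau) <= Re tau -> (0 < m)%nat ->
  let sigma := (RtoC (INR m) * tau)%C in
  string_gf m N tau = (lambert_main N (sigma / 2) / sigma + calt (fun i => remainder_term sigma (INR (S i))) N)%C.
Proof.
  intros Ht Hc Hm sigma. unfold string_gf, lambert_main, calt, Cdiv at 2.
  rewrite Cmult_comm, <- csum_scal, <- csum_plus. apply csum_ext. intros k _.
  rewrite string_term_decompose by (auto; lia). cbv zeta. fold sigma. ring.
Qed.

(** The prefactors 1 / tau of h(q) and m / (m tau) of m h(q^m) agree, so only a difference of
    [lambert_main] sums is divided by tau. The condition 1 <= N t^2 makes the endpoint errors 1 / N
    and 1 / (N t) at most t. *)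
Lemma string_gf_major (m : nat) : (1 <= m)%nat -> exists K, 0 <= K /\ forall (t y : R) (N : nat),
  0 < t <= 1 -> Rabs y <= t -> 1 <= INR N * t ^ 2 ->
  Cmod (string_gf 1 N (ctau t y) - INR m * string_gf m N (ctau t y) - RtoC ((INR m - 1) / 8)) <= K * sqrt t.
Proof.
  intros Hm. assert (Hm' : 1 <= INR m) by (apply (le_INR 1); lia). set (M := INR m) in *.
  exists ((50 * M + 27 * M + 2) * (M - 1) + (103 + 200 + 6) + M * (103 * M + 200 * M + 6)). split; [nra|].
  intros t y N Ht Hy HN.
  assert (HN' : 0 < INR N) by (destruct N; [simpl in HN; lra|apply lt_0_INR; lia]).
  assert (HN'' : (0 < N)%nat) by (apply INR_lt; simpl; lra).
  assert (Hs := sqrt_lt_R0 t (proj1 Ht)). assert (Es := sqrt_sqrt t (Rlt_le _ _ (proj1 Ht))).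
  assert (Hs1 : sqrt t <= 1) by (rewrite <- sqrt_1; apply sqrt_le_1; lra).
  assert (Hts : t <= sqrt t) by nra.
  set (tau := ctau t y). assert (R1 : Re tau = t) by reflexivity. assert (I1 : Im tau = - y) by reflexivity.
  assert (C1 : Rabs (Im tau) <= Re tau) by (rewrite R1, I1, Rabs_Ropp; easy).
  assert (P1 : 0 < Re tau) by (rewrite R1; lra).
  assert (Nt : tau <> 0) by (intros E; rewrite E in P1; simpl in P1; lra).
  assert (NM : RtoC M <> 0) by (apply RtoC_neq_0; lra).
  set (sigma := (RtoC M * tau)%C).
  assert (R2 : Re sigma = M * t) by (unfold sigma; rewrite Re_scale, R1; easy).
  assert (I2 : Im sigma = M * - y) by (unfold sigma; rewrite Im_scale, I1; easy).
  assert (P2 : 0 < Re sigma) by (rewrite R2; nra).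
  assert (C2 : Rabs (Im sigma) <= Re sigma).
  { rewrite R2, I2, Rabs_mult, Rabs_Ropp, (Rabs_right M) by lra. apply Rmult_le_compat_l; lra. }
  assert (Hinv : / (INR N * t) <= t).
  { apply Rmult_le_reg_r with (INR N * t); [nra|]. rewrite Rinv_l by nra. simpl in HN. lra. }
  assert (HinvN : / INR N <= t).
  { apply Rle_trans with (/ (INR N * t)); [|easy]. apply Rinv_le_contravar; nra. }
  assert (HsM : sqrt (M * t) <= M * sqrt t).
  { rewrite sqrt_mult by lra. apply Rmult_le_compat_r; [lra|].
    rewrite <- (sqrt_square M) at 2 by lra. apply sqrt_le_1; nra. }
  assert (B1 := lambert_main_diff tau m N P1 C1 Hm HN''). rewrite R1 in B1. fold M in B1.
  assert (B2 := remainder_sum_bound tau P1 C1 N HN''). rewrite R1 in B2.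
  assert (B3 := remainder_sum_bound sigma P2 C2 N HN''). rewrite R2 in B3.
  assert (D1 := string_gf_decompose tau 1 N P1 C1 (Nat.lt_0_1)).
  assert (D2 := string_gf_decompose tau m N P1 C1 ltac:(lia)). cbv zeta in D1, D2. fold M sigma in D2.
  simpl (INR 1) in D1. rewrite Cmult_1_l in D1.
  set (r1 := calt (fun i => remainder_term tau (INR (S i))) N) in *.
  set (r2 := calt (fun i => remainder_term sigma (INR (S i))) N) in *.
  fold M. rewrite D1, D2.
  replace (M * (tau / 2))%C with (sigma / 2)%C in B1 by (unfold sigma; field).
  set (l1 := lambert_main N (tau / 2)) in *. set (l2 := lambert_main N (sigma / 2)) in *.
  replace (l1 / tau + r1 - M * (l2 / sigma + r2) - RtoC ((M - 1) / 8))%C with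
    ((l1 - l2) / tau - RtoC ((M - 1) / 8) + (r1 - M * r2))%C by (unfold sigma; field; auto).
  eapply Rle_trans; [apply Cmod_triangle|].
  assert (B4 : Cmod (r1 - M * r2) <= (103 * t + 200 * sqrt t + 6 / INR N) + M * (103 * (M * t) + 200 * sqrt (M * t) + 6 / INR N)).
  { eapply Rle_trans; [apply Cmod_triangle_minus|]. rewrite Cmod_mult, Cmod_R, (Rabs_right M) by lra.
    apply Rplus_le_compat; [easy|]. apply Rmult_le_compat_l; lra. }
  assert (E1 : 50 * sqrt (M * t) + 27 * (M * t) + 2 / (INR N * t) <= (50 * M + 27 * M + 2) * sqrt t) by (unfold Rdiv; nra).
  assert (E2 : 103 * t + 200 * sqrt t + 6 / INR N <= (103 + 200 + 6) * sqrt t) by (unfold Rdiv; lra).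
  assert (E3 : 103 * (M * t) + 200 * sqrt (M * t) + 6 / INR N <= (103 * M + 200 * M + 6) * sqrt t) by (unfold Rdiv; nra).
  apply Rle_trans with ((50 * M + 27 * M + 2) * sqrt t * (M - 1) + ((103 + 200 + 6) * sqrt t + M * ((103 * M + 200 * M + 6) * sqrt t))).
  - apply Rplus_le_compat.
    + eapply Rle_trans; [exact B1|]. apply Rmult_le_compat_r; lra.
    + eapply Rle_trans; [exact B4|]. apply Rplus_le_compat; [easy|]. apply Rmult_le_compat_l; lra.
  - right. ring.
Qed.

Lemma one_minus_exp_lower (t : R) : 0 < t <= 1 -> t / 2 <= 1 - exp (- t).
Proof.
  intros Ht. assert (exp (- t) <= / (1 + t)).
  { rewrite exp_Ropp. apply Rinv_le_contravar; [lra|]. apply exp_ineq1_le. }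
  assert (t / 2 <= 1 - / (1 + t)); [|lra].
  apply Rmult_le_reg_r with (1 + t); [lra|]. rewrite Rmult_minus_distr_r, Rinv_l by lra. nra.
Qed.

(** Crude but polynomial in 1 / t and N, which is enough where [Phi] is exponentially small. *)
Lemma string_gf_trivial (t y : R) (m N : nat) : 0 < t <= 1 -> (0 < m)%nat ->
  Cmod (string_gf m N (ctau t y)) <= INR N * (2 / t).
Proof.
  intros Ht Hm. rewrite <- rsum_const. eapply Rle_trans; [apply Cmod_csum|]. apply rsum_le. intros k _.
  rewrite Cmod_mult, Cmod_sign, Rmult_1_l.
  rewrite Cmod_div by (apply one_minus_qpow_neq_0_nat; [lra|nia]).
  assert (H1 : Cmod (qpow (ctau t y) (INR (m * tri (S k)))) <= 1).
  { rewrite Cmod_qpow. apply exp_le_1. simpl (Re _). generalize (pos_INR (m * tri (S k))). nra. }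
  assert (H2 : t / 2 <= Cmod (1 - qpow (ctau t y) (INR (m * S k)))).
  { eapply Rle_trans; [now apply one_minus_exp_lower|]. eapply Rle_trans; [|apply one_minus_qpow_lower].
    apply Rplus_le_compat_l, Ropp_le_contravar, exp_le_mono. simpl (Re _).
    assert (1 <= INR (m * S k)) by (apply (le_INR 1); nia). nra. }
  replace (2 / t) with (1 * / (t / 2)) by (field; lra).
  apply Rmult_le_compat; [apply Cmod_ge_0| |easy|].
  - left. apply Rinv_0_lt_compat. lra.
  - apply Rinv_le_contravar; lra.
Qed.

(** * The partition generating function on a circle *)

Definition rho (t : R) (j : nat) : R := exp (- INR (S j) * t).

Lemma rho_bounds (t : R) (j : nat) : 0 < t -> 0 < rho t j < 1.
Proof.
  intros Ht. split; [apply exp_pos|]. apply exp_lt_1. generalize (lt_0_INR (S j) ltac:(lia)). nra.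
Qed.

Definition logP (J : nat) (t : R) : R := rsum (fun j => - ln (1 - rho t j)) J.

Definition Phi_factor (t : R) (j : nat) (y : R) : C :=
  (RtoC (1 - rho t j) / (1 - qpow (ctau t y) (INR (S j))))%C.

(* P(q) / P(|q|) for P = 1 / (q;q)_J. *)
Definition Phi (J : nat) (t y : R) : C := cprod (fun j => Phi_factor t j y) J.

Lemma partition_gf_Phi (J : nat) (t y : R) : 0 < t ->
  partition_gf J (ctau t y) = (RtoC (exp (logP J t)) * Phi J t y)%C.
Proof.
  intros Ht. unfold partition_gf, logP, Phi. induction J as [|J IH]; cbn [cprod rsum].
  - rewrite exp_0. ring.
  - rewrite IH, exp_plus, exp_Ropp. assert (H := rho_bounds t J Ht). rewrite exp_ln by lra.
    unfold Phi_factor. rewrite RtoC_mult, RtoC_inv by lra. field. split.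
    + apply one_minus_qpow_neq_0_nat; auto; lia.
    + apply RtoC_neq_0. lra.
Qed.

Lemma qpow_rho (t y : R) (j : nat) : qpow (ctau t y) (INR (S j)) = (RtoC (rho t j) * cis (INR (S j) * y))%C.
Proof. apply qpow_cis. Qed.

(** With v = 1 - cos x and d = |1 - r e^(ix)| <= 2, the square of the quotient is 1 - 2 r v / d^2,
    and 1 - u <= e^(-u). *)
Lemma Cmod_geometric_factor (r x : R) : 0 < r < 1 ->
  Cmod (RtoC (1 - r) / (1 - RtoC r * cis x)) <= exp (- (r * (1 - cos x) / 4)).
Proof.
  intros Hr.
  assert (Hc := COS_bound x).
  assert (E : Cmod (1 - RtoC r * cis x) ^ 2 = (1 - r) ^ 2 + 2 * r * (1 - cos x)).
  { rewrite Cmod_sqr. unfold cis, Re, Im. simpl. generalize (sin2_cos2' x). intros H.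
    transitivity (1 - 2 * r * cos x + r * r * (cos x * cos x + sin x * sin x)); [ring|rewrite H; ring]. }
  set (v := 1 - cos x) in *. set (d := Cmod _) in E.
  assert (Hv : 0 <= v <= 2) by (unfold v; lra).
  assert (Hd0 : 0 <= d) by apply Cmod_ge_0.
  assert (Hrv : 0 <= r * v) by nra.
  assert (Hd : 0 < d) by (destruct Hd0 as [|E0]; [easy|rewrite <- E0 in E; simpl in E; nra]).
  rewrite Cmod_div by (apply Cmod_neq_0; exact Hd). rewrite Cmod_R, Rabs_right by lra. fold d.
  assert (Hq : 0 <= (1 - r) / d) by (apply Rdiv_le_0_compat; lra).
  assert (Hsq : ((1 - r) / d) ^ 2 <= exp (- (r * v / 4)) ^ 2).
  { replace (exp (- (r * v / 4)) ^ 2) with (exp (- (r * v / 2))) by (simpl; rewrite Rmult_1_r, <- exp_plus; f_equal; field).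
    replace (((1 - r) / d) ^ 2) with (1 + - (2 * (r * v) / d ^ 2)).
    - apply Rle_trans with (exp (- (2 * (r * v) / d ^ 2))); [apply exp_ineq1_le|].
      apply exp_le_mono, Ropp_le_contravar.
      apply Rmult_le_reg_r with (d ^ 2); [nra|].
      replace (2 * (r * v) / d ^ 2 * d ^ 2) with (2 * (r * v)) by (field; lra).
      assert (d ^ 2 <= 4) by (rewrite E; nra). nra.
    - unfold Rdiv. rewrite Rpow_mult_distr. replace ((1 - r) ^ 2) with (d ^ 2 - 2 * (r * v)) by (rewrite E; ring).
      rewrite pow_inv. field. lra. }
  apply Rnot_lt_le. intros Hlt. assert (P := exp_pos (- (r * v / 4))). nra.
Qed.

(** Four times a lower bound for -log |Phi|: every factor contributes according to the distance of
    e^(i j y) from 1. *)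
Definition phase_defect (J : nat) (t y : R) : R := rsum (fun j => rho t j * (1 - cos (INR (S j) * y))) J.

Lemma Cmod_Phi (J : nat) (t y : R) : 0 < t -> Cmod (Phi J t y) <= exp (- (phase_defect J t y / 4)).
Proof.
  intros Ht. replace (- (phase_defect J t y / 4)) with (rsum (fun j => - (1 / 4) * (rho t j * (1 - cos (INR (S j) * y)))) J).
  - apply Cmod_cprod. intros k _. unfold Phi_factor. rewrite qpow_rho.
    eapply Rle_trans; [apply Cmod_geometric_factor, rho_bounds, Ht|]. right. f_equal. field.
  - rewrite rsum_scal. unfold phase_defect. field.
Qed.

Lemma one_minus_cos_lower (x : R) : 0 <= x <= 1 -> x ^ 2 / 4 <= 1 - cos x.
Proof.
  intros Hx. assert (Hpi := PI2_3_2).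
  destruct (MVT_le (fun x => 1 - cos x - x ^ 2 / 4) (fun x => sin x - x / 2) 0 x) as [c [Hc E]]; [lra| |].
  - intros y _. auto_derive; auto. req. field.
  - rewrite cos_0 in E.
    assert (H1 := x_cos_le_sin c ltac:(lra)).
    assert (H2 : 1 / 2 <= cos c) by (rewrite <- cos_PI3; apply cos_decr_1; lra).
    assert (0 <= sin c - c / 2) by nra. nra.
Qed.

Lemma one_minus_cos_ge (x : R) : 1 <= x <= PI -> 1 / 4 <= 1 - cos x.
Proof.
  intros Hx. assert (H := one_minus_cos_lower 1 ltac:(lra)).
  assert (cos x <= cos 1) by (apply cos_decr_1; lra). lra.
Qed.

(** Parallelogram law for e^(ia) - 1 and e^(ib) - 1, where |e^(ix) - 1|^2 = 2 (1 - cos x). *)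
Lemma one_minus_cos_pair (a b : R) : (1 - cos (b - a)) / 2 <= (1 - cos a) + (1 - cos b).
Proof.
  rewrite cos_minus. assert (Ha := sin2_cos2' a). assert (Hb := sin2_cos2' b).
  set (ca := cos a) in *. set (sa := sin a) in *. set (cb := cos b) in *. set (sb := sin b) in *.
  assert (H : 0 <= (sa - - sb) ^ 2 + (ca + cb - 2) ^ 2) by (apply Rplus_le_le_0_compat; apply pow2_ge_0).
  simpl in H. nra.
Qed.

Lemma nat_floor (x : R) : 0 <= x -> exists n : nat, INR n <= x < INR n + 1.
Proof.
  intros Hx. destruct (nfloor_ex x Hx) as [n Hn]. now exists n.
Qed.

Lemma cos_even_abs (x : R) : cos (Rabs x) = cos x.
Proof. unfold Rabs. destruct (Rcase_abs x); [apply cos_neg|easy]. Qed.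

Lemma rsum_squares (K : nat) : INR K ^ 3 / 3 <= rsum (fun j => INR (S j) ^ 2) K.
Proof.
  induction K as [|K IH]; [simpl; lra|]. rewrite rsum_S. rewrite S_INR at 1. rewrite S_INR. generalize (pos_INR K).
  intros. simpl in *. nra.
Qed.

Lemma rho_lower (t : R) (j : nat) (k : nat) : INR (S j) * t <= INR k -> exp (- INR k) <= rho t j.
Proof. intros H. apply exp_le_mono. lra. Qed.

Lemma exp_neg_nat (k : nat) : / 3 ^ k <= exp (- INR k).
Proof.
  rewrite exp_Ropp. apply Rinv_le_contravar; [apply exp_pos|].
  induction k as [|k IH]; [simpl; rewrite exp_0; lra|].
  rewrite S_INR, exp_plus, Rmult_comm. simpl. apply Rmult_le_compat; [left; apply exp_pos|left; apply exp_pos|apply exp_le_3|easy].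
Qed.

Lemma phase_defect_term_nonneg (t y : R) (j : nat) : 0 <= rho t j * (1 - cos (INR (S j) * y)).
Proof. apply Rmult_le_pos; [left; apply exp_pos|]. generalize (COS_bound (INR (S j) * y)). lra. Qed.

(** Only parts j <= 1 / t are kept: there the weight is at least 1/3 and j |y| <= 1, so each term is
    at least (j y)^2 / 12. With at least 1 / (2 t) parts the squares sum to 1 / (24 t^3), and 288 =
    12 * 24. *)
Lemma phase_defect_near (J : nat) (t y : R) : 0 < t <= 1 -> 1 / t <= INR J -> Rabs y <= t ->
  y ^ 2 / (288 * t ^ 3) <= phase_defect J t y.
Proof.
  intros Ht HJ Hy.
  assert (Hti : 1 <= 1 / t) by (apply Rmult_le_reg_r with t; [lra|]; field_simplify; lra).
  destruct (nat_floor (1 / t)) as [K [HK1 HK2]]; [lra|].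
  assert (HKJ : (K <= J)%nat) by (apply INR_le; lra).
  assert (HKt : INR K * t <= 1) by (apply Rmult_le_reg_r with (/ t); [apply Rinv_0_lt_compat; lra|]; field_simplify; lra).
  assert (HK3 : 1 / (2 * t) <= INR K).
  { replace (1 / (2 * t)) with (1 / t / 2) by (field; lra).
    destruct K as [|K']; [simpl in *; lra|]. assert (1 <= INR (S K')) by (apply (le_INR 1); lia). lra. }
  apply Rle_trans with (rsum (fun j => y ^ 2 / 12 * INR (S j) ^ 2) K).
  - rewrite rsum_scal. apply Rle_trans with (y ^ 2 / 12 * ((1 / (2 * t)) ^ 3 / 3)).
    + right. field. lra.
    + apply Rmult_le_compat_l; [generalize (pow2_ge_0 y); lra|].
      eapply Rle_trans; [|apply rsum_squares]. apply Rmult_le_compat_r; [lra|]. apply pow_incr. split; [|easy].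
      left. apply Rdiv_lt_0_compat; lra.
  - apply Rle_trans with (phase_defect K t y).
    + apply rsum_le. intros j Hj.
      assert (Hj1 : 0 < INR (S j)) by (apply lt_0_INR; lia).
      assert (Hj2 : INR (S j) <= INR K) by (apply le_INR; lia).
      assert (R1 : / 3 <= rho t j).
      { assert (E1 := exp_neg_nat 1). rewrite pow_1 in E1.
        assert (E2 : INR (S j) * t <= INR 1) by (simpl (INR 1); nra).
        generalize (rho_lower t j 1 E2). lra. }
      assert (C1 : (INR (S j) * Rabs y) ^ 2 / 4 <= 1 - cos (INR (S j) * y)).
      { rewrite <- (cos_even_abs (INR (S j) * y)), Rabs_mult, (Rabs_right (INR (S j))) by lra.
        apply one_minus_cos_lower. generalize (Rabs_pos y). split; nra. }
      rewrite Rpow_mult_distr, pow2_abs in C1.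
      apply Rle_trans with (/ 3 * (INR (S j) ^ 2 * y ^ 2 / 4)); [right; field|].
      apply Rmult_le_compat; try lra.
      generalize (pow2_ge_0 (INR (S j))) (pow2_ge_0 y). intros. apply Rmult_le_pos; [nra|lra].
    + apply rsum_mono; [intros; apply phase_defect_term_nonneg|easy].
Qed.

(* The phases j y and (j + g) y cannot both be close to 0 when g y lies in [1, PI]. *)
Lemma phase_defect_far (J : nat) (t y : R) : 0 < t <= 1 -> 3 / t <= INR J -> t <= Rabs y <= PI ->
  1 / (864 * t) <= phase_defect J t y.
Proof.
  intros Ht HJ Hy. assert (Hpi := PI2_3_2).
  assert (Hti : 1 <= 1 / t) by (apply Rmult_le_reg_r with t; [lra|]; field_simplify; lra).
  destruct (nat_floor (1 / t)) as [K [HK1 HK2]]; [lra|].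
  assert (HKt : INR K * t <= 1) by (apply Rmult_le_reg_r with (/ t); [apply Rinv_0_lt_compat; lra|]; field_simplify; lra).
  assert (HK3 : 1 / (2 * t) <= INR K).
  { replace (1 / (2 * t)) with (1 / t / 2) by (field; lra).
    destruct K as [|K']; [simpl in *; lra|]. assert (1 <= INR (S K')) by (apply (le_INR 1); lia). lra. }
  (* For |y| >= 1 take g = 1; otherwise g = floor (1 / |y|) + 1, so that 1 <= g |y| <= 1 + |y| < PI
     and g <= 1 / t + 1 <= 2 / t. The shifted parts then stay below 3 / t, where the weights are at
     least 1/27. *)
  assert (Hg : exists g : nat, INR g <= 2 / t /\ 1 <= INR g * Rabs y <= PI).
  { destruct (Rle_dec 1 (Rabs y)) as [H1|H1].
    - exists 1%nat. simpl. split; [|lra]. unfold Rdiv in *. lra.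
    - destruct (nat_floor (1 / Rabs y)) as [g [Hg1 Hg2]]; [left; apply Rdiv_lt_0_compat; lra|].
      exists (S g). rewrite S_INR.
      assert (Ey : 1 / Rabs y * Rabs y = 1) by (field; lra).
      assert (1 / Rabs y <= 1 / t) by (apply Rmult_le_compat_l; [lra|]; apply Rinv_le_contravar; lra).
      split; [unfold Rdiv in *; lra|]. split; nra. }
  destruct Hg as [g [Hg1 Hg2]].
  assert (HKg : (K + g <= J)%nat) by (apply INR_le; rewrite plus_INR; unfold Rdiv in *; lra).
  assert (V1 : phase_defect K t y <= phase_defect J t y).
  { apply rsum_mono; [intros; apply phase_defect_term_nonneg|lia]. }
  assert (V2 : rsum (fun j => rho t (g + j) * (1 - cos (INR (S (g + j)) * y))) K <= phase_defect J t y).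
  { apply Rle_trans with (phase_defect (g + K) t y).
    - unfold phase_defect at 1. rewrite rsum_split.
      assert (0 <= rsum (fun j => rho t j * (1 - cos (INR (S j) * y))) g) by (apply rsum_nonneg; intros; apply phase_defect_term_nonneg).
      lra.
    - apply rsum_mono; [intros; apply phase_defect_term_nonneg|lia]. }
  assert (V3 : INR K * / 216 <= phase_defect K t y + rsum (fun j => rho t (g + j) * (1 - cos (INR (S (g + j)) * y))) K).
  { unfold phase_defect. rewrite <- rsum_plus, <- rsum_const. apply rsum_le. intros j Hj.
    assert (Hj2 : INR (S j) <= INR K) by (apply le_INR; lia).
    assert (Hj3 : INR (S (g + j)) * t <= INR 3).
    { rewrite <- Nat.add_succ_r, plus_INR. assert (INR g * t <= 2 / t * t) by (apply Rmult_le_compat_r; lra).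
      replace (2 / t * t) with 2 in * by (field; lra).
      assert (INR (S j) * t <= INR K * t) by (apply Rmult_le_compat_r; lra).
      replace (INR 3) with 3 by (simpl; ring). lra. }
    assert (E3 := exp_neg_nat 3). replace (3 ^ 3) with 27 in E3 by ring.
    assert (R1 : / 27 <= rho t (g + j)) by (generalize (rho_lower t (g + j) 3 Hj3); lra).
    assert (R2 : / 27 <= rho t j).
    { apply Rle_trans with (rho t (g + j)); [easy|]. apply exp_le_mono. 
      assert (INR (S j) <= INR (S (g + j))) by (apply le_INR; lia). nra. }
    assert (P := one_minus_cos_pair (INR (S j) * y) (INR (S (g + j)) * y)).
    replace (INR (S (g + j)) * y - INR (S j) * y) with (INR g * y) in P by (rewrite !S_INR, plus_INR; ring).
    assert (P2 : 1 / 4 <= 1 - cos (INR g * y)).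
    { rewrite <- (cos_even_abs (INR g * y)), Rabs_mult, (Rabs_right (INR g)) by (apply Rle_ge, pos_INR).
      now apply one_minus_cos_ge. }
    assert (B1 := COS_bound (INR (S j) * y)). assert (B2 := COS_bound (INR (S (g + j)) * y)).
    assert (/ 27 * (1 - cos (INR (S j) * y)) <= rho t j * (1 - cos (INR (S j) * y))) by (apply Rmult_le_compat_r; lra).
    assert (/ 27 * (1 - cos (INR (S (g + j)) * y)) <= rho t (g + j) * (1 - cos (INR (S (g + j)) * y))) by (apply Rmult_le_compat_r; lra).
    lra. }
  replace (1 / (864 * t)) with (1 / (2 * t) / 432) by (field; lra). lra.
Qed.

Lemma Phi_near (J : nat) (t y : R) : 0 < t <= 1 -> 1 / t <= INR J -> Rabs y <= t ->
  Cmod (Phi J t y) <= exp (- (y ^ 2 / (1152 * t ^ 3))).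
Proof.
  intros Ht HJ Hy. eapply Rle_trans; [apply Cmod_Phi; lra|]. apply exp_le_mono, Ropp_le_contravar.
  assert (H := phase_defect_near J t y Ht HJ Hy).
  replace (y ^ 2 / (1152 * t ^ 3)) with (y ^ 2 / (288 * t ^ 3) / 4) by (field; lra). lra.
Qed.

Lemma Phi_far (J : nat) (t y : R) : 0 < t <= 1 -> 3 / t <= INR J -> t <= Rabs y <= PI ->
  Cmod (Phi J t y) <= exp (- (1 / (3456 * t))).
Proof.
  intros Ht HJ Hy. eapply Rle_trans; [apply Cmod_Phi; lra|]. apply exp_le_mono, Ropp_le_contravar.
  assert (H := phase_defect_far J t y Ht HJ Hy).
  replace (1 / (3456 * t)) with (1 / (864 * t) / 4) by (field; lra). lra.
Qed.

(** * Expansion of the logarithmic derivative of [Phi] in the angle *)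

Lemma Cmod_Ci : Cmod Ci = 1.
Proof. unfold Ci. rewrite Cmod_pair. replace (0 ^ 2 + 1 ^ 2) with 1 by ring. apply sqrt_1. Qed.

Lemma cder_mean_value_abs (f f' : R -> C) (x M : R) :
  (forall s, Rabs s <= Rabs x -> cder f s (f' s)) ->
  (forall s, Rabs s <= Rabs x -> Cmod (f' s) <= M) -> Cmod (f x - f 0) <= M * Rabs x.
Proof.
  intros Hf HM. destruct (Rle_dec 0 x) as [Hx|Hx].
  - rewrite (Rabs_right x) in * by lra. replace (M * x) with (M * (x - 0)) by ring.
    apply (cder_mean_value f f'); auto; intros s Hs; [apply Hf|apply HM]; rewrite Rabs_right; lra.
  - rewrite (Rabs_left x) in * by lra. replace (M * - x) with (M * (0 - x)) by ring.
    replace (f x - f 0)%C with (- (f 0 - f x))%C by ring. rewrite Cmod_opp.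
    apply (cder_mean_value f f'); [lra| |]; intros s Hs; [apply Hf|apply HM]; apply Rabs_le; lra.
Qed.

Lemma cis_0 : cis 0 = 1.
Proof. unfold cis. now rewrite cos_0, sin_0. Qed.

Lemma cder_cis1 (x : R) : cder cis x (Ci * cis x).
Proof.
  apply (cder_ext (fun y => cis (1 * y))); [intros y; now rewrite Rmult_1_l|].
  eapply cder_eq; [apply cder_cis|]. rewrite Rmult_1_l. ring.
Qed.

Lemma Cmod_cis_minus_1 (x : R) : Cmod (cis x - 1) <= Rabs x.
Proof.
  rewrite <- cis_0, <- (Rmult_1_l (Rabs x)).
  apply (cder_mean_value_abs cis (fun s => Ci * cis s)%C); intros s _.
  - apply cder_cis1.
  - rewrite Cmod_mult, Cmod_Ci, Cmod_cis. lra.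
Qed.

Lemma Cmod_cis_minus_linear (x : R) : Cmod (cis x - 1 - Ci * x) <= x ^ 2.
Proof.
  replace (cis x - 1 - Ci * x)%C with ((cis x - Ci * x) - (cis 0 - Ci * 0))%C by (rewrite cis_0; ring).
  replace (x ^ 2) with (Rabs x * Rabs x) by (rewrite <- (pow2_abs x); ring).
  apply (cder_mean_value_abs (fun s => cis s - Ci * s)%C (fun s => Ci * (cis s - 1))%C); intros s Hs.
  - eapply cder_eq.
    + apply cder_minus; [apply cder_cis1|]. apply (cder_scal Ci (fun s => RtoC s)).
      apply cder_RtoC, (is_derive_id (K := R_AbsRing)).
    + unfold one; simpl. ring.
  - rewrite Cmod_mult, Cmod_Ci, Rmult_1_l. eapply Rle_trans; [apply Cmod_cis_minus_1|easy].
Qed.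

Lemma one_minus_rcis_lower (r x : R) : 0 < r < 1 -> 1 - r <= Cmod (1 - RtoC r * cis x).
Proof.
  intros Hr. generalize (Cmod_triangle_inv 1 (RtoC r * cis x)).
  rewrite Cmod_1, Cmod_mult, Cmod_cis, Cmod_R, Rabs_right by lra. lra.
Qed.

(** The error of the linearisation is exactly r / (1 - r)^2 times [(e^(ix) - 1 - ix) (1 - r) + ix r
    (e^(ix) - 1)] / (1 - r e^(ix)); its numerator is at most x^2 and its denominator at least 1 -
    r. *)
Lemma geometric_linearisation (r x : R) : 0 < r < 1 ->
  Cmod (RtoC r * cis x / (1 - RtoC r * cis x) - RtoC (r / (1 - r)) - Ci * x * RtoC (r / (1 - r) ^ 2))
  <= r / (1 - r) ^ 3 * x ^ 2.
Proof.
  intros Hr. assert (L := one_minus_rcis_lower r x Hr).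
  assert (N : (1 - RtoC r * cis x)%C <> 0) by (apply Cmod_neq_0; lra).
  assert (N2 : RtoC (1 - r) <> 0) by (apply RtoC_neq_0; lra).
  assert (E : (RtoC r * cis x / (1 - RtoC r * cis x) - RtoC (r / (1 - r)) - Ci * x * RtoC (r / (1 - r) ^ 2) =
     RtoC (r / (1 - r) ^ 2) * (((cis x - 1 - Ci * x) * RtoC (1 - r) + Ci * x * (RtoC r * (cis x - 1))) / (1 - RtoC r * cis x)))%C).
  { replace (RtoC (r / (1 - r) ^ 2)) with (RtoC r / (RtoC (1 - r) * RtoC (1 - r)))%C by (rewrite <- RtoC_mult, <- RtoC_div by nra; f_equal; field; lra).
    rewrite (RtoC_div r) by lra. rewrite RtoC_minus in *. field. auto. }
  rewrite E, Cmod_mult, Cmod_R, Rabs_right by (apply Rle_ge, Rdiv_le_0_compat; nra).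
  replace (r / (1 - r) ^ 3 * x ^ 2) with (r / (1 - r) ^ 2 * (x ^ 2 / (1 - r))) by (field; lra).
  apply Rmult_le_compat_l; [apply Rdiv_le_0_compat; nra|].
  rewrite Cmod_div by exact N. unfold Rdiv.
  apply Rmult_le_compat; [apply Cmod_ge_0|left; apply Rinv_0_lt_compat; lra| |apply Rinv_le_contravar; lra].
  eapply Rle_trans; [apply Cmod_triangle|]. rewrite !Cmod_mult, Cmod_Ci, !Cmod_R, (Rabs_right (1 - r)), (Rabs_right r) by lra.
  assert (H1 := Cmod_cis_minus_linear x). assert (H2 := Cmod_cis_minus_1 x). assert (H3 := Rabs_pos x).
  assert (Rabs x * Cmod (cis x - 1) <= x ^ 2) by (rewrite <- (pow2_abs x); simpl; nra). nra.
Qed.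

(** [meanP] and [varP] are the mean and the variance of the size of a random partition into parts at
    most [J], drawn with weight e^(-t n) for size n. *)
Definition meanP (J : nat) (t : R) : R := rsum (fun j => INR (S j) * (rho t j / (1 - rho t j))) J.
Definition varP (J : nat) (t : R) : R := rsum (fun j => INR (S j) ^ 2 * (rho t j / (1 - rho t j) ^ 2)) J.

Definition Lam (J : nat) (t y : R) : C :=
  csum (fun j => Ci * INR (S j) * (RtoC (rho t j) * cis (INR (S j) * y) / (1 - RtoC (rho t j) * cis (INR (S j) * y))))%C J.

Lemma cder_Phi (J : nat) (t y : R) : 0 < t -> cder (Phi J t) y (Lam J t y * Phi J t y).
Proof.
  intros Ht. unfold Phi, Lam. induction J as [|J IH]; cbn [cprod csum].
  - eapply cder_eq; [apply cder_const|ring].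
  - assert (Hr := rho_bounds t J Ht).
    assert (N : (1 - RtoC (rho t J) * cis (INR (S J) * y))%C <> 0).
    { apply Cmod_neq_0. generalize (one_minus_rcis_lower _ (INR (S J) * y) Hr). lra. }
    eapply cder_eq.
    + apply cder_mult; [exact IH|]. unfold Phi_factor, Cdiv.
      apply cder_scal. apply (cder_ext (fun y => / (1 - RtoC (rho t J) * cis (INR (S J) * y)))%C).
      { intros z. now rewrite qpow_rho. }
      apply cder_inv; [exact N|]. apply cder_minus; [apply cder_const|]. apply cder_scal, cder_cis.
    + unfold Phi_factor. rewrite qpow_rho. field. exact N.
Qed.

Lemma Phi_0 (J : nat) (t : R) : 0 < t -> Phi J t 0 = 1.
Proof.
  intros Ht. unfold Phi. induction J as [|J IH]; cbn [cprod]; [easy|]. rewrite IH.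
  unfold Phi_factor. rewrite qpow_rho, Rmult_0_r, cis_0. assert (Hr := rho_bounds t J Ht).
  replace (1 - RtoC (rho t J) * 1)%C with (RtoC (1 - rho t J)) by (rewrite RtoC_minus; ring).
  field. apply RtoC_neq_0. lra.
Qed.

(** For a part n and X = n t, the bound 1 - e^(-X) >= X / (1 + X) leads to ((1 + X) / t)^3 e^(-X).
    Half of the exponential absorbs (1 + X)^3, with 48 forced by the cubic term (X / 2)^3 / 6; the
    other half is left for the summation. *)
Lemma third_moment_term (t : R) (j : nat) : 0 < t <= 1 ->
  INR (S j) ^ 3 * (rho t j / (1 - rho t j) ^ 3) <= 48 / t ^ 3 * exp (- (INR (S j) * t / 2)).
Proof.
  intros Ht. assert (Hr := rho_bounds t j (proj1 Ht)). assert (Hn := lt_0_INR (S j) ltac:(lia)).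
  set (n := INR (S j)) in *. set (X := n * t). assert (HX : 0 < X) by (unfold X; nra).
  assert (E : rho t j = exp (- X)) by (unfold rho; f_equal; unfold X, n; ring).
  assert (L : X / (1 + X) <= 1 - rho t j).
  { rewrite E, exp_Ropp. assert (/ exp X <= / (1 + X)) by (apply Rinv_le_contravar; [lra|apply exp_ineq1_le]).
    replace (X / (1 + X)) with (1 - / (1 + X)) by (field; lra). lra. }
  assert (L2 : n / (1 - rho t j) <= (1 + X) / t).
  { replace ((1 + X) / t) with (n * / (X / (1 + X))) by (unfold X; field; split; [|split]; unfold X in *; nra).
    apply Rmult_le_compat_l; [lra|]. apply Rinv_le_contravar; [apply Rdiv_lt_0_compat; lra|easy]. }
  replace (n ^ 3 * (rho t j / (1 - rho t j) ^ 3)) with ((n / (1 - rho t j)) ^ 3 * rho t j) by (field; lra).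
  assert (L3 : (n / (1 - rho t j)) ^ 3 <= ((1 + X) / t) ^ 3).
  { apply pow_incr. split; [apply Rdiv_le_0_compat; lra|easy]. }
  apply Rle_trans with (((1 + X) / t) ^ 3 * rho t j); [apply Rmult_le_compat_r; lra|].
  rewrite E. replace (exp (- X)) with (exp (- (X / 2)) * exp (- (X / 2))) by (rewrite <- exp_plus; f_equal; field).
  assert (P : (1 + X) ^ 3 * exp (- (X / 2)) <= 48).
  { apply exp_neg_le; [lra|]. assert (HX2 : 0 <= X / 2) by lra. generalize (exp_ge_cubic (X / 2) HX2).
    assert (0 <= X ^ 2) by (apply pow_le; lra). assert (0 <= X ^ 3) by (apply pow_le; lra). intros. simpl in *. nra. }
  replace (((1 + X) / t) ^ 3 * (exp (- (X / 2)) * exp (- (X / 2)))) with (((1 + X) ^ 3 * exp (- (X / 2))) * (/ t ^ 3 * exp (- (X / 2)))) by (field; lra).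
  replace (48 / t ^ 3 * exp (- (X / 2))) with (48 * (/ t ^ 3 * exp (- (X / 2)))) by (field; lra).
  apply Rmult_le_compat_r; [|exact P].
  apply Rmult_le_pos; [left; apply Rinv_0_lt_compat, pow_lt; lra|left; apply exp_pos].
Qed.

Lemma geometric_exp_sum (c : R) (J : nat) : 0 < c -> rsum (fun j => exp (- (INR (S j) * c))) J <= 1 / c.
Proof.
  intros Hc. set (x := exp (- c)). assert (Hx : 0 < x < 1) by (split; [apply exp_pos|apply exp_lt_1; lra]).
  assert (E : forall K, rsum (fun j => exp (- (INR (S j) * c))) K * (1 - x) = x * (1 - exp (- (INR K * c)))).
  { induction K as [|K IH]; [simpl rsum; simpl (INR 0); replace (- (0 * c)) with 0 by ring; rewrite exp_0; ring|].
    rewrite rsum_S, Rmult_plus_distr_r, IH. rewrite !S_INR.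
    replace (exp (- ((INR K + 1) * c))) with (exp (- (INR K * c)) * x) by (unfold x; rewrite <- exp_plus; f_equal; ring). ring. }
  assert (L : x * (1 + c) <= 1).
  { unfold x. rewrite Rmult_comm. rewrite <- (Rmult_1_l 1). replace (1 * 1) with 1 by ring. apply exp_neg_le; [lra|].
    rewrite Rmult_1_l. apply exp_ineq1_le. }
  apply Rmult_le_reg_r with (1 - x); [lra|]. rewrite E.
  assert (0 < exp (- (INR J * c))) by apply exp_pos.
  apply Rle_trans with x; [nra|]. apply Rmult_le_reg_r with c; [lra|]. 
  replace (1 / c * (1 - x) * c) with (1 - x) by (field; lra). lra.
Qed.

Lemma third_moment_bound (J : nat) (t : R) : 0 < t <= 1 ->
  rsum (fun j => INR (S j) ^ 3 * (rho t j / (1 - rho t j) ^ 3)) J <= 96 / t ^ 4.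
Proof.
  intros Ht. apply Rle_trans with (rsum (fun j => 48 / t ^ 3 * exp (- (INR (S j) * (t / 2)))) J).
  - apply rsum_le. intros j _. replace (INR (S j) * (t / 2)) with (INR (S j) * t / 2) by field. now apply third_moment_term.
  - rewrite rsum_scal. apply Rle_trans with (48 / t ^ 3 * (1 / (t / 2))).
    + apply Rmult_le_compat_l; [left; apply Rdiv_lt_0_compat; [lra|apply pow_lt; lra]|]. apply geometric_exp_sum. lra.
    + right. field. lra.
Qed.

(** The orders 0 and 1 in y produce i times the mean and i^2 times the variance; the quadratic error
    is a third moment, of order t^(-4). *)
Lemma Lam_expansion (J : nat) (t y : R) : 0 < t <= 1 ->
  Cmod (Lam J t y - (Ci * meanP J t - RtoC (varP J t * y))) <= 96 / t ^ 4 * y ^ 2.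
Proof.
  intros Ht.
  apply Rle_trans with (rsum (fun j => y ^ 2 * (INR (S j) ^ 3 * (rho t j / (1 - rho t j) ^ 3))) J).
  2:{ rewrite rsum_scal, Rmult_comm. apply Rmult_le_compat_r; [apply pow2_ge_0|now apply third_moment_bound]. }
  replace (Lam J t y - (Ci * meanP J t - RtoC (varP J t * y)))%C with
    (csum (fun j => Ci * INR (S j) * (RtoC (rho t j) * cis (INR (S j) * y) / (1 - RtoC (rho t j) * cis (INR (S j) * y))
      - RtoC (rho t j / (1 - rho t j)) - Ci * (INR (S j) * y)%R * RtoC (rho t j / (1 - rho t j) ^ 2)))%C J).
  - eapply Rle_trans; [apply Cmod_csum|]. apply rsum_le. intros j _.
    rewrite !Cmod_mult, Cmod_Ci, Cmod_R, Rabs_right by (apply Rle_ge, pos_INR).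
    assert (H := geometric_linearisation (rho t j) (INR (S j) * y) (rho_bounds t j (proj1 Ht))).
    apply Rle_trans with (1 * INR (S j) * (rho t j / (1 - rho t j) ^ 3 * (INR (S j) * y) ^ 2)).
    + apply Rmult_le_compat_l; [rewrite Rmult_1_l; apply pos_INR|exact H].
    + right. ring.
  - unfold Lam, meanP, varP. rewrite RtoC_mult, <- !csum_RtoC.
    replace (Ci * csum (fun k => RtoC (INR (S k) * (rho t k / (1 - rho t k)))) J)%C with
       (csum (fun k => Ci * RtoC (INR (S k) * (rho t k / (1 - rho t k))))%C J) by apply csum_scal.
    rewrite csum_mult_r, <- !csum_minus. apply csum_ext. intros j _.
    assert (I2 : (Ci * Ci = - (1))%C) by (unfold Ci; apply C_eq; unfold Re, Im; simpl; ring).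
    set (a := (_ / _)%C). set (b := rho t j / (1 - rho t j)). set (d := rho t j / (1 - rho t j) ^ 2).
    replace (INR (S j) ^ 2 * d) with (INR (S j) * INR (S j) * d) by ring. rewrite !RtoC_mult.
    transitivity (Ci * INR (S j) * a - Ci * (INR (S j) * b) - (Ci * Ci) * (INR (S j) * INR (S j) * d * y))%C; [ring|rewrite I2; ring].
Qed.

(* [Phi] solves Phi' = Lam Phi; the quotient of [Phi] and the Gaussian has a small logarithmic derivative. *)
Lemma Phi_gaussian (J : nat) (t y B' a1 b1 s : R) (n : Z) : 0 < s -> t = s ^ 2 -> t <= 1 -> 1 / t <= INR J -> Rabs y <= t ->
  / (576 * t ^ 3) <= B' -> Rabs (meanP J t - IZR n) <= a1 / t -> Rabs (varP J t - B') <= b1 / s ^ 5 ->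
  Cmod (Phi J t y * cis (- IZR n * y) - RtoC (exp (- (B' * y ^ 2 / 2)))) <=
  (a1 / t + b1 / s ^ 5 * Rabs y + 96 / t ^ 4 * y ^ 2) * Rabs y * exp (- (y ^ 2 / (1152 * t ^ 3))).
Proof.
  intros Hs Et Ht1 HJ Hy HB HA HV. assert (Ht : 0 < t) by (rewrite Et; apply pow_lt; lra).
  (* The gap between the Gaussian rate and the decay rate of [Phi_near]. As it is nonnegative, exp
     (c x^2) may be replaced by its value at y, and multiplying back by the Gaussian restores
     exactly that decay. *)
  set (c := B' / 2 - / (1152 * t ^ 3)).
  assert (Hc : 0 <= c).
  { unfold c. replace (/ (1152 * t ^ 3)) with (/ (576 * t ^ 3) / 2) by (field; lra). lra. }
  pose (Q := fun y : R => (Phi J t y * cis (- IZR n * y) * RtoC (exp (B' * y ^ 2 / 2)))%C).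
  assert (Q0 : Q 0 = 1).
  { unfold Q. rewrite Phi_0, Rmult_0_r, cis_0 by easy. replace (B' * 0 ^ 2 / 2) with 0 by field. rewrite exp_0. ring. }
  assert (HQ : Cmod (Q y - Q 0) <= (a1 / t + b1 / s ^ 5 * Rabs y + 96 / t ^ 4 * y ^ 2) * exp (c * y ^ 2) * Rabs y).
  { apply (cder_mean_value_abs Q (fun y => (Lam J t y - Ci * IZR n + RtoC (B' * y)) * Q y)%C).
    - intros x _. unfold Q. eapply cder_eq.
      + apply cder_mult; [apply cder_mult; [now apply cder_Phi|apply cder_cis]|].
        apply (cder_RtoC (fun y => exp (B' * y ^ 2 / 2)) x (B' * x * exp (B' * x ^ 2 / 2))).
        auto_derive; auto. replace (B' * (x * (x * 1)) * / 2) with (B' * x ^ 2 / 2) by (simpl; field). req. field.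
      + rewrite RtoC_opp, !RtoC_mult. ring.
    - intros x Hx. rewrite Cmod_mult.
      assert (Hx2 : x ^ 2 <= y ^ 2) by (rewrite <- (pow2_abs x), <- (pow2_abs y); apply pow_incr; split; [apply Rabs_pos|easy]).
      assert (P4 : 0 < t ^ 4) by (apply pow_lt; lra). assert (P5 : 0 < s ^ 5) by (apply pow_lt; lra).
      assert (A0 : 0 <= a1 / t) by (generalize (Rabs_pos (meanP J t - IZR n)); lra).
      assert (B0 : 0 <= b1 / s ^ 5) by (generalize (Rabs_pos (varP J t - B')); lra).
      assert (C0 : 0 <= 96 / t ^ 4) by (apply Rdiv_le_0_compat; lra).
      apply Rmult_le_compat; try apply Cmod_ge_0.
      + replace (Lam J t x - Ci * IZR n + RtoC (B' * x))%C with
          ((Lam J t x - (Ci * meanP J t - RtoC (varP J t * x))) + (Ci * RtoC (meanP J t - IZR n) - RtoC ((varP J t - B') * x)))%C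
          by (rewrite !RtoC_mult, !RtoC_minus; ring).
        eapply Rle_trans; [apply Cmod_triangle|]. 
        assert (L := Lam_expansion J t x (conj Ht Ht1)).
        assert (M : Cmod (Ci * RtoC (meanP J t - IZR n) - RtoC ((varP J t - B') * x)) <= a1 / t + b1 / s ^ 5 * Rabs y).
        { eapply Rle_trans; [apply Cmod_triangle_minus|]. rewrite Cmod_mult, Cmod_Ci, !Cmod_R, Rmult_1_l, Rabs_mult.
          apply Rplus_le_compat; [easy|]. apply Rmult_le_compat; auto using Rabs_pos. }
        assert (96 / t ^ 4 * x ^ 2 <= 96 / t ^ 4 * y ^ 2) by (apply Rmult_le_compat_l; lra). lra.
      + unfold Q. rewrite !Cmod_mult, Cmod_cis, Cmod_R, Rabs_right, Rmult_1_r by (left; apply exp_pos).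
        apply Rle_trans with (exp (- (x ^ 2 / (1152 * t ^ 3))) * exp (B' * x ^ 2 / 2)).
        * apply Rmult_le_compat_r; [left; apply exp_pos|]. apply Phi_near; auto. lra.
        * rewrite <- exp_plus. apply exp_le_mono. replace (- (x ^ 2 / (1152 * t ^ 3)) + B' * x ^ 2 / 2) with (c * x ^ 2) by (unfold c; field; lra).
          apply Rmult_le_compat_l; lra. }
  rewrite Q0 in HQ.
  replace (Phi J t y * cis (- IZR n * y) - RtoC (exp (- (B' * y ^ 2 / 2))))%C with (RtoC (exp (- (B' * y ^ 2 / 2))) * (Q y - 1))%C.
  - rewrite Cmod_mult, Cmod_R, Rabs_right by (left; apply exp_pos).
    replace (exp (- (y ^ 2 / (1152 * t ^ 3)))) with (exp (- (B' * y ^ 2 / 2)) * exp (c * y ^ 2)) by (rewrite <- exp_plus; f_equal; unfold c; field; lra).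
    assert (P := exp_pos (- (B' * y ^ 2 / 2))). 
    apply Rle_trans with (exp (- (B' * y ^ 2 / 2)) * ((a1 / t + b1 / s ^ 5 * Rabs y + 96 / t ^ 4 * y ^ 2) * exp (c * y ^ 2) * Rabs y)).
    + apply Rmult_le_compat_l; lra.
    + right. ring.
  - assert (E : (RtoC (exp (- (B' * y ^ 2 / 2))) * RtoC (exp (B' * y ^ 2 / 2)) = 1)%C).
    { rewrite <- RtoC_mult, <- exp_plus. replace (- (B' * y ^ 2 / 2) + B' * y ^ 2 / 2) with 0 by ring. now rewrite exp_0. }
    unfold Q. transitivity (Phi J t y * cis (- IZR n * y) * (RtoC (exp (- (B' * y ^ 2 / 2))) * RtoC (exp (B' * y ^ 2 / 2))) - RtoC (exp (- (B' * y ^ 2 / 2))))%C.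
    + ring.
    + rewrite E. ring.
Qed.

(** The exponential is a cube, which leaves (1 + v) exp (-v / 3456) <= 3456 for v = u^2, with 3456 =
    3 * 1152. *)
Lemma gaussian_poly_bound (u : R) (k : R) : 0 <= k ->
  k * (1 + u ^ 2) ^ 3 * exp (- (u ^ 2 / 1152)) <= k * 3456 ^ 3.
Proof.
  intros Hk. rewrite Rmult_assoc. apply Rmult_le_compat_l; [easy|].
  assert (Hu := pow2_ge_0 u). set (v := u ^ 2) in *. set (x := v / 1152).
  replace (exp (- x)) with (exp (- (x / 3)) ^ 3).
  - rewrite <- Rpow_mult_distr. apply pow_incr. split; [apply Rmult_le_pos; [lra|left; apply exp_pos]|].
    apply exp_neg_le; [lra|]. generalize (exp_ineq1_le (x / 3)). unfold x. lra.
  - simpl. rewrite Rmult_1_r, <- !exp_plus. f_equal. field.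
Qed.

(** In the scale u = |y| / s^3, with t = s^2, the errors of mean, variance and third order all
    become s times a power of u. The Gaussian gives way to a Lorentzian, whose integral is
    elementary. *)
Lemma major_arc_profile (a1 b1 s y : R) : 0 < s -> 0 <= a1 -> 0 <= b1 ->
  (a1 / s ^ 2 + b1 / s ^ 5 * Rabs y + 96 / (s ^ 2) ^ 4 * y ^ 2) * Rabs y * exp (- (y ^ 2 / (1152 * (s ^ 2) ^ 3)))
  <= (a1 + b1 + 96) * 3456 ^ 3 * s / (1 + (y / s ^ 3) ^ 2).
Proof.
  intros Hs Ha Hb. set (u := Rabs y / s ^ 3). assert (P3 : 0 < s ^ 3) by (apply pow_lt; lra).
  assert (Hu : 0 <= u) by (apply Rdiv_le_0_compat; [apply Rabs_pos|easy]).
  assert (Ey : Rabs y = u * s ^ 3) by (unfold u; field; lra).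
  assert (Ey2 : y ^ 2 = u ^ 2 * s ^ 6) by (rewrite <- pow2_abs, Ey; ring).
  replace ((y / s ^ 3) ^ 2) with (u ^ 2) by (unfold Rdiv; rewrite Rpow_mult_distr, Ey2; field; lra).
  rewrite Ey2, Ey.
  replace (u ^ 2 * s ^ 6 / (1152 * (s ^ 2) ^ 3)) with (u ^ 2 / 1152) by (field; lra).
  replace ((a1 / s ^ 2 + b1 / s ^ 5 * (u * s ^ 3) + 96 / (s ^ 2) ^ 4 * (u ^ 2 * s ^ 6)) * (u * s ^ 3))
    with (s * (a1 * u + b1 * u ^ 2 + 96 * u ^ 3)) by (field; lra).
  assert (G := gaussian_poly_bound u (a1 + b1 + 96) ltac:(lra)).
  assert (Hu2 := pow2_ge_0 u).
  apply Rmult_le_reg_r with (1 + u ^ 2); [lra|].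
  replace ((a1 + b1 + 96) * 3456 ^ 3 * s / (1 + u ^ 2) * (1 + u ^ 2)) with (s * ((a1 + b1 + 96) * 3456 ^ 3)) by (field; lra).
  eapply Rle_trans; [|apply Rmult_le_compat_l; [lra|exact G]].
  replace (s * (a1 * u + b1 * u ^ 2 + 96 * u ^ 3) * exp (- (u ^ 2 / 1152)) * (1 + u ^ 2)) with
    (s * (((a1 * u + b1 * u ^ 2 + 96 * u ^ 3) * (1 + u ^ 2)) * exp (- (u ^ 2 / 1152)))) by ring.
  apply Rmult_le_compat_l; [lra|]. apply Rmult_le_compat_r; [left; apply exp_pos|].
  replace ((a1 + b1 + 96) * (1 + u ^ 2) ^ 3) with ((a1 * (1 + u ^ 2) ^ 2 + b1 * (1 + u ^ 2) ^ 2 + 96 * (1 + u ^ 2) ^ 2) * (1 + u ^ 2)) by ring.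
  apply Rmult_le_compat_r; [lra|].
  assert (U1 : u <= 1 + u ^ 2) by nra.
  assert (U2 : u <= (1 + u ^ 2) ^ 2) by nra. assert (U3 : u ^ 2 <= (1 + u ^ 2) ^ 2) by nra.
  assert (U4 : u ^ 3 <= (1 + u ^ 2) ^ 2) by nra.
  repeat apply Rplus_le_compat; apply Rmult_le_compat_l; lra.
Qed.

(** * The partition generating function on the real axis *)

Definition nlog (x : R) : R := - ln (1 - exp (- x)).
(** Adding ln x removes the singularity of [nlog] at 0. Alternating sums are handled through the
    concave [slog] at small arguments and the convex [nlog] at large ones. *)
Definition slog (x : R) : R := nlog x + ln x.
Definition slog' (x : R) : R := / x - / (exp x - 1).

Lemma logP_nlog (J : nat) (t : R) : logP J t = rsum (fun j => nlog (INR (S j) * t)) J.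
Proof.
  apply rsum_ext. intros k _. unfold nlog, rho. do 4 f_equal. ring.
Qed.

Lemma exp_minus_1_ge (x : R) : x <= exp x - 1.
Proof. generalize (exp_ineq1_le x). lra. Qed.

Lemma is_derive_nlog (x : R) : 0 < x -> is_derive nlog x (- / (exp x - 1)).
Proof.
  intros Hx. assert (H := exp_minus_1_ge x). assert (P := exp_pos x).
  assert (exp (- x) < 1) by (apply exp_lt_1; lra).
  unfold nlog. auto_derive; [lra|]. req. rewrite exp_Ropp. field. lra.
Qed.

Lemma is_derive_slog (x : R) : 0 < x -> is_derive slog x (slog' x).
Proof.
  intros Hx. unfold slog, slog'. eapply is_derive_eq.
  - apply (is_derive_plus (K := R_AbsRing) (V := R_NormedModule)); [now apply is_derive_nlog|].
    apply (is_derive_ln x Hx).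
  - unfold plus; simpl. req. ring.
Qed.

(** The sign of the second derivative at c amounts to c e^(c/2) <= e^c - 1, that is, c <= 2 sinh (c
    / 2). *)
Lemma slog'_decr (x y : R) : 0 < x -> x <= y -> slog' y <= slog' x.
Proof.
  intros Hx Hxy.
  destruct (MVT_le slog' (fun u => - / u ^ 2 + exp u / (exp u - 1) ^ 2) x y Hxy) as [c [Hc E]].
  - intros u Hu. unfold slog'. assert (H := exp_minus_1_ge u). auto_derive; [repeat split; lra|]. req. field. lra.
  - assert (H : exp c / (exp c - 1) ^ 2 <= / c ^ 2).
    { assert (H := exp_minus_1_ge c). assert (S := two_sinh_ge (c / 2) ltac:(lra)).
      assert (E1 : exp c = exp (c / 2) * exp (c / 2)) by (rewrite <- exp_plus; f_equal; field).
      assert (E2 : exp (- (c / 2)) * exp (c / 2) = 1) by (rewrite <- exp_plus, <- exp_0; f_equal; ring).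
      assert (P := exp_pos (c / 2)). set (a := exp (c / 2)) in *. set (b := exp (- (c / 2))) in *.
      assert (K : c * a <= exp c - 1) by (rewrite E1; nra).
      apply Rmult_le_reg_r with (c ^ 2 * (exp c - 1) ^ 2); [apply Rmult_lt_0_compat; apply pow_lt; lra|].
      replace (exp c / (exp c - 1) ^ 2 * (c ^ 2 * (exp c - 1) ^ 2)) with ((c * a) * (c * a)) by (rewrite E1 at 1; field; lra).
      replace (/ c ^ 2 * (c ^ 2 * (exp c - 1) ^ 2)) with ((exp c - 1) * (exp c - 1)) by (field; lra).
      apply Rmult_le_compat; nra. }
    nra.
Qed.

Lemma slog'_bounds (x : R) : 0 < x -> 0 <= slog' x <= 1.
Proof.
  intros Hx. unfold slog'. assert (H := exp_minus_1_ge x). split.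
  - assert (/ (exp x - 1) <= / x) by (apply Rinv_le_contravar; lra). lra.
  - assert (H2 := exp_ineq1_le (- x)). assert (P := exp_pos x).
    assert (E2 : exp (- x) * exp x = 1) by (rewrite <- exp_plus, <- exp_0; f_equal; ring).
    assert (K : (1 - x) * exp x <= 1) by nra.
    apply Rmult_le_reg_r with (x * (exp x - 1)); [nra|].
    replace ((/ x - / (exp x - 1)) * (x * (exp x - 1))) with (exp x - 1 - x) by (field; lra). nra.
Qed.

(** The gaps decrease, so the selected gaps dominate those that follow them and are dominated by
    those that precede them; comparing with all gaps, which telescope, costs at most the first
    one. *)
Lemma alternating_convex (a : nat -> R) (K : nat) :
  (forall i, 0 <= a i - a (S i)) -> (forall i, a (S i) - a (S (S i)) <= a i - a (S i)) ->
  a O - a (2 * K)%nat <= 2 * rsum (fun i => a (2 * i)%nat - a (2 * i + 1)%nat) K <= a O - a (2 * K)%nat + (a O - a 1%nat).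
Proof.
  intros H0 H1. 
  (* The upper bound is strengthened by the next gap so that the induction closes. *)
  assert (H : a O - a (2 * K)%nat <= 2 * rsum (fun i => a (2 * i)%nat - a (2 * i + 1)%nat) K /\
    2 * rsum (fun i => a (2 * i)%nat - a (2 * i + 1)%nat) K <= a O - a (2 * K)%nat + (a O - a 1%nat) - (a (2 * K)%nat - a (2 * K + 1)%nat)).
  { induction K as [|K IH].
    - simpl. lra.
    - rewrite rsum_S. replace (2 * S K)%nat with (S (S (2 * K))) by lia.
      replace (S (S (2 * K)) + 1)%nat with (S (S (S (2 * K)))) by lia.
      replace (2 * K + 1)%nat with (S (2 * K)) in * by lia.
      generalize (H1 (2 * K)%nat) (H1 (S (2 * K))). lra. }
  generalize (H0 (2 * K)%nat). replace (S (2 * K)) with (2 * K + 1)%nat by lia. lra.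
Qed.

Lemma decr_deriv_increments (F F' : R -> R) (x t : R) : 0 < x -> 0 <= t ->
  (forall y, 0 < y -> is_derive F y (F' y)) -> (forall y z, 0 < y -> y <= z -> F' z <= F' y) ->
  F (x + t + t) - F (x + t) <= F (x + t) - F x.
Proof.
  intros Hx Ht HF Hd.
  destruct (MVT_le F F' x (x + t)) as [c [Hc Ec]]; [lra|intros; apply HF; lra|].
  destruct (MVT_le F F' (x + t) (x + t + t)) as [d [Hd1 Ed]]; [lra|intros; apply HF; lra|].
  rewrite Ec, Ed. replace (x + t - x) with t by ring. replace (x + t + t - (x + t)) with t by ring.
  apply Rmult_le_compat_r; [easy|]. apply Hd; lra.
Qed.

Lemma slog_increment (x t : R) : 0 < x -> 0 <= t -> 0 <= slog (x + t) - slog x <= t.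
Proof.
  intros Hx Ht. destruct (MVT_le slog slog' x (x + t)) as [c [Hc Ec]]; [lra|intros; apply is_derive_slog; lra|].
  rewrite Ec. replace (x + t - x) with t by ring. generalize (slog'_bounds c ltac:(lra)). nra.
Qed.

Lemma nlog_increment (x t : R) : 0 < x -> 0 <= t -> 0 <= nlog x - nlog (x + t) <= t / x.
Proof.
  intros Hx Ht. destruct (MVT_le nlog (fun y => - / (exp y - 1)) x (x + t)) as [c [Hc Ec]]; [lra|intros; apply is_derive_nlog; lra|].
  replace (nlog x - nlog (x + t)) with (- (nlog (x + t) - nlog x)) by ring. rewrite Ec. replace (x + t - x) with t by ring.
  assert (H := exp_minus_1_ge c). assert (H1 : / (exp c - 1) <= / x) by (apply Rinv_le_contravar; lra).
  assert (0 < / (exp c - 1)) by (apply Rinv_0_lt_compat; lra). unfold Rdiv. nra.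
Qed.

Lemma nlog_bounds (x : R) : 0 < x -> 0 <= nlog x <= exp (- x) / (1 - exp (- x)).
Proof.
  intros Hx. unfold nlog. assert (E := exp_pos (- x)). assert (exp (- x) < 1) by (apply exp_lt_1; lra).
  set (y := 1 - exp (- x)) in *. assert (Hy : 0 < y < 1) by (unfold y; lra). replace (exp (- x)) with (1 - y) by (unfold y; ring).
  split.
  - assert (ln y <= 0) by (rewrite <- ln_1; apply ln_le; lra). lra.
  - rewrite <- ln_Rinv by lra. assert (P : 0 < / y) by (apply Rinv_0_lt_compat; lra).
    assert (H1 := exp_ineq1_le (ln (/ y))). rewrite exp_ln in H1 by easy.
    replace ((1 - y) / y) with (/ y - 1) by (field; lra). lra.
Qed.

Lemma nlog_le_inv (x : R) : 0 < x -> nlog x <= / x.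
Proof.
  intros Hx. eapply Rle_trans; [apply nlog_bounds, Hx|].
  assert (H := exp_minus_1_ge x). replace (exp (- x) / (1 - exp (- x))) with (/ (exp x - 1)).
  - apply Rinv_le_contravar; lra.
  - rewrite exp_Ropp. field. split; [lra|]. generalize (exp_pos x); lra.
Qed.

Lemma slog_small (t : R) : 0 < t <= 1 -> 0 <= slog t <= t.
Proof.
  intros Ht. unfold slog, nlog. assert (E := exp_pos (- t)). assert (H1 : exp (- t) < 1) by (apply exp_lt_1; lra).
  assert (P : 0 < exp t) by apply exp_pos.
  assert (E1 : exp (- t) * exp t = 1) by (rewrite <- exp_plus, <- exp_0; f_equal; ring).
  assert (L1 : 1 - exp (- t) <= t) by (generalize (exp_ineq1_le (- t)); lra).
  assert (L2 : t * exp (- t) <= 1 - exp (- t)).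
  { generalize (exp_ineq1_le t). intros. nra. }
  split.
  - assert (ln (1 - exp (- t)) <= ln t) by (apply ln_le; lra). lra.
  - assert (H : ln (t * exp (- t)) <= ln (1 - exp (- t))) by (apply ln_le; [apply Rmult_lt_0_compat; lra|easy]).
    rewrite ln_mult, ln_exp in H by lra. lra.
Qed.

(** The logarithm of 2 4 ... (2 L) / (1 3 ... (2 L - 1)). *)
Definition wallis_log (L : nat) : R := rsum (fun i => ln (INR (2 * i + 2)) - ln (INR (2 * i + 1))) L.

Lemma wallis_log_eq (L : nat) : wallis_log L = ln (PI / 2) - ln (wallis (2 * L)).
Proof.
  unfold wallis_log. induction L as [|L IH].
  - simpl (2 * 0)%nat. rewrite wallis_0. simpl. ring.
  - rewrite rsum_S, IH. assert (H := wallis_rec (2 * L)). assert (P := wallis_pos (2 * L)).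
    replace (S (S (2 * L))) with (2 * S L)%nat in H by lia.
    rewrite !plus_INR. simpl (INR 1). replace (INR 2) with 2 by (simpl; ring).
    assert (Hn := pos_INR (2 * L)).
    replace (wallis (2 * S L)) with ((INR (2 * L) + 1) / (INR (2 * L) + 2) * wallis (2 * L)).
    + rewrite ln_mult, (ln_div (INR (2 * L) + 1)) by (first [lra | apply Rdiv_lt_0_compat; lra]). ring.
    + field_simplify_eq; [|lra]. lra.
Qed.

Lemma ln_1_plus_le (x : R) : -1 < x -> ln (1 + x) <= x.
Proof.
  intros Hx. assert (H := exp_ineq1_le (ln (1 + x))). rewrite exp_ln in H by lra. lra.
Qed.

(** The bounds for the square of [wallis (2 * L)], in logarithmic form. With L about 1 / t the error
    is O(t); the PI in ln (t / (2 PI)) enters here. *)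
Lemma wallis_log_bounds (L : nat) : (0 < L)%nat ->
  ln (PI * INR L) <= 2 * wallis_log L <= ln (PI * INR L) + / (2 * INR L).
Proof.
  intros HL. assert (HL' : 0 < INR L) by now apply lt_0_INR. assert (Hpi := PI_RGT_0).
  rewrite wallis_log_eq. assert (P := wallis_pos (2 * L)).
  assert (U := wallis_sqr_upper (2 * L - 1)). assert (W := wallis_sqr_lower (2 * L)).
  replace (S (2 * L - 1)) with (2 * L)%nat in U by lia.
  rewrite <- S_INR in U. replace (S (2 * L - 1)) with (2 * L)%nat in U by lia.
  rewrite mult_INR in U, W. replace (INR 2) with 2 in U, W by (simpl; ring).
  set (w := wallis (2 * L)) in *. set (l := INR L) in *.
  assert (W2 : 0 < w ^ 2) by (apply pow_lt; easy).
  replace (2 * (ln (PI / 2) - ln w)) with (ln (PI ^ 2 / (4 * w ^ 2))).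
  - split.
    + apply ln_le; [nra|]. apply Rmult_le_reg_r with (4 * w ^ 2); [lra|].
      replace (PI ^ 2 / (4 * w ^ 2) * (4 * w ^ 2)) with (PI ^ 2) by (field; lra). nra.
    + apply Rle_trans with (ln (PI * l * (1 + / (2 * l)))).
      * apply ln_le; [apply Rdiv_lt_0_compat; [apply pow_lt|]; lra|].
        replace (PI * l * (1 + / (2 * l))) with (PI * (2 * l + 1) / 2) by (field; lra).
        apply Rmult_le_reg_r with (4 * w ^ 2); [lra|].
        replace (PI ^ 2 / (4 * w ^ 2) * (4 * w ^ 2)) with (PI ^ 2) by (field; lra). nra.
      * assert (Q : 0 < / (2 * l)) by (apply Rinv_0_lt_compat; lra).
        rewrite ln_mult by nra. apply Rplus_le_compat_l. apply ln_1_plus_le. lra.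
  - replace (PI ^ 2 / (4 * w ^ 2)) with ((PI / 2 / w) * (PI / 2 / w)) by (field; lra).
    assert (0 < PI / 2 / w) by (apply Rdiv_lt_0_compat; lra).
    rewrite ln_mult by easy. rewrite (ln_div (PI / 2)) by lra. ring.
Qed.

(** The even-indexed terms at t are the terms at 2 t, so subtracting them twice leaves odd minus
    even. *)
Lemma logP_doubling (J : nat) (t : R) :
  logP (2 * J) t - 2 * logP J (2 * t) = rsum (fun i => nlog (INR (2 * i + 1) * t) - nlog (INR (2 * i + 2) * t)) J.
Proof.
  rewrite !logP_nlog. induction J as [|J IH]; [simpl; ring|].
  replace (2 * S J)%nat with (S (S (2 * J))) by lia. rewrite !rsum_S, <- IH.
  replace (S (2 * J)) with (2 * J + 1)%nat by lia. replace (S (2 * J + 1)) with (2 * J + 2)%nat by lia.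
  replace (INR (S J) * (2 * t)) with (INR (2 * J + 2) * t); [ring|].
  rewrite !S_INR, plus_INR, mult_INR. simpl. ring.
Qed.

(* For j t <= 2 the logarithmic singularity of [nlog] gives a Wallis product; the rest is an alternating sum of a convex or concave function. *)
Lemma alternating_nlog (t : R) (J : nat) : 0 < t <= 1 -> 2 / t ^ 2 <= INR J ->
  Rabs (2 * (logP (2 * J) t - 2 * logP J (2 * t)) - ln (PI / (2 * t))) <= 4 * t.
Proof.
  intros Ht HJ. rewrite logP_doubling. assert (Hpi := PI_RGT_0).
  assert (Hti : 1 <= 1 / t) by (apply Rmult_le_reg_r with t; [lra|]; field_simplify; lra).
  (* This cut puts X = (2 L + 1) t above 1: the first gap of [slog] is at most t, and that of [nlog]
     from X on is at most t / X <= t. *)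
  destruct (nat_floor (1 / t)) as [L0 [HL1 HL2]]; [lra|]. set (L := S L0).
  assert (HL : INR L = INR L0 + 1) by apply S_INR.
  assert (HLpos : 0 < INR L) by lra.
  assert (HLinv : / INR L <= t).
  { replace t with (/ (1 / t)) by (field; lra). apply Rinv_le_contravar; lra. }
  assert (Hti2 : 2 / t ^ 2 = 2 * (1 / t * (1 / t))) by (field; lra).
  assert (HLJ : (L <= J)%nat) by (apply INR_le; nra).
  assert (HLpos' : (0 < L)%nat) by (unfold L; lia).
  replace J with (L + (J - L))%nat at 1 by lia. rewrite rsum_split.
  set (K := (J - L)%nat).
  set (T := rsum _ K).
  assert (Hhead : rsum (fun i => nlog (INR (2 * i + 1) * t) - nlog (INR (2 * i + 2) * t)) L =
     wallis_log L - rsum (fun i => (fun i => - slog (INR (S i) * t)) (2 * i)%nat - (fun i => - slog (INR (S i) * t)) (2 * i + 1)%nat) L).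
  { unfold wallis_log. transitivity (rsum (fun i => (ln (INR (2 * i + 2)) - ln (INR (2 * i + 1))) + (-1) * ((fun i => - slog (INR (S i) * t)) (2 * i)%nat - (fun i => - slog (INR (S i) * t)) (2 * i + 1)%nat)) L).
    - apply rsum_ext. intros i _. cbv beta. unfold slog.
      replace (S (2 * i)) with (2 * i + 1)%nat by lia. replace (S (2 * i + 1)) with (2 * i + 2)%nat by lia.
      rewrite !ln_mult by (try lra; apply lt_0_INR; lia). ring.
    - rewrite rsum_plus, rsum_scal. ring. }
  rewrite Hhead. set (H := rsum _ L).
  assert (HH : slog (INR (2 * L + 1) * t) - slog t <= 2 * H <= slog (INR (2 * L + 1) * t) - slog t + t).
  { assert (A := alternating_convex (fun i => - slog (INR (S i) * t)) L). cbv beta in A. fold H in A.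
    replace (INR (S (2 * L)) * t) with (INR (2 * L + 1) * t) in A by (f_equal; f_equal; lia).
    replace (INR 1 * t) with t in A by (simpl; ring).
    assert (S1 := slog_increment t t (proj1 Ht) (Rlt_le _ _ (proj1 Ht))).
    replace (INR 2 * t) with (t + t) in A by (simpl; ring).
    enough (- slog t - - slog (INR (2 * L + 1) * t) <= 2 * H <= - slog t - - slog (INR (2 * L + 1) * t) + (- slog t - - slog (t + t))) by lra.
    apply A.
    - intros i. assert (Hi := lt_0_INR (S i) ltac:(lia)).
      assert (S2 := slog_increment (INR (S i) * t) t ltac:(nra) ltac:(lra)).
      replace (INR (S (S i)) * t) with (INR (S i) * t + t) by (rewrite !S_INR; ring). lra.
    - intros i. assert (Hi := lt_0_INR (S i) ltac:(lia)).
      assert (S2 := decr_deriv_increments slog slog' (INR (S i) * t) t ltac:(nra) ltac:(lra) is_derive_slog slog'_decr).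
      replace (INR (S (S i)) * t) with (INR (S i) * t + t) by (rewrite !S_INR; ring).
      replace (INR (S (S (S i))) * t) with (INR (S i) * t + t + t) by (rewrite !S_INR; ring). lra. }
  set (X := INR (2 * L + 1) * t) in *.
  assert (EX : X = (2 * INR L + 1) * t) by (unfold X; rewrite plus_INR, mult_INR; simpl; ring).
  assert (HX : 1 <= X).
  { rewrite EX. assert (1 / t * t = 1) by (field; lra). nra. }
  set (Y := INR (2 * L + 1 + 2 * K) * t).
  (* The size of [J] pushes the last argument beyond 1 / t, where [nlog] is at most t. *)
  assert (HY : / t <= Y).
  { unfold Y. rewrite !plus_INR, !mult_INR. unfold K. rewrite minus_INR by easy. simpl (INR 2). simpl (INR 1).
    apply Rle_trans with (INR J * t); [|nra].
    apply Rle_trans with (2 / t ^ 2 * t); [|apply Rmult_le_compat_r; lra].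
    replace (2 / t ^ 2 * t) with (2 * / t) by (field; lra). assert (0 < / t) by (apply Rinv_0_lt_compat; lra). lra. }
  assert (HnY : 0 <= nlog Y <= t).
  { assert (PY : 0 < Y) by (assert (0 < / t) by (apply Rinv_0_lt_compat; lra); lra).
    split; [apply nlog_bounds, PY|]. eapply Rle_trans; [apply nlog_le_inv, PY|].
    rewrite <- (Rinv_inv t). apply Rinv_le_contravar; [apply Rinv_0_lt_compat; lra|easy]. }
  assert (HT : nlog X - nlog Y <= 2 * T <= nlog X - nlog Y + t).
  { assert (A := alternating_convex (fun i => nlog (INR (2 * L + 1 + i) * t)) K). cbv beta in A.
    rewrite Nat.add_0_r in A. fold X in A. fold Y in A.
    replace (rsum (fun i => nlog (INR (2 * L + 1 + 2 * i) * t) - nlog (INR (2 * L + 1 + (2 * i + 1)) * t)) K) with T in A.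
    2:{ apply rsum_ext. intros i _. replace (2 * (L + i) + 1)%nat with (2 * L + 1 + 2 * i)%nat by lia.
        now replace (2 * (L + i) + 2)%nat with (2 * L + 1 + (2 * i + 1))%nat by lia. }
    assert (S1 := nlog_increment X t ltac:(lra) ltac:(lra)).
    replace (INR (2 * L + 1 + 1) * t) with (X + t) in A by (unfold X; rewrite (plus_INR (2 * L + 1) 1); simpl (INR 1); ring).
    assert (t / X <= t).
    { apply Rmult_le_reg_r with X; [lra|]. replace (t / X * X) with t by (field; lra). nra. }
    enough (nlog X - nlog Y <= 2 * T <= nlog X - nlog Y + (nlog X - nlog (X + t))) by lra.
    apply A.
    - intros i. assert (Hi := lt_0_INR (2 * L + 1 + i) ltac:(lia)).
      assert (S2 := nlog_increment (INR (2 * L + 1 + i) * t) t ltac:(nra) ltac:(lra)).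
      replace (2 * L + 1 + S i)%nat with (S (2 * L + 1 + i)) by lia.
      replace (INR (S (2 * L + 1 + i)) * t) with (INR (2 * L + 1 + i) * t + t) by (rewrite (S_INR (2 * L + 1 + i)); ring). lra.
    - intros i. assert (Hi := lt_0_INR (2 * L + 1 + i) ltac:(lia)).
      assert (S2 := decr_deriv_increments (fun x => - nlog x) (fun x => / (exp x - 1)) (INR (2 * L + 1 + i) * t) t ltac:(nra) ltac:(lra)).
      replace (2 * L + 1 + S i)%nat with (S (2 * L + 1 + i)) by lia.
      replace (INR (S (2 * L + 1 + i)) * t) with (INR (2 * L + 1 + i) * t + t) by (rewrite (S_INR (2 * L + 1 + i)); ring).
      replace (2 * L + 1 + S (S i))%nat with (S (S (2 * L + 1 + i))) by lia.
      replace (INR (S (S (2 * L + 1 + i))) * t) with (INR (2 * L + 1 + i) * t + t + t) by (rewrite (S_INR (S (2 * L + 1 + i))), (S_INR (2 * L + 1 + i)); ring).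
      enough (- nlog (INR (2 * L + 1 + i) * t + t + t) - - nlog (INR (2 * L + 1 + i) * t + t) <= - nlog (INR (2 * L + 1 + i) * t + t) - - nlog (INR (2 * L + 1 + i) * t)) by lra.
      apply S2.
      + intros y Hy. eapply is_derive_eq; [apply (is_derive_opp (K := R_AbsRing) (V := R_NormedModule)); now apply is_derive_nlog|].
        unfold opp; simpl. req. ring.
      + intros y z Hy Hz. apply Rinv_le_contravar; [generalize (exp_minus_1_ge y); lra|].
        generalize (exp_le_mono y z Hz). lra. }
  assert (HW := wallis_log_bounds L HLpos').
  assert (Hs := slog_small t Ht).
  assert (ES : slog X - nlog X = ln X) by (unfold slog; ring).
  assert (EL : ln (PI * INR L) - ln X = ln (PI / (2 * t)) - ln (1 + / (2 * INR L))).
  { rewrite EX. replace ((2 * INR L + 1) * t) with (2 * t * (INR L * (1 + / (2 * INR L)))) by (field; lra).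
    assert (0 < / (2 * INR L)) by (apply Rinv_0_lt_compat; lra).
    rewrite (ln_mult (2 * t)), (ln_mult (INR L)), (ln_mult PI), ln_div by (try lra; nra). ring. }
  assert (HL2' : 0 <= ln (1 + / (2 * INR L)) <= / (2 * INR L)).
  { assert (0 < / (2 * INR L)) by (apply Rinv_0_lt_compat; lra).
    split; [rewrite <- ln_1; apply ln_le; lra|apply ln_1_plus_le; lra]. }
  assert (HLi : / (2 * INR L) <= t) by (rewrite Rinv_mult; assert (0 < / INR L) by (apply Rinv_0_lt_compat; lra); lra).
  apply Rabs_le. lra.
Qed.

Lemma rsum_exchange (f : nat -> nat -> R) (n m : nat) :
  rsum (fun i => rsum (fun j => f i j) m) n = rsum (fun j => rsum (fun i => f i j) n) m.
Proof.
  induction n as [|n IH]; simpl.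
  - rewrite rsum_const. ring.
  - rewrite IH, <- rsum_plus. apply rsum_ext. easy.
Qed.

Lemma logP_increment_upper (J k : nat) (t : R) : 0 < t <= 1 ->
  logP (J + k) t - logP J t <= 2 * exp (- (INR J * t)) / t ^ 2.
Proof.
  intros Ht. rewrite !logP_nlog, rsum_split.
  assert (L := one_minus_exp_lower t Ht).
  apply Rle_trans with (rsum (fun i => exp (- (INR J * t)) / (t / 2) * exp (- (INR (S i) * t))) k).
  - enough (rsum (fun i => nlog (INR (S (J + i)) * t)) k <= rsum (fun i => exp (- (INR J * t)) / (t / 2) * exp (- (INR (S i) * t))) k) by lra.
    apply rsum_le. intros i _. assert (Hi := lt_0_INR (S (J + i)) ltac:(lia)).
    eapply Rle_trans; [apply nlog_bounds; nra|].
    replace (exp (- (INR J * t)) / (t / 2) * exp (- (INR (S i) * t))) with (exp (- (INR (S (J + i)) * t)) / (t / 2)).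
    + apply Rmult_le_compat_l; [left; apply exp_pos|]. apply Rinv_le_contravar; [lra|].
      apply Rle_trans with (1 := L). apply Rplus_le_compat_l, Ropp_le_contravar, exp_le_mono, Ropp_le_contravar.
      rewrite S_INR, plus_INR. generalize (pos_INR J) (pos_INR i). nra.
    + replace (- (INR (S (J + i)) * t)) with (- (INR J * t) + - (INR (S i) * t)) by (rewrite !S_INR, plus_INR; ring).
      rewrite exp_plus. field. lra.
  - rewrite rsum_scal. assert (H := geometric_exp_sum t k (proj1 Ht)).
    replace (2 * exp (- (INR J * t)) / t ^ 2) with (exp (- (INR J * t)) / (t / 2) * (1 / t)) by (field; lra).
    apply Rmult_le_compat_l; [|easy]. apply Rdiv_le_0_compat; [left; apply exp_pos|lra].
Qed.

Lemma logP_mono (J K : nat) (t : R) : 0 < t -> (J <= K)%nat -> logP J t <= logP K t.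
Proof.
  intros Ht H. rewrite !logP_nlog. apply rsum_mono; [|easy].
  intros i. apply nlog_bounds. generalize (lt_0_INR (S i) ltac:(lia)). nra.
Qed.

(** The doubling relation changes the truncation together with t; it is iterated on the limit in
    [J], which is finite for 0 < t <= 1 by [logPinf_lim]. *)
Definition logPinf (t : R) : R := real (Lim_seq (fun J => logP J t)).

Lemma logPinf_lim (t : R) : 0 < t <= 1 -> is_lim_seq (fun J => logP J t) (logPinf t).
Proof.
  intros Ht. destruct (ex_finite_lim_seq_incr (fun J => logP J t) (2 / t ^ 2)) as [l Hl].
  - intros n. apply logP_mono; [lra|lia].
  - intros n. assert (H := logP_increment_upper 0 n t Ht). simpl (0 + n)%nat in H.
    replace (logP 0 t) with 0 in H by reflexivity. simpl (INR 0) in H. rewrite Rmult_0_l, Ropp_0, exp_0 in H. lra.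
  - unfold logPinf. now rewrite (is_lim_seq_unique _ _ Hl).
Qed.

Lemma logP_le_inf (J : nat) (t : R) : 0 < t <= 1 -> logP J t <= logPinf t.
Proof.
  intros Ht. apply (is_lim_seq_incr_compare (fun J => logP J t) (logPinf t)).
  - now apply logPinf_lim.
  - intros n. apply logP_mono; [lra|lia].
Qed.

Lemma logPinf_le (t M : R) : 0 < t <= 1 -> (forall J, logP J t <= M) -> logPinf t <= M.
Proof.
  intros Ht H. apply (is_lim_seq_le (fun J => logP J t) (fun _ => M) (logPinf t) M H).
  - now apply logPinf_lim.
  - apply is_lim_seq_const.
Qed.

(** The neglected terms are at most 2 e^(-1/t) / t^2, and e^(1/t) >= 1 / (6 t^3) turns this into 12
    t. *)
Lemma logP_tail (J : nat) (t : R) : 0 < t <= 1 -> 1 <= INR J * t ^ 2 -> logPinf t <= logP J t + 12 * t.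
Proof.
  intros Ht HJ. apply logPinf_le; [easy|]. intros K.
  assert (E : 2 * exp (- (INR J * t)) / t ^ 2 <= 12 * t).
  { apply Rle_trans with (2 * exp (- (/ t)) / t ^ 2).
    - apply Rmult_le_compat_r; [left; apply Rinv_0_lt_compat, pow_lt; lra|].
      apply Rmult_le_compat_l; [lra|]. apply exp_le_mono, Ropp_le_contravar.
      apply Rmult_le_reg_r with t; [lra|]. rewrite Rinv_l by lra. simpl in HJ. lra.
    - assert (P : 0 < / t) by (apply Rinv_0_lt_compat; lra).
      assert (H : 2 / t ^ 2 * exp (- / t) <= 12 * t); [|unfold Rdiv in *; lra].
      apply exp_neg_le; [lra|]. generalize (exp_ge_cubic (/ t) (Rlt_le _ _ P)). intros H.
      apply Rle_trans with (12 * t * ((/ t) ^ 3 / 6)); [right; field; lra|].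
      apply Rmult_le_compat_l; [lra|]. assert (0 <= (/ t) ^ 2) by (apply pow_le; lra). lra. }
  destruct (Nat.le_ge_cases J K) as [H|H].
  - assert (U := logP_increment_upper J (K - J) t Ht). replace (J + (K - J))%nat with K in U by lia. lra.
  - assert (U := logP_mono K J t (proj1 Ht) H). lra.
Qed.

Lemma neg_ln_taylor (x : R) (K : nat) : 0 <= x < 1 ->
  0 <= - ln (1 - x) - rsum (fun k => x ^ S k / INR (S k)) K <= x ^ S K / (1 - x).
Proof.
  intros Hx.
  destruct (MVT_le (fun y => - ln (1 - y) - rsum (fun k => y ^ S k / INR (S k)) K) (fun y => y ^ K / (1 - y)) 0 x) as [c [Hc E]]; [lra| |].
  - intros y Hy. induction K as [|K IH].
    + simpl. auto_derive; [lra|]. req. field. lra.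
    + apply (is_derive_ext (fun y => (- ln (1 - y) - rsum (fun k => y ^ S k / INR (S k)) K) - y ^ S K / INR (S K))).
      { intros z. rewrite rsum_S. req. ring. }
      eapply is_derive_eq.
      * apply (is_derive_minus (K := R_AbsRing) (V := R_NormedModule)); [exact IH|].
        instantiate (1 := y ^ K). assert (HK : 0 < INR (S K)) by (apply lt_0_INR; lia).
        apply (is_derive_ext (fun y => / INR (S K) * y ^ S K)); [intros z; unfold Rdiv; req; ring|].
        eapply is_derive_eq; [apply is_derive_scal, is_derive_pow, (is_derive_id (K := R_AbsRing))|].
        unfold one; simpl pred. simpl (_ ^ K). simpl. req. field. simpl in HK. lra.
      * unfold minus, plus, opp; simpl. req. field. lra.
  - replace (rsum (fun k => 0 ^ S k / INR (S k)) K) with 0 in E.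
    2:{ rewrite (rsum_ext _ (fun _ => 0)); [rewrite rsum_const; ring|]. intros k _. simpl. unfold Rdiv. ring. }
    rewrite !Rminus_0_r, ln_1, Ropp_0, Rminus_0_r in E. rewrite E.
    assert (0 <= c ^ K) by (apply pow_le; lra). assert (c ^ K <= x ^ K) by (apply pow_incr; lra).
    assert (Q : / (1 - c) <= / (1 - x)) by (apply Rinv_le_contravar; lra).
    assert (0 < / (1 - c)) by (apply Rinv_0_lt_compat; lra).
    unfold Rdiv. simpl. split; [apply Rmult_le_pos; [apply Rmult_le_pos|]; lra|].
    replace (x * x ^ K * / (1 - x)) with (x ^ K * / (1 - x) * x) by ring.
    apply Rmult_le_compat_r; [lra|]. apply Rmult_le_compat; lra.
Qed.

Lemma lim_exp_neg (t : R) : 0 < t -> is_lim_seq (fun n => exp (- (INR n * t))) 0.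
Proof.
  intros Ht. apply (is_lim_seq_ext (fun n => exp (- t) ^ n)).
  - induction n as [|n IH]; [simpl; rewrite Rmult_0_l, Ropp_0, exp_0; easy|].
    rewrite S_INR. simpl. rewrite IH, <- exp_plus. f_equal. ring.
  - apply is_lim_seq_geom. rewrite Rabs_right by (left; apply exp_pos). apply exp_lt_1. lra.
Qed.

Lemma rho_pow (t : R) (j k : nat) : rho t j ^ S k = exp (- (INR (S j) * (INR (S k) * t))).
Proof.
  unfold rho. induction k as [|k IH].
  - simpl (INR 1). rewrite pow_1. f_equal. ring.
  - rewrite <- tech_pow_Rmult, IH, <- exp_plus. f_equal. rewrite (S_INR (S k)). ring.
Qed.

(** When the logarithms are expanded and the sum over parts is done first, the k-th powers
    contribute at most 1 / (k^2 t): a Basel sum. The number [K] of Taylor terms is free, and its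
    error tends to 0. *)
Lemma logP_crude_upper (J : nat) (t : R) : 0 < t <= 1 -> logP J t <= PI ^ 2 / (6 * t).
Proof.
  intros Ht.
  assert (H : forall K, logP J t <= PI ^ 2 / (6 * t) + INR J * (2 / t) * exp (- (INR K * t))).
  { intros K. unfold logP.
    apply Rle_trans with (rsum (fun j => rsum (fun k => rho t j ^ S k / INR (S k)) K + 2 / t * exp (- (INR K * t))) J).
    - apply rsum_le. intros j _. assert (Hr := rho_bounds t j (proj1 Ht)).
      assert (N := neg_ln_taylor (rho t j) K ltac:(lra)).
      assert (Hj : 1 <= INR (S j)) by (apply (le_INR 1); lia).
      assert (rho t j ^ S K / (1 - rho t j) <= exp (- (INR K * t)) * / (t / 2)).
      { apply Rmult_le_compat; [apply pow_le; lra|left; apply Rinv_0_lt_compat; lra| |].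
        - rewrite rho_pow. apply exp_le_mono, Ropp_le_contravar.
          assert (HK := pos_INR K). apply Rle_trans with (1 * (INR (S K) * t)); [rewrite S_INR; nra|].
          apply Rmult_le_compat_r; [rewrite S_INR; nra|easy].
        - apply Rinv_le_contravar; [lra|]. eapply Rle_trans; [now apply one_minus_exp_lower|].
          apply Rplus_le_compat_l, Ropp_le_contravar, exp_le_mono. nra. }
      replace (2 / t * exp (- (INR K * t))) with (exp (- (INR K * t)) * / (t / 2)) by (field; lra). lra.
    - rewrite rsum_plus, rsum_const, rsum_exchange. rewrite <- Rmult_assoc. apply Rplus_le_compat_r.
      apply Rle_trans with (rsum (fun k => / t * / INR (S k) ^ 2) K).
      + apply rsum_le. intros k _. assert (Hk := lt_0_INR (S k) ltac:(lia)).
        rewrite (rsum_ext _ (fun j => / INR (S k) * exp (- (INR (S j) * (INR (S k) * t))))) by (intros j _; rewrite rho_pow; unfold Rdiv; ring).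
        rewrite rsum_scal. assert (G := geometric_exp_sum (INR (S k) * t) J ltac:(nra)).
        replace (/ t * / INR (S k) ^ 2) with (/ INR (S k) * (1 / (INR (S k) * t))) by (field; lra).
        apply Rmult_le_compat_l; [left; apply Rinv_0_lt_compat; lra|easy].
      + rewrite rsum_scal. replace (PI ^ 2 / (6 * t)) with (/ t * (PI ^ 2 / 6)) by (field; lra).
        apply Rmult_le_compat_l; [left; apply Rinv_0_lt_compat; lra|apply basel_upper]. }
  apply (is_lim_seq_le (fun _ => logP J t) (fun K => PI ^ 2 / (6 * t) + INR J * (2 / t) * exp (- (INR K * t))) (logP J t) (PI ^ 2 / (6 * t)) H).
  - apply is_lim_seq_const.
  - replace (Finite (PI ^ 2 / (6 * t))) with (Rbar_plus (PI ^ 2 / (6 * t)) (Rbar_mult (INR J * (2 / t)) 0)) by (simpl; f_equal; ring).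
    apply is_lim_seq_plus'; [apply is_lim_seq_const|]. apply (is_lim_seq_scal_l _ (INR J * (2 / t)) 0), lim_exp_neg. lra.
Qed.

(** The same exchange of sums from below: 1 / (e^y - 1) >= 1 / y - 1 loses at most 1 for each of the
    [K] powers kept. *)
Lemma logPinf_crude_lower (t : R) (K : nat) : 0 < t <= 1 ->
  / t * rsum (fun k => / INR (S k) ^ 2) K - INR K <= logPinf t.
Proof.
  intros Ht. set (V := / t * rsum (fun k => / INR (S k) ^ 2) K - INR K).
  assert (H : forall J, V * (1 - exp (- (INR J * t))) <= logPinf t).
  { intros J. eapply Rle_trans; [|apply (logP_le_inf J t Ht)]. unfold logP.
    apply Rle_trans with (rsum (fun j => rsum (fun k => rho t j ^ S k / INR (S k)) K) J).
    2:{ apply rsum_le. intros j _. assert (Hr := rho_bounds t j (proj1 Ht)).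
        generalize (neg_ln_taylor (rho t j) K ltac:(lra)). lra. }
    rewrite rsum_exchange. set (e := 1 - exp (- (INR J * t))).
    assert (He : 0 <= e <= 1).
    { unfold e. assert (exp (- (INR J * t)) <= 1) by (apply exp_le_1; generalize (pos_INR J); nra).
      generalize (exp_pos (- (INR J * t))). lra. }
    apply Rle_trans with (rsum (fun k => e * (/ t * / INR (S k) ^ 2 + -1 * 1)) K).
    - rewrite rsum_scal, rsum_plus, !rsum_scal, rsum_const. unfold V. right. ring.
    - apply rsum_le. intros k _. assert (Hk : 1 <= INR (S k)) by (apply (le_INR 1); lia).
      rewrite (rsum_ext _ (fun j => / INR (S k) * exp (- (INR (S j) * (INR (S k) * t))))) by (intros j _; rewrite rho_pow; unfold Rdiv; ring).
      rewrite rsum_scal. set (y := INR (S k) * t). assert (Hy : 0 < y) by (unfold y; nra).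
      assert (Hsl := slog'_bounds y Hy). unfold slog' in Hsl.
      assert (M := exp_minus_1_ge y).
      assert (E : rsum (fun j => exp (- (INR (S j) * y))) J = (1 - exp (- (INR J * y))) * / (exp y - 1)).
      { assert (EE : forall n, rsum (fun j => exp (- (INR (S j) * y))) n * (exp y - 1) = 1 - exp (- (INR n * y))).
        { induction n as [|n IH]; [simpl; replace (- (0 * y)) with 0 by ring; rewrite exp_0; ring|].
          rewrite rsum_S, Rmult_plus_distr_r, IH.
          replace (exp (- (INR n * y))) with (exp (- (INR (S n) * y)) * exp y) by (rewrite <- exp_plus; f_equal; rewrite S_INR; ring). ring. }
        rewrite <- EE. field. lra. }
      rewrite E.
      assert (e <= 1 - exp (- (INR J * y))).
      { unfold e. apply Rplus_le_compat_l, Ropp_le_contravar, exp_le_mono, Ropp_le_contravar. unfold y. 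
        assert (HJ := pos_INR J). apply Rmult_le_compat_l; nra. }
      assert (P : 0 < / (exp y - 1)) by (apply Rinv_0_lt_compat; lra).
      assert (Pk : 0 < / INR (S k) <= 1) by (split; [apply Rinv_0_lt_compat; lra|rewrite <- Rinv_1; apply Rinv_le_contravar; lra]).
      apply Rle_trans with (/ INR (S k) * (e * / (exp y - 1))).
      2:{ apply Rmult_le_compat_l; [lra|]. apply Rmult_le_compat_r; lra. }
      replace (/ t * / INR (S k) ^ 2) with (/ INR (S k) * / y) by (unfold y; field; lra).
      apply Rle_trans with (/ INR (S k) * (e * (/ y - 1))).
      2:{ apply Rmult_le_compat_l; [lra|]. apply Rmult_le_compat_l; lra. }
      nra. }
  apply (is_lim_seq_le (fun J => V * (1 - exp (- (INR J * t)))) (fun _ => logPinf t) V (logPinf t) H).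
  - replace (Finite V) with (Rbar_mult V (1 - 0)) by (simpl; f_equal; ring).
    apply (is_lim_seq_scal_l _ V (1 - 0)). apply is_lim_seq_minus'; [apply is_lim_seq_const|]. apply lim_exp_neg. lra.
  - apply is_lim_seq_const.
Qed.

(** The beginning of the expansion given by the transformation of the Dedekind eta function, whose
    next term is -t / 24. *)
Definition logP_main (t : R) : R := PI ^ 2 / (6 * t) + ln (t / (2 * PI)) / 2.

(** Keeping about 1 / sqrt t powers balances the two losses 2 / (K t) and K of the lower bound. The
    result is small against 1 / t, as the doubling argument requires. *)
Lemma logPinf_crude (t : R) : 0 < t <= 1 -> Rabs (logPinf t - logP_main t) <= 9 / sqrt t.
Proof.
  intros Ht. set (s := sqrt t). assert (Hs : 0 < s) by (apply sqrt_lt_R0; lra).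
  assert (Es : s * s = t) by (apply sqrt_sqrt; lra). assert (Hs1 : s <= 1) by nra.
  assert (Hsi : 1 <= / s) by (rewrite <- Rinv_1 at 1; apply Rinv_le_contravar; lra).
  assert (Hpi := PI_RGT_0). assert (Hpi4 := PI_4).
  assert (U : logPinf t <= PI ^ 2 / (6 * t)) by (apply logPinf_le; [easy|intros J; now apply logP_crude_upper]).
  assert (L : PI ^ 2 / (6 * t) - 4 * / s <= logPinf t).
  { destruct (nat_floor (/ s)) as [n [Hn1 Hn2]]; [lra|].
    eapply Rle_trans; [|apply (logPinf_crude_lower t (S n) Ht)]. rewrite S_INR.
    assert (B := basel_lower n).
    assert (/ t * (PI ^ 2 / 6 - 2 / INR (S n)) <= / t * rsum (fun k => / INR (S k) ^ 2) (S n)).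
    { apply Rmult_le_compat_l; [left; apply Rinv_0_lt_compat; lra|easy]. }
    assert (/ INR (S n) <= s).
    { rewrite <- (Rinv_inv s). apply Rinv_le_contravar; [lra|]. rewrite S_INR. lra. }
    assert (Q : / t * (2 / INR (S n)) <= 2 * / s).
    { replace (2 * / s) with (/ t * (2 * s)) by (rewrite <- Es; field; lra).
      apply Rmult_le_compat_l; [left; apply Rinv_0_lt_compat; lra|]. unfold Rdiv. lra. }
    replace (PI ^ 2 / (6 * t)) with (/ t * (PI ^ 2 / 6)) by (field; lra). lra. }
  assert (N1 : - (2 * / s) <= ln t <= 0).
  { split; [|rewrite <- ln_1; apply ln_le; lra].
    rewrite <- Es, ln_mult by lra.
    assert (H := ln_1_plus_le (/ s - 1)). replace (1 + (/ s - 1)) with (/ s) in H by ring.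
    rewrite ln_Rinv in H by lra. lra. }
  assert (N2 : 0 <= ln (2 * PI) <= 7).
  { split; [rewrite <- ln_1; apply ln_le; generalize PI2_3_2; lra|].
    assert (H := ln_1_plus_le (2 * PI - 1)). replace (1 + (2 * PI - 1)) with (2 * PI) in H by ring. lra. }
  unfold logP_main. rewrite ln_div by lra. replace (9 / s) with (9 * / s) by reflexivity. apply Rabs_le. lra.
Qed.

(* The error E = logPinf - logP_main satisfies E(s/2) = 2 E(s) + O(s), so that any bound o(1/s) improves to O(s). *)
Lemma logPinf_doubling (s : R) : 0 < s <= 1 ->
  Rabs (logPinf s - logP_main s) <= Rabs (logPinf (s / 2) - logP_main (s / 2)) / 2 + 16 * s.
Proof.
  intros Hs. set (t := s / 2). assert (Ht : 0 < t <= 1) by (unfold t; lra). assert (Hpi := PI_RGT_0).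
  destruct (INR_unbounded (2 / t ^ 2)) as [J HJ].
  assert (A := alternating_nlog t J Ht ltac:(lra)). replace (2 * t) with s in A by (unfold t; field).
  assert (HJ2 : 2 <= INR J * t ^ 2).
  { assert (P : 0 < t ^ 2) by (apply pow_lt; lra). apply Rmult_le_reg_r with (/ t ^ 2); [now apply Rinv_0_lt_compat|].
    replace (INR J * t ^ 2 * / t ^ 2) with (INR J) by (field; lra). unfold Rdiv in HJ. lra. }
  assert (U1 := logP_le_inf (2 * J) t Ht). assert (U2 := logP_le_inf J s Hs).
  assert (T1 := logP_tail (2 * J) t Ht). rewrite mult_INR in T1. simpl (INR 2) in T1.
  assert (T1' := T1 ltac:(nra)).
  assert (T2 := logP_tail J s Hs). replace (s ^ 2) with (4 * t ^ 2) in T2 by (unfold t; field).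
  assert (T2' := T2 ltac:(nra)).
  assert (M : logP_main t - 2 * logP_main s = ln (PI / s) / 2).
  { unfold logP_main. replace s with (2 * t) by (unfold t; field).
    rewrite !ln_div, !ln_mult by lra. field. lra. }
  apply Rabs_le_between in A.
  assert (Q := Rabs_le_between (logPinf t - logP_main t) (Rabs (logPinf t - logP_main t))).
  destruct Q as [Q _]. specialize (Q (Rle_refl _)).
  apply Rabs_le. unfold t in *. lra.
Qed.

(** Each doubling halves the error but evaluates it at s / 2, where the crude bound grows only by
    sqrt 2; after n of them 9 / sqrt s (sqrt 2 / 2)^n is left. The increments 16 s, 16 (s / 2) / 2,
    ... sum to less than 32 s. *)
Lemma logPinf_asymptotic (s : R) : 0 < s <= 1 -> Rabs (logPinf s - logP_main s) <= 32 * s.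
Proof.
  intros Hs. set (q := sqrt 2 / 2).
  assert (S2 : sqrt 2 * sqrt 2 = 2) by (apply sqrt_sqrt; lra). assert (P2 : 0 < sqrt 2) by (apply sqrt_lt_R0; lra).
  assert (Hq : 0 < q < 1) by (unfold q; nra).
  assert (H : forall n s, 0 < s <= 1 -> Rabs (logPinf s - logP_main s) <= 9 / sqrt s * q ^ n + 32 * s).
  { clear s Hs. induction n as [|n IH]; intros s Hs.
    - generalize (logPinf_crude s Hs). simpl. lra.
    - eapply Rle_trans; [now apply logPinf_doubling|].
      assert (I := IH (s / 2) ltac:(lra)).
      rewrite sqrt_div in I by lra.
      assert (Ps : 0 < sqrt s) by (apply sqrt_lt_R0; lra).
      replace (9 / (sqrt s / sqrt 2) * q ^ n) with (2 * (9 / sqrt s * q ^ S n)) in I by (unfold q at 1; simpl; unfold q; field; lra).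
      lra. }
  apply (is_lim_seq_le (fun _ => Rabs (logPinf s - logP_main s)) (fun n => 9 / sqrt s * q ^ n + 32 * s) (Rabs (logPinf s - logP_main s)) (32 * s)).
  - intros n. now apply H.
  - apply is_lim_seq_const.
  - replace (Finite (32 * s)) with (Rbar_plus (Rbar_mult (9 / sqrt s) 0) (32 * s)) by (simpl; f_equal; ring).
    apply is_lim_seq_plus'; [|apply is_lim_seq_const].
    apply (is_lim_seq_scal_l _ (9 / sqrt s) 0), is_lim_seq_geom. rewrite Rabs_right; lra.
Qed.

Lemma logP_asymptotic (J : nat) (t : R) : 0 < t <= 1 -> 1 <= INR J * t ^ 2 -> Rabs (logP J t - logP_main t) <= 44 * t.
Proof.
  intros Ht HJ. assert (H := logPinf_asymptotic t Ht). apply Rabs_le_between in H.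
  assert (H1 := logP_tail J t Ht HJ). assert (H2 := logP_le_inf J t Ht). apply Rabs_le. lra.
Qed.

(** * Mean and variance from log P by convexity *)

Lemma is_derive_rsum (f : nat -> R -> R) (f' : nat -> R) (x : R) (n : nat) :
  (forall k, is_derive (f k) x (f' k)) -> is_derive (fun y => rsum (fun k => f k y) n) x (rsum f' n).
Proof.
  intros H. induction n as [|n IH]; simpl.
  - apply (is_derive_const (K := R_AbsRing) (V := R_NormedModule)).
  - apply (is_derive_plus (K := R_AbsRing) (V := R_NormedModule)); auto.
Qed.

Lemma is_derive_rho (j : nat) (t : R) : is_derive (fun t => rho t j) t (- INR (S j) * rho t j).
Proof.
  unfold rho. set (n := INR (S j)). auto_derive; auto. req. ring.
Qed.

Lemma is_derive_logP (J : nat) (t : R) : 0 < t -> is_derive (logP J) t (- meanP J t).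
Proof.
  intros Ht. unfold meanP. replace (- rsum _ J) with (rsum (fun j => -1 * (INR (S j) * (rho t j / (1 - rho t j)))) J) by (rewrite rsum_scal; ring).
  apply (is_derive_rsum (fun j t => - ln (1 - rho t j))). intros j. assert (Hr := rho_bounds t j Ht).
  assert (H := is_derive_rho j t).
  eapply is_derive_eq.
  - apply (is_derive_opp (K := R_AbsRing) (V := R_NormedModule)).
    apply (is_derive_comp ln (fun t => 1 - rho t j)); [apply is_derive_ln; lra|].
    apply (is_derive_minus (K := R_AbsRing) (V := R_NormedModule)); [apply (is_derive_const (K := R_AbsRing) (V := R_NormedModule))|exact H].
  - unfold opp, minus, plus, scal, zero; simpl. unfold mult, opp; simpl. req. field. lra.
Qed.

Lemma is_derive_meanP (J : nat) (t : R) : 0 < t -> is_derive (meanP J) t (- varP J t).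
Proof.
  intros Ht. unfold varP. replace (- rsum _ J) with (rsum (fun j => -1 * (INR (S j) ^ 2 * (rho t j / (1 - rho t j) ^ 2))) J) by (rewrite rsum_scal; ring).
  apply (is_derive_rsum (fun j t => INR (S j) * (rho t j / (1 - rho t j)))). intros j. assert (Hr := rho_bounds t j Ht).
  assert (H := is_derive_rho j t).
  eapply is_derive_eq.
  - apply (is_derive_scal (fun t => rho t j / (1 - rho t j))).
    apply (is_derive_div (fun t => rho t j) (fun t => 1 - rho t j)); [exact H| |lra].
    apply (is_derive_minus (K := R_AbsRing) (V := R_NormedModule)); [apply (is_derive_const (K := R_AbsRing) (V := R_NormedModule))|exact H].
  - unfold minus, plus, zero, opp; simpl pow. simpl (INR (S j)). fold (INR (S j)).
    set (n := INR (S j)). change (match j with O => 1 | S _ => INR j + 1 end) with n.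
    unfold opp, plus; simpl. req. field. lra.
Qed.

Lemma rho_decr (j : nat) (t u : R) : t <= u -> rho u j <= rho t j.
Proof. intros H. apply exp_le_mono. assert (Hj := pos_INR (S j)). nra. Qed.

Lemma meanP_decr (J : nat) (t u : R) : 0 < t -> t <= u -> meanP J u <= meanP J t.
Proof.
  intros Ht H. apply rsum_le. intros j _. assert (H1 := rho_bounds t j Ht). assert (H2 := rho_bounds u j ltac:(lra)).
  assert (H3 := rho_decr j t u H). apply Rmult_le_compat_l; [apply pos_INR|].
  apply Rmult_le_compat; try lra; [left; apply Rinv_0_lt_compat; lra|apply Rinv_le_contravar; lra].
Qed.

Lemma varP_decr (J : nat) (t u : R) : 0 < t -> t <= u -> varP J u <= varP J t.
Proof.
  intros Ht H. apply rsum_le. intros j _. assert (H1 := rho_bounds t j Ht). assert (H2 := rho_bounds u j ltac:(lra)).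
  assert (H3 := rho_decr j t u H). apply Rmult_le_compat_l; [apply pow2_ge_0|].
  apply Rmult_le_compat; try lra; [left; apply Rinv_0_lt_compat, pow_lt; lra|].
  apply Rinv_le_contravar; [apply pow_lt; lra|]. apply pow_incr. lra.
Qed.

(* Monotonicity of the derivative transfers asymptotics from [F] to [D]; it is applied with step of order t^2 to [logP], and t^(3/2) to [meanP]. *)
Lemma convex_secant (F D : R -> R) (t h : R) : 0 < t -> 0 < h ->
  (forall u, 0 < u -> is_derive F u (- D u)) -> (forall u v, 0 < u -> u <= v -> D v <= D u) ->
  D (t + h) * h <= F t - F (t + h) <= D t * h.
Proof.
  intros Ht Hh HF HD. destruct (MVT_le F (fun u => - D u) t (t + h)) as [c [Hc E]]; [lra|intros; apply HF; lra|].
  replace (F t - F (t + h)) with (- (F (t + h) - F t)) by ring. rewrite E.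
  assert (D (t + h) <= D c) by (apply HD; lra). assert (D c <= D t) by (apply HD; lra).
  replace (t + h - t) with h by ring. split; nra.
Qed.

Lemma logP_main_secant (t h : R) : 0 < t -> 0 < h ->
  PI ^ 2 / 6 * (h / (t * (t + h))) - h / (2 * t) <= logP_main t - logP_main (t + h) <= PI ^ 2 / 6 * (h / (t * (t + h))).
Proof.
  intros Ht Hh. assert (Hpi := PI_RGT_0). unfold logP_main.
  rewrite !ln_div by lra.
  assert (L : 0 <= ln (t + h) - ln t <= h / t).
  { split; [generalize (ln_le t (t + h) Ht ltac:(lra)); lra|]. rewrite <- ln_div by lra.
    replace ((t + h) / t) with (1 + h / t) by (field; lra). apply ln_1_plus_le.
    assert (0 < h / t) by (apply Rdiv_lt_0_compat; lra). lra. }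
  replace (PI ^ 2 / 6 * (h / (t * (t + h)))) with (PI ^ 2 / (6 * t) - PI ^ 2 / (6 * (t + h))) by (field; lra).
  replace (h / (2 * t)) with (h / t / 2) by (field; lra). lra.
Qed.

Lemma PI_sqr_le : PI ^ 2 / 6 <= 3.
Proof. generalize PI_4 PI_RGT_0. intros. nra. Qed.

Lemma meanP_asymptotic (J : nat) (t : R) : 0 < t <= 1 / 2 -> 4 <= INR J * t ^ 2 ->
  Rabs (meanP J t - PI ^ 2 / (6 * t ^ 2)) <= 300 / t.
Proof.
  (* The error O(t) of log P divided by h, and the bias h / t^3 of the secant, are then both O(1 /
     t). *)
  intros Ht HJ. set (h := t ^ 2 / 2).
  assert (Hh : 0 < h <= t / 4) by (unfold h; simpl; nra).
  assert (HJpos := pos_INR J).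
  assert (G0 := logP_asymptotic J t ltac:(lra) ltac:(lra)).
  assert (G1 := logP_asymptotic J (t + h) ltac:(lra)).
  assert (G2 := logP_asymptotic J (t - h) ltac:(lra)).
  assert (Q1 : t ^ 2 <= (t + h) ^ 2) by (apply pow_incr; lra).
  assert (Q2 : (t / 2) ^ 2 <= (t - h) ^ 2) by (apply pow_incr; lra).
  specialize (G1 ltac:(nra)). specialize (G2 ltac:(nra)).
  apply Rabs_le_between in G0. apply Rabs_le_between in G1. apply Rabs_le_between in G2.
  assert (D1 := convex_secant (logP J) (meanP J) t h ltac:(lra) ltac:(lra) (is_derive_logP J) (meanP_decr J)).
  assert (D2 := convex_secant (logP J) (meanP J) (t - h) h ltac:(lra) ltac:(lra) (is_derive_logP J) (meanP_decr J)).
  assert (M1 := logP_main_secant t h ltac:(lra) ltac:(lra)).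
  assert (M2 := logP_main_secant (t - h) h ltac:(lra) ltac:(lra)).
  replace (t - h + h) with t in * by ring.
  assert (P6 := PI_sqr_le). assert (P0 : 0 < PI ^ 2 / 6) by (generalize PI_RGT_0; intros; nra).
  set (c := PI ^ 2 / 6) in *.
  replace (PI ^ 2 / (6 * t ^ 2)) with (c / t ^ 2) by (unfold c; field; lra).
  assert (E1 : h * (c / t ^ 2 - 2 * / t) <= c * (h / (t * (t + h)))).
  { replace (c * (h / (t * (t + h)))) with (h * (c / t ^ 2 - c * h / (t ^ 2 * (t + h)))) by (field; lra).
    apply Rmult_le_compat_l; [lra|]. apply Rplus_le_compat_l, Ropp_le_contravar.
    replace (c * h / (t ^ 2 * (t + h))) with (c / 2 * / (t + h)) by (unfold h; field; split; [unfold h in *; lra|lra]).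
    apply Rmult_le_compat; [lra|left; apply Rinv_0_lt_compat; lra|lra|apply Rinv_le_contravar; lra]. }
  assert (E2 : c * (h / ((t - h) * t)) <= h * (c / t ^ 2 + 3 * / t)).
  { replace (c * (h / ((t - h) * t))) with (h * (c / t ^ 2 + c * h / (t ^ 2 * (t - h)))) by (field; lra).
    apply Rmult_le_compat_l; [lra|]. apply Rplus_le_compat_l.
    replace (c * h / (t ^ 2 * (t - h))) with (c / 2 * / (t - h)) by (unfold h; field; split; [unfold h in *; lra|lra]).
    apply Rle_trans with (3 / 2 * / (t / 2)); [|right; field; lra].
    apply Rmult_le_compat; [lra|left; apply Rinv_0_lt_compat; lra|lra|apply Rinv_le_contravar; lra]. }
  assert (E3 : h / (2 * t) = h * (/ t / 2)) by (field; lra).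
  assert (E4 : t = h * (2 * / t)) by (unfold h; field; lra).
  assert (Pt : 0 < / t) by (apply Rinv_0_lt_compat; lra).
  assert (L : h * (c / t ^ 2 - 300 / t) <= h * meanP J t).
  { replace (300 / t) with (300 * / t) by reflexivity.
    assert (44 * t + 44 * (t + h) <= h * (200 * / t)) by lra. lra. }
  assert (U : h * meanP J t <= h * (c / t ^ 2 + 300 / t)).
  { replace (300 / t) with (300 * / t) by reflexivity.
    assert (44 * t + 44 * (t - h) <= h * (200 * / t)) by lra. lra. }
  apply Rmult_le_reg_l in L; [|lra]. apply Rmult_le_reg_l in U; [|lra].
  apply Rabs_le. lra.
Qed.

Lemma varP_asymptotic (J : nat) (s : R) : 0 < s <= 1 / 2 -> 16 <= INR J * (s ^ 2) ^ 2 ->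
  Rabs (varP J (s ^ 2) - PI ^ 2 / (3 * (s ^ 2) ^ 3)) <= 8000 / s ^ 5.
Proof.
  (* Now the error O(1 / t) of the mean divided by h, and the bias h / t^4, are both O(s^(-5)). *)
  intros Hs HJ. set (t := s ^ 2) in *. set (h := s ^ 3 / 2).
  assert (Ht : 0 < t <= 1 / 4) by (unfold t; simpl; split; nra).
  assert (Hh : 0 < h <= t / 4) by (unfold h, t; simpl; split; [assert (0 < s * s) by nra; nra|nra]).
  assert (HJpos := pos_INR J).
  assert (G0 := meanP_asymptotic J t ltac:(lra) ltac:(lra)).
  assert (G1 := meanP_asymptotic J (t + h) ltac:(lra)).
  assert (G2 := meanP_asymptotic J (t - h) ltac:(lra)).
  assert (Q1 : t ^ 2 <= (t + h) ^ 2) by (apply pow_incr; lra).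
  (* Passing to t - h >= t / 2 costs a factor 4 in the lower bound for [J], hence 16 here against 4
     in [meanP_asymptotic]. *)
  assert (Q2 : (t / 2) ^ 2 <= (t - h) ^ 2) by (apply pow_incr; lra).
  specialize (G1 ltac:(nra)). specialize (G2 ltac:(nra)).
  apply Rabs_le_between in G0. apply Rabs_le_between in G1. apply Rabs_le_between in G2.
  assert (D1 := convex_secant (meanP J) (varP J) t h ltac:(lra) ltac:(lra) (is_derive_meanP J) (varP_decr J)).
  assert (D2 := convex_secant (meanP J) (varP J) (t - h) h ltac:(lra) ltac:(lra) (is_derive_meanP J) (varP_decr J)).
  replace (t - h + h) with t in * by ring.
  assert (P6 := PI_sqr_le). assert (P0 : 0 < PI ^ 2 / 6) by (generalize PI_RGT_0; intros; nra).
  set (c := PI ^ 2 / 6) in *.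
  replace (PI ^ 2 / (6 * t ^ 2)) with (c / t ^ 2) in * by (unfold c; field; lra).
  replace (PI ^ 2 / (6 * (t + h) ^ 2)) with (c / (t + h) ^ 2) in * by (unfold c; field; lra).
  replace (PI ^ 2 / (6 * (t - h) ^ 2)) with (c / (t - h) ^ 2) in * by (unfold c; field; lra).
  replace (PI ^ 2 / (3 * t ^ 3)) with (2 * c / t ^ 3) by (unfold c; field; lra).
  set (x := h / t). assert (Hx : 0 < x <= 1 / 4).
  { unfold x. split; [apply Rdiv_lt_0_compat; lra|]. apply Rmult_le_reg_r with t; [lra|]. replace (h / t * t) with h by (field; lra). lra. }
  assert (Eh : h = x * t) by (unfold x; field; lra).
  assert (F1 : 2 - 3 * x <= (2 + x) / (1 + x) ^ 2).
  { apply Rmult_le_reg_r with ((1 + x) ^ 2); [apply pow_lt; lra|]. 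
    replace ((2 + x) / (1 + x) ^ 2 * (1 + x) ^ 2) with (2 + x) by (field; lra). nra. }
  assert (F2 : (2 - x) / (1 - x) ^ 2 <= 2 + 8 * x).
  { apply Rmult_le_reg_r with ((1 - x) ^ 2); [apply pow_lt; lra|]. 
    replace ((2 - x) / (1 - x) ^ 2 * (1 - x) ^ 2) with (2 - x) by (field; lra). nra. }
  assert (Pt3 : 0 < / t ^ 3) by (apply Rinv_0_lt_compat, pow_lt; lra).
  assert (E1 : h * (2 * c / t ^ 3 - 9 * x * / t ^ 3) <= c / t ^ 2 - c / (t + h) ^ 2).
  { replace (c / t ^ 2 - c / (t + h) ^ 2) with (h * / t ^ 3 * c * ((2 + x) / (1 + x) ^ 2)) by (rewrite Eh; field; repeat split; nra).
    replace (h * (2 * c / t ^ 3 - 9 * x * / t ^ 3)) with (h * / t ^ 3 * (2 * c - 9 * x)) by (field; lra).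
    rewrite (Rmult_assoc _ c). apply Rmult_le_compat_l; [apply Rmult_le_pos; lra|]. nra. }
  assert (E2 : c / (t - h) ^ 2 - c / t ^ 2 <= h * (2 * c / t ^ 3 + 24 * x * / t ^ 3)).
  { replace (c / (t - h) ^ 2 - c / t ^ 2) with (h * / t ^ 3 * c * ((2 - x) / (1 - x) ^ 2)) by (rewrite Eh; field; repeat split; nra).
    replace (h * (2 * c / t ^ 3 + 24 * x * / t ^ 3)) with (h * / t ^ 3 * (2 * c + 24 * x)) by (field; lra).
    rewrite (Rmult_assoc _ c). apply Rmult_le_compat_l; [apply Rmult_le_pos; lra|]. nra. }
  assert (E3 : x * / t ^ 3 = / s ^ 5 / 2) by (unfold x, h, t; field; lra).
  assert (E4 : / t = h * (2 * / s ^ 5)) by (unfold h, t; field; lra).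
  assert (Ps : 0 < / s ^ 5) by (apply Rinv_0_lt_compat, pow_lt; lra).
  assert (I1 : 300 / (t + h) <= 300 * / t) by (apply Rmult_le_compat_l; [lra|]; apply Rinv_le_contravar; lra).
  assert (I2 : 300 / (t - h) <= 600 * / t).
  { apply Rle_trans with (300 * / (t / 2)); [|right; field; lra]. apply Rmult_le_compat_l; [lra|]; apply Rinv_le_contravar; lra. }
  replace (300 / t) with (300 * / t) in * by reflexivity.
  assert (L : h * (2 * c / t ^ 3 - 8000 / s ^ 5) <= h * varP J t).
  { replace (8000 / s ^ 5) with (8000 * / s ^ 5) by reflexivity. 
    replace (9 * x * / t ^ 3) with (9 * (/ s ^ 5 / 2)) in E1 by (rewrite <- E3; ring). nra. }
  assert (U : h * varP J t <= h * (2 * c / t ^ 3 + 8000 / s ^ 5)).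
  { replace (8000 / s ^ 5) with (8000 * / s ^ 5) by reflexivity. 
    replace (24 * x * / t ^ 3) with (24 * (/ s ^ 5 / 2)) in E2 by (rewrite <- E3; ring). nra. }
  apply Rmult_le_reg_l in L; [|lra]. apply Rmult_le_reg_l in U; [|lra].
  apply Rabs_le. lra.
Qed.

(** * The Gaussian integral and the Bessel function *)

Definition gauss_int (x : R) : R := RInt (fun y => exp (- y ^ 2)) 0 x.
(** Its derivative is opposite to that of the square of [gauss_int]. It equals atan 1 = PI / 4 at 0
    and tends to 0 at infinity, which replaces polar coordinates. *)
Definition gauss_aux (x : R) : R := RInt (fun s => exp (- x ^ 2 * (1 + s ^ 2)) / (1 + s ^ 2)) 0 1.

Lemma RInt_mult_const (c : R) (f : R -> R) (a b : R) : (forall y, continuous f y) ->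
  RInt (fun y => c * f y) a b = c * RInt f a b.
Proof. intros H. apply (RInt_scal (V := R_CompleteNormedModule) f). now apply ex_RInt_cont. Qed.

Lemma RInt_dilate (f : R -> R) (u a b : R) : (forall y, continuous f y) ->
  RInt (fun y => u * f (u * y)) a b = RInt f (u * a) (u * b).
Proof.
  intros H. assert (E := RInt_comp_lin (V := R_CompleteNormedModule) f u 0 a b).
  rewrite !Rplus_0_r in E. rewrite <- E by (now apply ex_RInt_cont).
  apply RInt_ext. intros y _. now rewrite Rplus_0_r.
Qed.

Lemma one_plus_sqr_pos (s : R) : 0 < 1 + s ^ 2.
Proof. generalize (pow2_ge_0 s). lra. Qed.

Lemma continuous_gauss (x : R) : continuous (fun y => exp (- y ^ 2)) x.
Proof. apply (cont_derive (fun y => exp (- y ^ 2))). auto_derive. auto. Qed.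

Lemma continuous_gauss_aux (x s : R) : continuous (fun s => exp (- x ^ 2 * (1 + s ^ 2)) / (1 + s ^ 2)) s.
Proof.
  apply (cont_derive (fun s => exp (- x ^ 2 * (1 + s ^ 2)) / (1 + s ^ 2))). auto_derive.
  generalize (one_plus_sqr_pos s). simpl. lra.
Qed.

Lemma is_derive_RInt_cont (f : R -> R) (a x : R) : (forall y, continuous f y) ->
  is_derive (fun x => RInt f a x) x (f x).
Proof.
  intros H. apply (is_derive_RInt f _ a x); [|apply H].
  apply filter_forall. intros y. apply (RInt_correct (V := R_CompleteNormedModule) f), ex_RInt_cont, H.
Qed.

Lemma is_derive_gauss_integrand (x s : R) :
  is_derive (fun u => exp (- u ^ 2 * (1 + s ^ 2)) / (1 + s ^ 2)) x (- (2 * x) * exp (- x ^ 2 * (1 + s ^ 2))).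
Proof.
  assert (P := one_plus_sqr_pos s).
  apply (is_derive_ext (fun u => / (1 + s ^ 2) * exp (- u ^ 2 * (1 + s ^ 2)))); [intros; unfold Rdiv; req; ring|].
  set (c := 1 + s ^ 2) in *. auto_derive; auto. replace (- (x * (x * 1)) * c) with (- x ^ 2 * c) by ring. req. field. lra.
Qed.

(** Differentiation under the integral cancels the denominator, and the substitution y = x s
    recovers [gauss_int x]. *)
Lemma is_derive_gauss_aux (x : R) : is_derive gauss_aux x (- 2 * exp (- x ^ 2) * gauss_int x).
Proof.
  assert (D : forall u s, Derive (fun z => exp (- z ^ 2 * (1 + s ^ 2)) / (1 + s ^ 2)) u = - (2 * u) * exp (- u ^ 2 * (1 + s ^ 2))).
  { intros u s. apply is_derive_unique, is_derive_gauss_integrand. }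
  eapply is_derive_eq.
  - apply (is_derive_RInt_param (fun x s => exp (- x ^ 2 * (1 + s ^ 2)) / (1 + s ^ 2)) 0 1 x).
    + apply filter_forall. intros y s _. eexists. apply is_derive_gauss_integrand.
    + intros s _. apply (continuity_2d_pt_ext (fun u v => - (2 * u) * exp (- u ^ 2 * (1 + v ^ 2)))); [intros; symmetry; apply D|].
      apply continuity_2d_pt_mult.
      * apply continuity_2d_pt_opp, continuity_2d_pt_mult; [apply continuity_2d_pt_const|apply continuity_2d_pt_id1].
      * apply (continuity_1d_2d_pt_comp exp (fun u v => - u ^ 2 * (1 + v ^ 2))).
        -- apply derivable_continuous_pt, derivable_pt_exp.
        -- apply (continuity_2d_pt_ext (fun u v => - (u * u) * (1 + v * v))); [intros; ring|].
           apply continuity_2d_pt_mult.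
           ++ apply continuity_2d_pt_opp, continuity_2d_pt_mult; apply continuity_2d_pt_id1.
           ++ apply continuity_2d_pt_plus; [apply continuity_2d_pt_const|]. apply continuity_2d_pt_mult; apply continuity_2d_pt_id2.
    + apply filter_forall. intros y. apply ex_RInt_cont. intros s. apply continuous_gauss_aux.
  - rewrite (RInt_ext _ (fun s => (- 2 * exp (- x ^ 2)) * (x * exp (- (x * s) ^ 2)))).
    + rewrite RInt_mult_const.
      * rewrite (RInt_dilate (fun y => exp (- y ^ 2))) by apply continuous_gauss.
        rewrite Rmult_0_r, Rmult_1_r. reflexivity.
      * intros s. apply (cont_derive (fun s => x * (exp (- (x * s) ^ 2)))). auto_derive. auto.
    + intros s _. rewrite D.
      replace (- x ^ 2 * (1 + s ^ 2)) with (- x ^ 2 + - (x * s) ^ 2) by ring.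
      rewrite exp_plus. req. ring.
Qed.

Lemma gauss_int_sqr (x : R) : 0 <= x -> gauss_int x ^ 2 + gauss_aux x = PI / 4.
Proof.
  intros Hx.
  destruct (MVT_le (fun x => gauss_int x * gauss_int x + gauss_aux x) (fun _ => 0) 0 x Hx) as [c [_ E]].
  - intros y _. assert (H := is_derive_RInt_cont (fun y => exp (- y ^ 2)) 0 y continuous_gauss).
    eapply is_derive_eq.
    + apply (is_derive_plus (K := R_AbsRing) (V := R_NormedModule)).
      * apply (is_derive_mult gauss_int gauss_int); [exact H|exact H|intros; apply Rmult_comm].
      * apply is_derive_gauss_aux.
    + unfold plus, mult; simpl. req. ring.
  - assert (G0 : gauss_int 0 = 0) by (apply (RInt_point (V := R_CompleteNormedModule))).
    assert (A0 : gauss_aux 0 = PI / 4).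
    { unfold gauss_aux. rewrite (RInt_ext _ (fun s => / (1 + s ^ 2))).
      - rewrite (RInt_FTC atan); [rewrite atan_0, atan_1; req; ring| |].
        + intros s. eapply is_derive_eq; [apply is_derive_atan|]. unfold Rsqr. req. f_equal. ring.
        + intros s. apply (cont_derive (fun s => / (1 + s ^ 2))). auto_derive. generalize (one_plus_sqr_pos s). simpl. lra.
      - intros s _. replace (- 0 ^ 2 * (1 + s ^ 2)) with 0 by ring. rewrite exp_0. unfold Rdiv. apply Rmult_1_l. }
    rewrite G0, A0 in E. simpl. lra.
Qed.

Lemma gauss_aux_bounds (x : R) : 0 <= gauss_aux x <= exp (- x ^ 2).
Proof.
  assert (C := continuous_gauss_aux x).
  assert (K : forall c : R, RInt (fun _ => c) 0 1 = c).
  { intros c. rewrite RInt_const. unfold scal; simpl; unfold mult; simpl. req. ring. }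
  assert (Kc : forall c y : R, continuous (fun _ : R => c) y) by (intros; apply continuous_const).
  split.
  - rewrite <- (K 0). apply RInt_mono; [lra|apply Kc|exact C|]. intros s _.
    apply Rdiv_le_0_compat; [left; apply exp_pos|apply one_plus_sqr_pos].
  - rewrite <- (K (exp (- x ^ 2))). apply RInt_mono; [lra|exact C|apply Kc|]. intros s _.
    assert (P := pow2_ge_0 s). assert (P2 := pow2_ge_0 x).
    apply Rle_trans with (exp (- x ^ 2 * (1 + s ^ 2)) / 1).
    + apply Rmult_le_compat_l; [left; apply exp_pos|]. apply Rinv_le_contravar; lra.
    + rewrite Rdiv_1_r. destruct (Rle_lt_or_eq_dec (- x ^ 2 * (1 + s ^ 2)) (- x ^ 2)) as [H|H]; [nra|left; now apply exp_increasing|right; now rewrite H].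
Qed.

(** A difference of squares: (r - g) (r + g) is [gauss_aux x], at most 1 / x^2, while r + g >=
    1/2. *)
Lemma gauss_int_bounds (x : R) : 0 < x -> Rabs (gauss_int x - sqrt PI / 2) <= 2 / x ^ 2.
Proof.
  intros Hx. assert (H := gauss_int_sqr x ltac:(lra)). assert (B := gauss_aux_bounds x).
  assert (Hpi := PI2_3_2).
  assert (S : sqrt PI * sqrt PI = PI) by (apply sqrt_sqrt; lra).
  assert (S1 : 1 <= sqrt PI) by (rewrite <- sqrt_1 at 1; apply sqrt_le_1; lra).
  assert (G0 : 0 <= gauss_int x).
  { unfold gauss_int. replace 0 with (RInt (fun _ : R => 0) 0 x) at 1.
    - apply RInt_mono; [lra|intros; apply continuous_const|apply continuous_gauss|]. intros; left; apply exp_pos.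
    - rewrite RInt_const. unfold scal; simpl; unfold mult; simpl. req. ring. }
  assert (E : exp (- x ^ 2) <= / x ^ 2).
  { rewrite exp_Ropp. apply Rinv_le_contravar; [apply pow_lt; lra|]. generalize (exp_ineq1_le (x ^ 2)). lra. }
  set (g := gauss_int x) in *. set (r := sqrt PI / 2) in *.
  assert (Hd : (r - g) * (r + g) = gauss_aux x).
  { replace ((r - g) * (r + g)) with (r * r - g ^ 2) by ring. unfold r.
    replace (sqrt PI / 2 * (sqrt PI / 2)) with (sqrt PI * sqrt PI / 4) by field. rewrite S. lra. }
  assert (Hr : 1 / 2 <= r) by (unfold r; lra).
  unfold Rdiv. apply Rabs_le. split; [|nra]. assert (0 <= / x ^ 2) by (left; apply Rinv_0_lt_compat, pow_lt; lra). nra.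
Qed.

Lemma gauss_integral_scaled (b x : R) : 0 < b -> 0 < x ->
  Rabs (RInt (fun y => exp (- (b * y ^ 2))) (- x) x - sqrt (PI / b)) <= 4 / (sqrt b * (b * x ^ 2)).
Proof.
  intros Hb Hx. assert (Hs := sqrt_lt_R0 b Hb). assert (Es := sqrt_sqrt b (Rlt_le _ _ Hb)).
  set (s := sqrt b) in *.
  assert (C : forall y, continuous (fun y => exp (- (b * y ^ 2))) y).
  { intros y. apply (cont_derive (fun y => exp (- (b * y ^ 2)))). auto_derive. auto. }
  assert (H1 : forall u, s * RInt (fun y => exp (- (b * y ^ 2))) 0 u = gauss_int (s * u)).
  { intros u. unfold gauss_int. rewrite <- (RInt_mult_const s) by easy.
    transitivity (RInt (fun y => exp (- y ^ 2)) (s * 0) (s * u)); [|now rewrite Rmult_0_r].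
    rewrite <- RInt_dilate by apply continuous_gauss.
    apply RInt_ext. intros y _. rewrite <- Es. req. do 2 f_equal. ring. }
  assert (Hodd : gauss_int (s * - x) = - gauss_int (s * x)).
  { unfold gauss_int. transitivity (RInt (fun y => exp (- y ^ 2)) (-1 * 0) (-1 * (s * x))); [f_equal; ring|].
    rewrite <- RInt_dilate by apply continuous_gauss.
    rewrite (RInt_ext _ (fun y => -1 * exp (- y ^ 2))).
    - rewrite RInt_mult_const by apply continuous_gauss. req. ring.
    - intros y _. do 3 f_equal. ring. }
  assert (HI : RInt (fun y => exp (- (b * y ^ 2))) (- x) x = 2 / s * gauss_int (s * x)).
  { rewrite <- (RInt_Chasles (V := R_CompleteNormedModule) (fun y => exp (- (b * y ^ 2))) (- x) 0 x) by (now apply ex_RInt_cont).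
    rewrite <- (opp_RInt_swap (V := R_CompleteNormedModule) (fun y => exp (- (b * y ^ 2)))) by (now apply ex_RInt_cont).
    assert (A := H1 x). assert (B := H1 (- x)). rewrite Hodd in B.
    change (- RInt (fun y => exp (- (b * y ^ 2))) 0 (- x) + RInt (fun y => exp (- (b * y ^ 2))) 0 x = 2 / s * gauss_int (s * x)).
    apply Rmult_eq_reg_l with s; [|lra].
    replace (s * (2 / s * gauss_int (s * x))) with (2 * gauss_int (s * x)) by (field; lra). lra. }
  rewrite HI. rewrite sqrt_div_alt by easy. fold s.
  assert (G := gauss_int_bounds (s * x) ltac:(nra)).
  replace (2 / s * gauss_int (s * x) - sqrt PI / s) with (2 / s * (gauss_int (s * x) - sqrt PI / 2)) by (field; lra).
  rewrite Rabs_mult, Rabs_right by (apply Rle_ge, Rdiv_le_0_compat; lra).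
  apply Rle_trans with (2 / s * (2 / (s * x) ^ 2)).
  - apply Rmult_le_compat_l; [apply Rdiv_le_0_compat; lra|easy].
  - right. rewrite <- Es. field. lra.
Qed.

(** * Gamma at half-integers and the Bessel series *)

Definition gamma_seq (x : R) (n : nat) : R := INR (Factorial.fact n) * Rpower (INR n) x / gauss_prod x n.

Lemma gauss_prod_shift (x : R) (n : nat) : x * gauss_prod (x + 1) n = gauss_prod x n * (x + 1 + INR n).
Proof.
  induction n as [|n IH]; [simpl; ring|].
  cbn [gauss_prod]. rewrite <- Rmult_assoc, IH, !S_INR. ring.
Qed.

(** The product (1/2) (3/2) ... (n + 1/2) is a Wallis integral up to elementary factors, so the
    bounds for [wallis] also yield Gamma (1/2) = sqrt PI. *)
Lemma gauss_prod_half (n : nat) :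
  gauss_prod (1 / 2) n * PI = (INR n + 1 / 2) * INR (Factorial.fact n) * (2 * wallis (2 * n)).
Proof.
  induction n as [|n IH].
  - cbn [gauss_prod]. simpl (2 * 0)%nat. rewrite wallis_0. simpl. field.
  - cbn [gauss_prod]. assert (H := wallis_rec (2 * n)).
    replace (S (S (2 * n))) with (2 * S n)%nat in H by lia. rewrite mult_INR in H. simpl (INR 2) in H.
    rewrite fact_simpl, mult_INR, S_INR.
    replace (gauss_prod (1 / 2) n * (1 / 2 + (INR n + 1)) * PI) with (gauss_prod (1 / 2) n * PI * (INR n + 1 + 1 / 2)) by ring.
    rewrite IH. assert (Hn := pos_INR n).
    replace ((INR n + 1 / 2) * INR (Factorial.fact n) * (2 * wallis (2 * n)) * (INR n + 1 + 1 / 2))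
      with (INR (Factorial.fact n) * ((1 + 1) * INR n + 1) * wallis (2 * n) * (INR n + 1 + 1 / 2)) by field.
    transitivity (INR (Factorial.fact n) * (((1 + 1) * INR n + 1) * wallis (2 * n)) * (INR n + 1 + 1 / 2)); [ring|].
    rewrite <- H. ring.
Qed.

Lemma gamma_seq_half (n : nat) : (0 < n)%nat ->
  sqrt PI * (INR n / (INR n + 1 / 2)) <= gamma_seq (1 / 2) n <= sqrt PI.
Proof.
  intros Hn. assert (Hn' : 1 <= INR n) by (apply (le_INR 1); lia). assert (Hpi := PI_RGT_0).
  assert (Hg := gauss_prod_half n). assert (Hw := wallis_pos (2 * n)).
  assert (Hf : 0 < INR (Factorial.fact n)) by apply INR_fact_lt_0.
  assert (U := wallis_sqr_upper (2 * n - 1)). assert (W := wallis_sqr_lower (2 * n)).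
  rewrite <- S_INR in U. replace (S (2 * n - 1)) with (2 * n)%nat in U by lia.
  rewrite mult_INR in U, W. replace (INR 2) with 2 in U, W by (simpl; ring).
  set (w := wallis (2 * n)) in *. set (l := INR n) in *.
  assert (S1 : sqrt PI * sqrt PI = PI) by (apply sqrt_sqrt; lra). assert (S0 : 0 < sqrt PI) by (apply sqrt_lt_R0; lra).
  assert (L1 : sqrt l * sqrt l = l) by (apply sqrt_sqrt; lra). assert (L0 : 0 < sqrt l) by (apply sqrt_lt_R0; lra).
  assert (E : gamma_seq (1 / 2) n = sqrt l * PI / (2 * (l + 1 / 2) * w)).
  { unfold gamma_seq. fold l. replace (1 / 2) with (/ 2) at 1 by field. rewrite Rpower_sqrt by lra.
    replace (gauss_prod (1 / 2) n) with ((l + 1 / 2) * INR (Factorial.fact n) * (2 * w) / PI) by (rewrite <- Hg; field; lra).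
    field. repeat split; lra. }
  rewrite E. set (a := sqrt l) in *. set (p := sqrt PI) in *.
  assert (D : 0 < 2 * (l + 1 / 2) * w) by (apply Rmult_lt_0_compat; lra).
  split.
  - apply Rmult_le_reg_r with (2 * (l + 1 / 2) * w); [easy|].
    replace (p * (l / (l + 1 / 2)) * (2 * (l + 1 / 2) * w)) with (p * a * (2 * a * w)) by (rewrite <- L1; field; rewrite L1; lra).
    replace (a * PI / (2 * (l + 1 / 2) * w) * (2 * (l + 1 / 2) * w)) with (p * a * p) by (rewrite <- S1; field; split; lra).
    apply Rmult_le_compat_l; [nra|]. apply Rnot_lt_le. intros Hlt.
    assert (p * p < (2 * a * w) * (2 * a * w)) by nra.
    replace ((2 * a * w) * (2 * a * w)) with (2 * (2 * (a * a) * w ^ 2)) in * by ring. rewrite L1 in *. lra.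
  - apply Rmult_le_reg_r with (2 * (l + 1 / 2) * w); [easy|].
    replace (a * PI / (2 * (l + 1 / 2) * w) * (2 * (l + 1 / 2) * w)) with (p * (a * p)) by (rewrite <- S1; field; split; lra).
    apply Rmult_le_compat_l; [lra|]. apply Rnot_lt_le. intros Hlt.
    assert (Q : (2 * (l + 1 / 2) * w) * (2 * (l + 1 / 2) * w) < (a * p) * (a * p)) by nra.
    replace ((a * p) * (a * p)) with ((a * a) * (p * p)) in Q by ring. rewrite L1, S1 in Q.
    replace ((2 * (l + 1 / 2) * w) * (2 * (l + 1 / 2) * w)) with ((2 * l + 1) * ((2 * l + 1) * w ^ 2)) in Q by field. nra.
Qed.

Lemma is_lim_seq_ratio (c : R) : is_lim_seq (fun n => INR n / (INR n + c)) 1.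
Proof.
  destruct (INR_unbounded (Rabs c)) as [m Hm].
  apply (is_lim_seq_incr_n _ m).
  apply (is_lim_seq_ext (fun n => 1 - c * / (INR (n + m) + c))).
  - intros n. assert (H : 0 < INR (n + m) + c).
    { rewrite plus_INR. assert (D := Rle_abs (- c)). rewrite Rabs_Ropp in D. generalize (pos_INR n). lra. }
    field. lra.
  - replace (Finite 1) with (Rbar_minus 1 (Rbar_mult c 0)) by (simpl; f_equal; ring).
    apply is_lim_seq_minus'; [apply is_lim_seq_const|].
    replace (Finite (c * 0)) with (Rbar_mult c 0) by reflexivity.
    apply (is_lim_seq_scal_l _ c 0).
    apply (is_lim_seq_inv _ p_infty); [|easy].
    apply (is_lim_seq_plus _ _ p_infty c); [|apply is_lim_seq_const|easy].
    apply (is_lim_seq_incr_n INR). apply is_lim_seq_INR.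
Qed.

Lemma is_lim_gamma_half : is_lim_seq (gamma_seq (1 / 2)) (sqrt PI).
Proof.
  apply (is_lim_seq_le_le_loc (fun n => sqrt PI * (INR n / (INR n + 1 / 2))) _ (fun _ => sqrt PI)).
  - exists 1%nat. intros n Hn. apply gamma_seq_half. lia.
  - replace (Finite (sqrt PI)) with (Rbar_mult (sqrt PI) 1) by (simpl; f_equal; ring).
    apply (is_lim_seq_scal_l _ (sqrt PI) 1), is_lim_seq_ratio.
  - apply is_lim_seq_const.
Qed.

Lemma gauss_prod_neq_0 (x : R) (n : nat) : (forall k : nat, x + INR k <> 0) -> gauss_prod x n <> 0.
Proof.
  intros H. induction n as [|n IH]; cbn [gauss_prod].
  - specialize (H O). simpl in H. rewrite Rplus_0_r in H. exact H.
  - apply Rmult_integral_contrapositive_currified; auto.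
Qed.

Lemma gamma_seq_shift (x : R) (n : nat) : (forall k : nat, x + INR k <> 0) -> (0 < n)%nat ->
  gamma_seq (x + 1) n = x * gamma_seq x n * (INR n / (INR n + (x + 1))).
Proof.
  intros Hx Hn. assert (Hn' : 0 < INR n) by now apply lt_0_INR.
  assert (N1 := gauss_prod_neq_0 x n Hx).
  assert (N2 : gauss_prod (x + 1) n <> 0).
  { apply gauss_prod_neq_0. intros k. specialize (Hx (S k)). rewrite S_INR in Hx. lra. }
  assert (Nx : x <> 0) by (specialize (Hx O); simpl in Hx; lra).
  assert (N3 : INR n + (x + 1) <> 0) by (specialize (Hx (S n)); rewrite S_INR in Hx; lra).
  unfold gamma_seq. rewrite Rpower_plus, Rpower_1 by easy.
  assert (E := gauss_prod_shift x n).
  replace (gauss_prod (x + 1) n) with (gauss_prod x n * (x + 1 + INR n) / x) by (rewrite <- E; field; easy).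
  field. repeat split; auto; lra.
Qed.

Lemma is_lim_gamma_shift (x l : R) : (forall k : nat, x + INR k <> 0) ->
  is_lim_seq (gamma_seq x) l -> is_lim_seq (gamma_seq (x + 1)) (x * l).
Proof.
  intros Hx H. apply (is_lim_seq_ext_loc (fun n => x * gamma_seq x n * (INR n / (INR n + (x + 1))))).
  - exists 1%nat. intros n Hn. symmetry. apply gamma_seq_shift; auto.
  - replace (Finite (x * l)) with (Finite (x * l * 1)) by (f_equal; ring).
    apply is_lim_seq_mult'; [|apply is_lim_seq_ratio].
    apply (is_lim_seq_scal_l _ x l H).
Qed.

(** The Bessel series of order -3/2 starts at Gamma (-1/2), which is reached from 1/2 by the
    recurrence used backwards. *)
Lemma is_lim_gamma_minus_half : is_lim_seq (gamma_seq (- 1 / 2)) (- 2 * sqrt PI).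
Proof.
  assert (Hx : forall k : nat, - 1 / 2 + INR k <> 0).
  { intros [|k]; [simpl; lra|]. rewrite S_INR. generalize (pos_INR k). lra. }
  apply (is_lim_seq_ext_loc (fun n => -2 * gamma_seq (1 / 2) n * / (INR n / (INR n + 1 / 2)))).
  - exists 1%nat. intros n Hn. assert (Hn' : 1 <= INR n) by (apply (le_INR 1); lia).
    assert (E := gamma_seq_shift (- 1 / 2) n Hx Hn). replace (- 1 / 2 + 1) with (1 / 2) in E by field.
    rewrite E. field. split; lra.
  - replace (Finite (-2 * sqrt PI)) with (Finite (-2 * sqrt PI * / 1)) by (f_equal; field).
    apply is_lim_seq_mult'.
    + apply (is_lim_seq_scal_l _ (-2) (sqrt PI) is_lim_gamma_half).
    + apply (is_lim_seq_inv _ 1); [apply is_lim_seq_ratio|]. intros E. apply Rbar_finite_eq in E. lra.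
Qed.

(* Gamma (k - 1/2). *)
Fixpoint gamma_half_int (k : nat) : R :=
  match k with O => -2 * sqrt PI | S k' => (INR k' - 1 / 2) * gamma_half_int k' end.

Lemma is_lim_gamma_half_int (k : nat) : is_lim_seq (gamma_seq (INR k - 1 / 2)) (gamma_half_int k).
Proof.
  induction k as [|k IH]; cbn [gamma_half_int].
  - replace (INR 0 - 1 / 2) with (- 1 / 2) by (simpl; field). apply is_lim_gamma_minus_half.
  - replace (INR (S k) - 1 / 2) with (INR k - 1 / 2 + 1) by (rewrite S_INR; ring).
    apply is_lim_gamma_shift; [|exact IH]. intros j H.
    assert (H2 : 2 * (INR k + INR j) = 1) by lra. rewrite <- plus_INR in H2.
    replace 2 with (INR 2) in H2 by (simpl; ring). rewrite <- mult_INR in H2. apply (INR_eq _ 1) in H2. lia.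
Qed.

Lemma Gamma_half_int (k : nat) : Gamma (INR k - 1 / 2) = gamma_half_int k.
Proof. change (real (Lim_seq (gamma_seq (INR k - 1 / 2))) = gamma_half_int k). now rewrite (is_lim_seq_unique _ _ (is_lim_gamma_half_int k)). Qed.

(** Legendre's duplication formula, by induction. It merges k! and Gamma into (2 k)!, which turns
    the Bessel series into exponential series. *)
Lemma gamma_half_int_fact (k : nat) :
  INR (Factorial.fact k) * gamma_half_int k * (INR k - 1 / 2) * 4 ^ k = INR (Factorial.fact (2 * k)) * sqrt PI.
Proof.
  induction k as [|k IH]; [simpl; field|].
  cbn [gamma_half_int]. replace (2 * S k)%nat with (S (S (2 * k))) by lia.
  rewrite !fact_simpl, !mult_INR. rewrite !S_INR, mult_INR. simpl (INR 2).
  rewrite Rmult_assoc, <- Rmult_assoc.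
  transitivity ((((1 + 1) * INR k + 1 + 1) * ((1 + 1) * INR k + 1)) * (INR (Factorial.fact k) * gamma_half_int k * (INR k - 1 / 2) * 4 ^ k)).
  - simpl pow. field.
  - rewrite IH. ring.
Qed.

Lemma half_int_neq_0 (k : nat) : INR k - 1 / 2 <> 0.
Proof. destruct k as [|k]; [simpl; lra|]. rewrite S_INR. generalize (pos_INR k). lra. Qed.

Lemma bessel_term (x : R) (k : nat) : 0 < x ->
  Rpower (x / 2) (2 * INR k + - (3 / 2)) / (INR (Factorial.fact k) * Gamma (INR k + - (3 / 2) + 1)) =
  Rpower (x / 2) (- (3 / 2)) / sqrt PI * ((INR k - 1 / 2) * (x ^ (2 * k) / INR (Factorial.fact (2 * k)))).
Proof.
  intros Hx. replace (INR k + - (3 / 2) + 1) with (INR k - 1 / 2) by field. rewrite Gamma_half_int.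
  assert (H := gamma_half_int_fact k). assert (N := half_int_neq_0 k).
  assert (S0 : 0 < sqrt PI) by (apply sqrt_lt_R0, PI_RGT_0).
  assert (F1 : 0 < INR (Factorial.fact k)) by apply INR_fact_lt_0.
  assert (F2 : 0 < INR (Factorial.fact (2 * k))) by apply INR_fact_lt_0.
  assert (P4 : 0 < 4 ^ k) by (apply pow_lt; lra).
  rewrite Rpower_plus.
  replace (Rpower (x / 2) (2 * INR k)) with (x ^ (2 * k) / 4 ^ k).
  - assert (N2 : gamma_half_int k <> 0).
    { intros E. rewrite E in H. nra. }
    replace (INR (Factorial.fact (2 * k))) with (INR (Factorial.fact k) * gamma_half_int k * (INR k - 1 / 2) * 4 ^ k / sqrt PI) by (rewrite H; field; lra).
    field. repeat split; auto; try lra; intros E; apply N; lra.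
  - replace (2 * INR k) with (INR (2 * k)) by (rewrite mult_INR; simpl; ring).
    rewrite Rpower_pow by lra. unfold Rdiv. rewrite Rpow_mult_distr, pow_inv, (pow_mult 2 2 k).
    now replace (2 ^ 2) with 4 by ring.
Qed.

Lemma is_lim_exp_partial (x : R) : is_lim_seq (fun n => rsum (fun k => x ^ k / INR (Factorial.fact k)) n) (exp x).
Proof.
  apply is_lim_seq_incr_1.
  apply (is_lim_seq_ext (sum_n (fun k => x ^ k / INR (Factorial.fact k)))).
  - intros n. apply rsum_sum_n.
  - assert (H := is_exp_Reals x). unfold is_pseries in H.
    apply (is_lim_seq_ext (sum_n (fun k => scal (pow_n x k) (/ INR (Factorial.fact k))))); [|exact H].
    intros n. apply sum_n_ext. intros k. rewrite pow_n_pow. reflexivity.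
Qed.

(** The term k x^(2k) / (2k)! is x / 2 times the odd exponential term just before, and e^x - e^(-x)
    and e^x + e^(-x) isolate odd and even terms. This shift of degree explains the two lengths
    [2 * K] and [2 * S K]. *)
Lemma bessel_partial (x : R) (K : nat) :
  rsum (fun k => (INR k - 1 / 2) * (x ^ (2 * k) / INR (Factorial.fact (2 * k)))) (S K) =
  x * (rsum (fun k => x ^ k / INR (Factorial.fact k)) (2 * K) - rsum (fun k => (- x) ^ k / INR (Factorial.fact k)) (2 * K)) / 4
  - (rsum (fun k => x ^ k / INR (Factorial.fact k)) (2 * S K) + rsum (fun k => (- x) ^ k / INR (Factorial.fact k)) (2 * S K)) / 4.
Proof.
  induction K as [|K IH].
  - simpl. field.
  - rewrite rsum_S, IH. set (e := fun k => x ^ k / INR (Factorial.fact k)). set (f := fun k => (- x) ^ k / INR (Factorial.fact k)).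
    change (x ^ (2 * S K) / INR (Factorial.fact (2 * S K))) with (e (2 * S K)%nat).
    assert (Heven : forall j, f (2 * j)%nat = e (2 * j)%nat) by (intros j; unfold e, f; rewrite !pow_mult; do 2 f_equal; ring).
    assert (Hodd : forall j, f (S (2 * j)) = - e (S (2 * j))).
    { intros j. unfold e, f. rewrite <- !tech_pow_Rmult.
      replace ((- x) ^ (2 * j)) with (x ^ (2 * j)) by (rewrite !pow_mult; f_equal; ring). unfold Rdiv. ring. }
    assert (E5 : x * e (S (2 * K)) = 2 * INR (S K) * e (2 * S K)%nat).
    { unfold e. replace (2 * S K)%nat with (S (S (2 * K))) by lia. rewrite (fact_simpl (S (2 * K))), mult_INR.
      replace (INR (S (S (2 * K)))) with (2 * INR (S K)) by (rewrite !S_INR, mult_INR; simpl; ring).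
      rewrite <- (tech_pow_Rmult x (S (2 * K))). field. split; [apply INR_fact_neq_0|apply not_0_INR; lia]. }
    assert (F1 := Heven K). assert (F2 := Hodd K). assert (F3 := Heven (S K)). assert (F4 := Hodd (S K)).
    replace (2 * S (S K))%nat with (S (S (S (S (2 * K))))) by lia.
    replace (2 * S K)%nat with (S (S (2 * K))) in * by lia.
    rewrite !rsum_S. rewrite F1, F2, F3, F4. clearbody e f. lra.
Qed.

Lemma BesselI_minus_three_halves (x : R) : 0 < x ->
  BesselI (- (3 / 2)) x = Rpower (x / 2) (- (3 / 2)) / sqrt PI * (x * (exp x - exp (- x)) / 4 - (exp x + exp (- x)) / 4).
Proof.
  intros Hx. unfold BesselI.
  rewrite (Series_ext _ _ (fun k => bessel_term x k Hx)), Series_scal_l. f_equal.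
  apply is_series_unique.
  assert (L : is_lim_seq (sum_n (fun k => (INR k - 1 / 2) * (x ^ (2 * k) / INR (Factorial.fact (2 * k)))))
    (x * (exp x - exp (- x)) / 4 - (exp x + exp (- x)) / 4)); [|exact L].
  assert (Hsub : forall (y : R) (d : nat), is_lim_seq (fun K => rsum (fun k => y ^ k / INR (Factorial.fact k)) (2 * (K + d))) (exp y)).
  { intros y d. apply (is_lim_seq_subseq (fun n => rsum (fun k => y ^ k / INR (Factorial.fact k)) n) (exp y) (fun K => (2 * (K + d))%nat)).
    - apply eventually_subseq. intros n. lia.
    - apply is_lim_exp_partial. }
  apply (is_lim_seq_ext (fun K => x * / 4 * (rsum (fun k => x ^ k / INR (Factorial.fact k)) (2 * (K + 0)) - rsum (fun k => (- x) ^ k / INR (Factorial.fact k)) (2 * (K + 0)))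
     - / 4 * (rsum (fun k => x ^ k / INR (Factorial.fact k)) (2 * (K + 1)) + rsum (fun k => (- x) ^ k / INR (Factorial.fact k)) (2 * (K + 1))))).
  - intros K. rewrite rsum_sum_n, bessel_partial. rewrite Nat.add_0_r, Nat.add_1_r. field.
  - replace (Finite (x * (exp x - exp (- x)) / 4 - (exp x + exp (- x)) / 4)) with
      (Finite (x * / 4 * (exp x - exp (- x)) - / 4 * (exp x + exp (- x)))) by (f_equal; field).
    apply is_lim_seq_minus'.
    + apply (is_lim_seq_scal_l _ (x * / 4) (exp x - exp (- x))). apply is_lim_seq_minus'; apply Hsub.
    + apply (is_lim_seq_scal_l _ (/ 4) (exp x + exp (- x))). apply is_lim_seq_plus'; apply Hsub.
Qed.

(** In the elementary form the part x e^x is exactly the main term; of the rest, e^x is smaller by a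
    factor x and the others decay. *)
Lemma BesselI_asymptotic (x : R) : 1 <= x ->
  Rabs (BesselI (- (3 / 2)) x - exp x / sqrt (2 * PI * x)) <= 2 * exp x / (x * sqrt x).
Proof.
  intros Hx. rewrite BesselI_minus_three_halves by lra. assert (Hpi := PI2_3_2).
  assert (S2 : 0 < sqrt 2) by (apply sqrt_lt_R0; lra). assert (S2' : sqrt 2 * sqrt 2 = 2) by (apply sqrt_sqrt; lra).
  assert (Sx : 0 < sqrt x) by (apply sqrt_lt_R0; lra). assert (Sx' : sqrt x * sqrt x = x) by (apply sqrt_sqrt; lra).
  assert (Sp : 1 <= sqrt PI) by (rewrite <- sqrt_1 at 1; apply sqrt_le_1; lra).
  assert (E1 : Rpower (x / 2) (- (3 / 2)) = 2 * sqrt 2 / (x * sqrt x)).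
  { rewrite Rpower_Ropp. replace (3 / 2) with (1 + / 2) by field. rewrite Rpower_plus, Rpower_1, Rpower_sqrt by lra.
    rewrite sqrt_div by lra. field. repeat split; lra. }
  assert (E2 : sqrt (2 * PI * x) = sqrt 2 * sqrt PI * sqrt x) by (rewrite !sqrt_mult by lra; reflexivity).
  rewrite E1, E2.
  replace (2 * sqrt 2 / (x * sqrt x) / sqrt PI * (x * (exp x - exp (- x)) / 4 - (exp x + exp (- x)) / 4) - exp x / (sqrt 2 * sqrt PI * sqrt x))
    with (- (sqrt 2 / 2 / (x * sqrt x) / sqrt PI * (x * exp (- x) + exp x + exp (- x)))).
  - rewrite Rabs_Ropp.
    assert (P1 := exp_pos x). assert (P2 := exp_pos (- x)). 
    assert (B1 : x * exp (- x) <= 1).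
    { rewrite exp_Ropp. apply Rmult_le_reg_r with (exp x); [easy|]. rewrite Rmult_assoc, Rinv_l by lra. generalize (exp_ineq1_le x). lra. }
    assert (B2 : 2 <= exp x) by (generalize (exp_ineq1_le x); lra).
    assert (B3 : exp (- x) <= 1) by nra.
    assert (Px : 0 < x * sqrt x) by nra.
    rewrite Rabs_right.
    + apply Rmult_le_reg_r with (x * sqrt x * sqrt PI); [nra|].
      replace (sqrt 2 / 2 / (x * sqrt x) / sqrt PI * (x * exp (- x) + exp x + exp (- x)) * (x * sqrt x * sqrt PI)) with (sqrt 2 / 2 * (x * exp (- x) + exp x + exp (- x))) by (field; repeat split; lra).
      replace (2 * exp x / (x * sqrt x) * (x * sqrt x * sqrt PI)) with (2 * exp x * sqrt PI) by (field; repeat split; lra).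
      assert (sqrt 2 <= 2) by nra. 
      apply Rle_trans with (1 * (2 * exp x)); [apply Rmult_le_compat; nra|nra].
    + apply Rle_ge. apply Rmult_le_pos; [|nra]. repeat apply Rdiv_le_0_compat; lra.
  - set (r := sqrt 2) in *.
    assert (I : / r = r / 2).
    { apply Rmult_eq_reg_l with r; [|lra]. rewrite Rinv_r by lra. lra. }
    replace (exp x / (r * sqrt PI * sqrt x)) with (/ r * (exp x / (sqrt PI * sqrt x))) by (field; repeat split; lra).
    rewrite I. field. repeat split; lra.
Qed.

(** * The circle integral *)

Lemma RInt_abs_bound (f g : R -> R) (a b : R) : a <= b ->
  (forall x, continuous f x) -> (forall x, continuous g x) ->
  (forall x, a < x < b -> Rabs (f x) <= g x) -> Rabs (RInt f a b) <= RInt g a b.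
Proof.
  intros Hab Hf Hg H. eapply Rle_trans; [apply abs_RInt_le; [easy|now apply ex_RInt_cont]|].
  apply RInt_mono; auto. intros x. apply (continuous_comp f Rabs); [apply Hf|apply continuous_Rabs].
Qed.

Lemma RInt_lorentz (c a : R) : 0 < c -> 0 <= a -> RInt (fun y => / (1 + (y / c) ^ 2)) (- a) a <= c * PI.
Proof.
  intros Hc Ha.
  rewrite (RInt_FTC (fun y => c * atan (y / c))).
  - assert (B1 := atan_bound (a / c)). assert (B2 := atan_bound (- a / c)). unfold Rdiv in *. nra.
  - intros y. assert (P := pow2_ge_0 (y / c)). auto_derive; auto. req.
    unfold Rsqr, Rdiv in *. set (z := y * / c) in *. field. split; [nra|lra].
  - intros y. apply (cont_derive (fun y => / (1 + (y / c) ^ 2))). auto_derive.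
    assert (P := pow2_ge_0 (y / c)). simpl in P. unfold Rdiv in P. lra.
Qed.

(** The fifth power is what the far range needs: the trivial bound for h costs t^(-3) there, and t^2
    must remain. *)
Lemma exp_neg_inv_small (t : R) : 0 < t -> exp (- (1 / (3456 * t))) <= 120 * 3456 ^ 5 * t ^ 5.
Proof.
  intros Ht. set (z := 1 / (3456 * t)). assert (Hz : 0 < z) by (apply Rdiv_lt_0_compat; lra).
  assert (T := exp_ge_taylor z 5 (Rlt_le _ _ Hz)).
  assert (T2 : z ^ 5 / 120 <= exp z).
  { eapply Rle_trans; [|exact T]. 
    replace (sum_f_R0 (fun k => z ^ k / INR (fact k)) 5) with (1 + z + z ^ 2 / 2 + z ^ 3 / 6 + z ^ 4 / 24 + z ^ 5 / 120) by (simpl; field).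
    assert (0 <= z ^ 2) by (apply pow_le; lra). assert (0 <= z ^ 3) by (apply pow_le; lra). assert (0 <= z ^ 4) by (apply pow_le; lra). lra. }
  rewrite <- (Rmult_1_l (exp _)). assert (P5 : 0 < t ^ 5) by (apply pow_lt; lra).
  apply exp_neg_le; [apply Rmult_lt_0_compat; [lra|easy]|].
  apply Rle_trans with (120 * 3456 ^ 5 * t ^ 5 * (z ^ 5 / 120)).
  - right. unfold z. field. lra.
  - apply Rmult_le_compat_l; [|easy]. apply Rmult_le_pos; lra.
Qed.

Definition string_diff (m N : nat) (t y : R) : C := (string_gf 1 N (ctau t y) - INR m * string_gf m N (ctau t y))%C.

Lemma cdiff_string_diff (m N : nat) (t : R) : 0 < t -> (0 < m)%nat -> cdiff (string_diff m N t).
Proof.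
  intros Ht Hm. apply cdiff_minus; [apply cdiff_string_gf; auto; lia|].
  apply cdiff_mult; [apply cdiff_const|now apply cdiff_string_gf].
Qed.

Lemma cdiff_Phi (J : nat) (t : R) : 0 < t -> cdiff (Phi J t).
Proof. intros Ht x. eexists. now apply cder_Phi. Qed.

Definition integrand (m N J : nat) (t y : R) : R :=
  Re (string_diff m N t y * Phi J t y * cis (- IZR (Z.of_nat N) * y)).

Lemma continuous_integrand (m N J : nat) (t : R) : 0 < t -> (0 < m)%nat -> forall y, continuous (integrand m N J t) y.
Proof.
  intros Ht Hm. apply cdiff_cont_Re. apply cdiff_mult; [|apply cdiff_cis].
  apply cdiff_mult; [now apply cdiff_string_diff|now apply cdiff_Phi].
Qed.

Lemma integrand_abs (m N J : nat) (t y : R) : Rabs (integrand m N J t y) <= Cmod (string_diff m N t y) * Cmod (Phi J t y).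
Proof.
  unfold integrand. eapply Rle_trans; [apply Re_le_Cmod|]. rewrite !Cmod_mult, Cmod_cis. lra.
Qed.

Lemma far_integrand (m : nat) : (1 <= m)%nat -> exists K, 0 <= K /\ forall (N J : nat) (t y : R),
  0 < t <= 1 -> INR N = PI ^ 2 / (6 * t ^ 2) -> 3 / t <= INR J -> t <= Rabs y <= PI ->
  Rabs (integrand m N J t y) <= K * t ^ 2.
Proof.
  intros Hm. set (M := INR m). assert (HM : 1 <= M) by (apply (le_INR 1); lia).
  exists ((1 + M) * 6 * (120 * 3456 ^ 5)). split; [nra|]. intros N J t y Ht HN HJ Hy.
  assert (P6 := PI_sqr_le).
  eapply Rle_trans; [apply integrand_abs|].
  assert (B1 : Cmod (string_diff m N t y) <= (1 + M) * (6 / t ^ 3)).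
  { assert (HN2 : INR N * (2 / t) <= 6 / t ^ 3).
    { rewrite HN. replace (PI ^ 2 / (6 * t ^ 2) * (2 / t)) with (2 * (PI ^ 2 / 6) / t ^ 3) by (field; lra).
      apply Rmult_le_compat_r; [left; apply Rinv_0_lt_compat, pow_lt; lra|lra]. }
    unfold string_diff. eapply Rle_trans; [apply Cmod_triangle_minus|].
    rewrite Cmod_mult, Cmod_R, Rabs_right by (apply Rle_ge, pos_INR). fold M.
    assert (T1 := string_gf_trivial t y 1 N Ht Nat.lt_0_1). assert (T2 := string_gf_trivial t y m N Ht ltac:(lia)).
    rewrite Rmult_plus_distr_r, Rmult_1_l. apply Rplus_le_compat; [lra|]. apply Rmult_le_compat_l; lra. }
  assert (B2 : Cmod (Phi J t y) <= 120 * 3456 ^ 5 * t ^ 5).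
  { eapply Rle_trans; [now apply Phi_far|]. apply exp_neg_inv_small. lra. }
  apply Rle_trans with ((1 + M) * (6 / t ^ 3) * (120 * 3456 ^ 5 * t ^ 5)).
  - apply Rmult_le_compat; auto using Cmod_ge_0.
  - right. field. lra.
Qed.

Lemma near_integrand (m : nat) : (1 <= m)%nat -> exists K, 0 <= K /\ forall (N J : nat) (s y : R),
  0 < s <= 1 / 2 -> INR N = PI ^ 2 / (6 * (s ^ 2) ^ 2) -> 16 <= INR J * (s ^ 2) ^ 2 -> Rabs y <= s ^ 2 ->
  Rabs (integrand m N J (s ^ 2) y - (INR m - 1) / 8 * exp (- (PI ^ 2 / (6 * (s ^ 2) ^ 3) * y ^ 2)))
  <= K * s * / (1 + (y / s ^ 3) ^ 2).
Proof.
  intros Hm. set (M := INR m). assert (HM : 1 <= M) by (apply (le_INR 1); lia).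
  destruct (string_gf_major m Hm) as [K1 [HK1 H1]].
  (* The constants of [meanP_asymptotic], [varP_asymptotic] and [Lam_expansion], as combined by
     [major_arc_profile]. *)
  set (K2 := (300 + 8000 + 96) * 3456 ^ 3).
  exists (K1 * 1152 + (M - 1) / 8 * K2). split; [unfold K2; nra|]. intros N J s y Hs HN HJ Hy.
  set (t := s ^ 2) in *. assert (Ht : 0 < t <= 1 / 4) by (unfold t; simpl; split; nra).
  assert (Hpi := PI2_3_2).
  assert (HNt : 1 <= INR N * t ^ 2).
  { rewrite HN. replace (PI ^ 2 / (6 * t ^ 2) * t ^ 2) with (PI ^ 2 / 6) by (field; lra). nra. }
  assert (HJt : 1 / t <= INR J).
  { apply Rmult_le_reg_r with (t ^ 2); [apply pow_lt; lra|]. replace (1 / t * t ^ 2) with t by (field; lra). lra. }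
  assert (B1 := H1 t y N ltac:(lra) Hy HNt). fold M in B1.
  assert (St : sqrt t = s) by (unfold t; apply sqrt_pow2; lra). rewrite St in B1.
  assert (HA := meanP_asymptotic J t ltac:(lra) ltac:(lra)). rewrite <- HN in HA. rewrite INR_IZR_INZ in HA.
  assert (HV := varP_asymptotic J s Hs HJ). fold t in HV.
  set (B' := PI ^ 2 / (3 * t ^ 3)) in *.
  assert (Pt3 : 0 < / t ^ 3) by (apply Rinv_0_lt_compat, pow_lt; lra).
  assert (HB : / (576 * t ^ 3) <= B').
  { unfold B'. replace (PI ^ 2 / (3 * t ^ 3)) with (PI ^ 2 / 3 * / t ^ 3) by (field; lra).
    rewrite Rinv_mult. apply Rmult_le_compat_r; [lra|]. nra. }
  assert (G := Phi_gaussian J t y B' 300 8000 s (Z.of_nat N) ltac:(lra) eq_refl ltac:(lra) HJt Hy HB HA HV).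
  assert (Pr := major_arc_profile 300 8000 s y ltac:(lra) ltac:(lra) ltac:(lra)). fold t K2 in Pr.
  assert (Near := Phi_near J t y ltac:(lra) HJt Hy).
  set (u2 := (y / s ^ 3) ^ 2) in *. assert (Hu : 0 <= u2) by apply pow2_ge_0.
  assert (Eu : y ^ 2 / (1152 * t ^ 3) = u2 / 1152).
  { unfold u2, t. unfold Rdiv. rewrite Rpow_mult_distr. field. lra. }
  rewrite Eu in Near.
  assert (Near2 : Cmod (Phi J t y) <= 1152 * / (1 + u2)).
  { eapply Rle_trans; [exact Near|]. rewrite exp_Ropp.
    replace (1152 * / (1 + u2)) with (/ ((1 + u2) / 1152)) by (field; lra).
    apply Rinv_le_contravar; [apply Rdiv_lt_0_compat; lra|]. generalize (exp_ineq1_le (u2 / 1152)). lra. }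
  replace (exp (- (PI ^ 2 / (6 * t ^ 3) * y ^ 2))) with (exp (- (B' * y ^ 2 / 2))) by (f_equal; unfold B'; field; lra).
  set (e := exp (- (B' * y ^ 2 / 2))) in *. set (c := cis (- IZR (Z.of_nat N) * y)) in *.
  (* First h is replaced by its limit, at the price of the mere decay of [Phi]; then [Phi] is
     replaced by its Gaussian. *)
  replace (integrand m N J t y - (M - 1) / 8 * e) with
    (Re ((string_diff m N t y - RtoC ((M - 1) / 8)) * Phi J t y * c + RtoC ((M - 1) / 8) * (Phi J t y * c - RtoC e))%C).
  - eapply Rle_trans; [apply Re_le_Cmod|]. eapply Rle_trans; [apply Cmod_triangle|].
    rewrite !Cmod_mult, Cmod_R, (Rabs_right ((M - 1) / 8)) by lra. unfold c at 1. rewrite Cmod_cis, Rmult_1_r.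
    replace ((K1 * 1152 + (M - 1) / 8 * K2) * s * / (1 + u2)) with (K1 * s * (1152 * / (1 + u2)) + (M - 1) / 8 * (K2 * s / (1 + u2))) by (field; lra).
    apply Rplus_le_compat.
    + apply Rmult_le_compat; auto using Cmod_ge_0.
    + apply Rmult_le_compat_l; [lra|]. eapply Rle_trans; [exact G|exact Pr].
  - unfold integrand. fold c. destruct (string_diff m N t y), (Phi J t y), c. unfold Re. simpl. ring.
Qed.

Lemma RInt_split3 (f : R -> R) (a b : R) : (forall x, continuous f x) ->
  RInt f (- b) b = RInt f (- b) (- a) + RInt f (- a) a + RInt f a b.
Proof.
  intros H. assert (E := fun u v => ex_RInt_cont f u v H).
  rewrite <- (RInt_Chasles (V := R_CompleteNormedModule) f (- b) a b), <- (RInt_Chasles (V := R_CompleteNormedModule) f (- b) (- a) a) by apply E.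
  reflexivity.
Qed.

(** The Gaussian integral sqrt (PI / b) with b = PI^2 / (6 t^3) is the main term. Three errors are
    of order s^4: the far ranges, as t^2; the near range, as s times a Lorentzian of width s^3; and
    the Gaussian beyond |y| = t. *)
Lemma integral_asymptotic (m : nat) : (1 <= m)%nat -> exists K, 0 <= K /\ forall (N J : nat) (s : R),
  0 < s <= 1 / 2 -> INR N = PI ^ 2 / (6 * (s ^ 2) ^ 2) -> 16 <= INR J * (s ^ 2) ^ 2 ->
  Rabs (RInt (integrand m N J (s ^ 2)) (- PI) PI - (INR m - 1) / 8 * (sqrt (6 / PI) * s ^ 3)) <= K * s ^ 4.
Proof.
  intros Hm. set (M := INR m). assert (HM : 1 <= M) by (apply (le_INR 1); lia).
  destruct (far_integrand m Hm) as [K1 [HK1 H1]]. destruct (near_integrand m Hm) as [K2 [HK2 H2]].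
  exists (8 * K1 + 4 * K2 + (M - 1) / 8 * 24). split; [nra|]. intros N J s Hs HN HJ.
  set (t := s ^ 2) in *. assert (Ht : 0 < t <= 1 / 4) by (unfold t; simpl; split; nra).
  assert (Hpi := PI2_3_2). assert (Hpi4 := PI_4).
  assert (HJt : 3 / t <= INR J).
  { apply Rmult_le_reg_r with (t ^ 2); [apply pow_lt; lra|]. replace (3 / t * t ^ 2) with (3 * t) by (field; lra). lra. }
  assert (Cf := continuous_integrand m N J t ltac:(lra) ltac:(lia)).
  set (f := integrand m N J t) in *.
  rewrite (RInt_split3 f t PI Cf).
  assert (Cc : forall c x : R, continuous (fun _ : R => c) x) by (intros; apply continuous_const).
  assert (F1 : Rabs (RInt f (- PI) (- t)) <= 4 * (K1 * t ^ 2)).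
  { eapply Rle_trans; [apply (RInt_abs_bound f (fun _ => K1 * t ^ 2)); auto; [lra|]|].
    - intros y Hy. apply H1; auto; [lra|]. rewrite Rabs_left; lra.
    - rewrite RInt_const. unfold scal; simpl; unfold mult; simpl. apply Rmult_le_compat_r; [|lra].
      apply Rmult_le_pos; [easy|]. nra. }
  assert (F2 : Rabs (RInt f t PI) <= 4 * (K1 * t ^ 2)).
  { eapply Rle_trans; [apply (RInt_abs_bound f (fun _ => K1 * t ^ 2)); auto; [lra|]|].
    - intros y Hy. apply H1; auto; [lra|]. rewrite Rabs_right; lra.
    - rewrite RInt_const. unfold scal; simpl; unfold mult; simpl. apply Rmult_le_compat_r; [|lra].
      apply Rmult_le_pos; [easy|]. nra. }
  set (b := PI ^ 2 / (6 * t ^ 3)).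
  assert (Pt3 : 0 < t ^ 3) by (apply pow_lt; lra).
  assert (Hb : 0 < b) by (apply Rdiv_lt_0_compat; nra).
  assert (Cg : forall y, continuous (fun y => exp (- (b * y ^ 2))) y).
  { intros y. apply (cont_derive (fun y => exp (- (b * y ^ 2)))). auto_derive. auto. }
  assert (Cl : forall y, continuous (fun y => / (1 + (y / s ^ 3) ^ 2)) y).
  { intros y. apply (cont_derive (fun y => / (1 + (y / s ^ 3) ^ 2))). auto_derive.
    assert (P := pow2_ge_0 (y / s ^ 3)). simpl in P. unfold Rdiv in P. lra. }
  assert (Ps3 : 0 < s ^ 3) by (apply pow_lt; lra).
  assert (F3 : Rabs (RInt f (- t) t - (M - 1) / 8 * RInt (fun y => exp (- (b * y ^ 2))) (- t) t) <= 4 * (K2 * s ^ 4)).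
  { replace (RInt f (- t) t - (M - 1) / 8 * RInt (fun y => exp (- (b * y ^ 2))) (- t) t) with
      (RInt (fun y => 1 * f y + (- ((M - 1) / 8)) * exp (- (b * y ^ 2))) (- t) t) by (rewrite RInt_lincomb by auto; req; ring).
    eapply Rle_trans; [apply (RInt_abs_bound _ (fun y => K2 * s * / (1 + (y / s ^ 3) ^ 2))); [lra| | |]|].
    - intros y. apply (continuous_plus (V := R_NormedModule) (fun y => 1 * f y)); [apply (continuous_scal_r (V := R_NormedModule) 1 f), Cf|].
      apply (continuous_scal_r (V := R_NormedModule) _ (fun y => exp (- (b * y ^ 2)))), Cg.
    - intros y. apply (continuous_scal_r (V := R_NormedModule) _ (fun y => / (1 + (y / s ^ 3) ^ 2))), Cl.
    - intros y Hy. replace (1 * f y + - ((M - 1) / 8) * exp (- (b * y ^ 2))) with (f y - (M - 1) / 8 * exp (- (b * y ^ 2))) by ring.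
      apply H2; auto. apply Rabs_le; unfold t in Hy; lra.
    - rewrite RInt_mult_const by auto. assert (L := RInt_lorentz (s ^ 3) t Ps3 ltac:(lra)).
      apply Rle_trans with (K2 * s * (s ^ 3 * PI)); [apply Rmult_le_compat_l; [nra|easy]|].
      replace (K2 * s * (s ^ 3 * PI)) with (K2 * s ^ 4 * PI) by ring.
      rewrite (Rmult_comm 4). apply Rmult_le_compat_l; [|easy]. apply Rmult_le_pos; [easy|apply pow_le; lra]. }
  assert (F4 : Rabs (RInt (fun y => exp (- (b * y ^ 2))) (- t) t - sqrt (6 / PI) * s ^ 3) <= 24 * s ^ 4).
  { assert (G := gauss_integral_scaled b t Hb ltac:(lra)).
    assert (E1 : sqrt (PI / b) = sqrt (6 / PI) * s ^ 3).
    { replace (PI / b) with (6 / PI * (s ^ 3) ^ 2) by (unfold b, t; field; lra).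
      rewrite sqrt_mult, sqrt_pow2; auto; [lra| |apply pow_le; lra]. apply Rdiv_le_0_compat; lra. }
    rewrite E1 in G. eapply Rle_trans; [exact G|].
    assert (Hp6 : 1 <= PI ^ 2 / 6) by nra.
    assert (E2 : / s ^ 3 <= sqrt b).
    { replace (/ s ^ 3) with (sqrt ((/ s ^ 3) ^ 2)) by (apply sqrt_pow2; left; now apply Rinv_0_lt_compat).
      apply sqrt_le_1; [apply pow2_ge_0|lra|]. unfold b. replace (PI ^ 2 / (6 * t ^ 3)) with (PI ^ 2 / 6 * (/ s ^ 3) ^ 2) by (unfold t; field; lra).
      assert (0 < (/ s ^ 3) ^ 2) by (apply pow_lt; now apply Rinv_0_lt_compat). nra. }
    assert (E3 : / t <= b * t ^ 2).
    { unfold b. replace (PI ^ 2 / (6 * t ^ 3) * t ^ 2) with (PI ^ 2 / 6 * / t) by (field; lra).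
      assert (0 < / t) by (apply Rinv_0_lt_compat; lra). nra. }
    assert (P1 : 0 < / s ^ 3) by now apply Rinv_0_lt_compat. assert (P2 : 0 < / t) by (apply Rinv_0_lt_compat; lra).
    assert (E4 : / s ^ 3 * / t <= sqrt b * (b * t ^ 2)) by (apply Rmult_le_compat; lra).
    apply Rle_trans with (4 / (/ s ^ 3 * / t)).
    - apply Rmult_le_compat_l; [lra|]. apply Rinv_le_contravar; [nra|easy].
    - replace (4 / (/ s ^ 3 * / t)) with (4 * s ^ 4 * s) by (unfold t; field; lra).
      assert (0 <= s ^ 4) by (apply pow_le; lra). nra. }
  replace (t ^ 2) with (s ^ 4) in * by (unfold t; ring).
  assert (F5 : Rabs ((M - 1) / 8 * (RInt (fun y => exp (- (b * y ^ 2))) (- t) t - sqrt (6 / PI) * s ^ 3)) <= (M - 1) / 8 * (24 * s ^ 4)).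
  { rewrite Rabs_mult, (Rabs_right ((M - 1) / 8)) by lra. apply Rmult_le_compat_l; lra. }
  set (g := RInt (fun y => exp (- (b * y ^ 2))) (- t) t) in *.
  set (r := sqrt (6 / PI) * s ^ 3) in *.
  apply Rabs_le_between in F1. apply Rabs_le_between in F2. apply Rabs_le_between in F3. apply Rabs_le_between in F5.
  apply Rabs_le. unfold f in *. lra.
Qed.

(** * From the integral to the stated asymptotics *)

Lemma Cm_diff_integral (m N J : nat) (t : R) : 0 < t -> (0 < m)%nat -> (N <= J)%nat ->
  INR (Cm 1 N) - INR m * INR (Cm m N) =
  exp (t * INR N) / (2 * PI) * (exp (logP J t) * RInt (integrand m N J t) (- PI) PI).
Proof.
  intros Ht Hm HN. rewrite (Cm_diff_coef t m N J Ht Hm HN). unfold coef. rewrite <- INR_IZR_INZ. f_equal.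
  rewrite <- RInt_mult_const by (now apply continuous_integrand).
  apply RInt_ext. intros y _. unfold integrand. rewrite <- INR_IZR_INZ. fold (string_diff m N t y).
  rewrite partition_gf_Phi by easy. unfold Re. simpl. req. ring.
Qed.

Lemma exp_minus_1_abs (x : R) : Rabs (exp x - 1) <= Rabs x * exp (Rabs x).
Proof.
  assert (H := exp_ineq1_le x). assert (H2 := exp_ineq1_le (- x)). assert (P := exp_pos x).
  assert (E : exp x * exp (- x) = 1) by (rewrite <- exp_plus, Rplus_opp_r; apply exp_0).
  assert (U : exp x - 1 <= x * exp x) by nra.
  destruct (Rle_dec 0 x) as [Hx|Hx].
  - rewrite (Rabs_right x) by lra. rewrite Rabs_right by lra. easy.
  - rewrite (Rabs_left x) by lra.
    assert (1 <= exp (- x)) by lra. rewrite Rabs_left1 by nra. nra.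
Qed.

(** This relation between N and t is the saddle point: t N equals the leading term PI^2 / (6 t) of
    log P, so the exponents add up to PI^2 / (3 t). The square root of t / (2 PI) supplies one more
    power of s, raising s^3 to s^4. *)
Lemma Cm_diff_asymptotic (m : nat) : (1 <= m)%nat -> exists K, 0 <= K /\ forall (N : nat) (s : R),
  0 < s <= 1 / 2 -> INR N = PI ^ 2 / (6 * (s ^ 2) ^ 2) ->
  Rabs (INR (Cm 1 N) - INR m * INR (Cm m N) - (INR m - 1) * sqrt 3 / (16 * PI ^ 2) * s ^ 4 * exp (PI ^ 2 / (3 * s ^ 2)))
  <= K * s ^ 5 * exp (PI ^ 2 / (3 * s ^ 2)).
Proof.
  intros Hm. set (M := INR m). assert (HM : 1 <= M) by (apply (le_INR 1); lia).
  destruct (integral_asymptotic m Hm) as [K [HK H]].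
  set (c1 := (M - 1) / 8 * sqrt (6 / PI)).
  assert (Hc1 : 0 <= c1) by (apply Rmult_le_pos; [lra|apply sqrt_pos]).
  exists (44 * exp 44 * (c1 + K) + K). assert (Pe := exp_pos 44). split; [assert (0 <= 44 * exp 44 * (c1 + K)) by (apply Rmult_le_pos; lra); lra|].
  intros N s Hs HN. set (t := s ^ 2) in *.
  assert (Ht : 0 < t <= 1 / 4) by (unfold t; simpl; split; nra).
  assert (Hpi := PI2_3_2). assert (Hp6 : 1 <= PI ^ 2 / 6) by nra.
  (* As N t^2 = PI^2 / 6 >= 1, this ensures 16 <= J t^2, which [integral_asymptotic] asks for. *)
  set (J := (16 * N)%nat).
  assert (HNt : INR N * t ^ 2 = PI ^ 2 / 6) by (rewrite HN; field; lra).
  assert (HJt : INR J * t ^ 2 = 16 * (INR N * t ^ 2)) by (unfold J; rewrite mult_INR; simpl; ring).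
  assert (HJN : (N <= J)%nat) by (unfold J; lia).
  unfold M at 1. rewrite (Cm_diff_integral m N J t) by (lra || lia).
  assert (HI := H N J s Hs HN ltac:(fold t; lra)). fold t M in HI.
  set (I := RInt (integrand m N J t) (- PI) PI) in *.
  assert (HP := logP_asymptotic J t ltac:(lra) ltac:(lra)).
  set (eps := logP J t - logP_main t) in *.
  set (X := exp (PI ^ 2 / (3 * t))).
  assert (S2 : 0 < sqrt (2 * PI)) by (apply sqrt_lt_R0; lra).
  assert (E1 : exp (t * INR N) * exp (logP J t) = X * (s / sqrt (2 * PI)) * exp eps).
  { replace (logP J t) with (logP_main t + eps) by (unfold eps; ring). unfold logP_main. rewrite !exp_plus.
    replace (exp (ln (t / (2 * PI)) / 2)) with (s / sqrt (2 * PI)).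
    - unfold X. replace (PI ^ 2 / (3 * t)) with (t * INR N + PI ^ 2 / (6 * t)) by (rewrite HN; field; lra). rewrite exp_plus. ring.
    - replace (ln (t / (2 * PI)) / 2) with (/ 2 * ln (t / (2 * PI))) by field.
      change (exp (/ 2 * ln (t / (2 * PI)))) with (Rpower (t / (2 * PI)) (/ 2)). rewrite Rpower_sqrt by (apply Rdiv_lt_0_compat; lra).
      rewrite sqrt_div by lra. f_equal. symmetry. apply sqrt_pow2. lra. }
  set (q := s / (2 * PI * sqrt (2 * PI))).
  assert (Hq : 0 < q <= s).
  { unfold q. assert (1 <= sqrt (2 * PI)) by (rewrite <- sqrt_1 at 1; apply sqrt_le_1; lra).
    split; [apply Rdiv_lt_0_compat; nra|]. apply Rmult_le_reg_r with (2 * PI * sqrt (2 * PI)); [nra|].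
    replace (s / (2 * PI * sqrt (2 * PI)) * (2 * PI * sqrt (2 * PI))) with s by (field; lra).
    assert (1 <= 2 * PI * sqrt (2 * PI)) by nra. nra. }
  replace (exp (t * INR N) / (2 * PI) * (exp (logP J t) * I)) with (X * q * (exp eps * I)).
  2:{ transitivity (exp (t * INR N) * exp (logP J t) * (I / (2 * PI))); [rewrite E1; unfold q; field; lra|field; lra]. }
  replace ((M - 1) * sqrt 3 / (16 * PI ^ 2) * s ^ 4 * X) with (X * q * (c1 * s ^ 3)).
  2:{ assert (Q : sqrt (6 / PI) / sqrt (2 * PI) = sqrt 3 / PI).
      { rewrite <- sqrt_div by (try lra; apply Rdiv_le_0_compat; lra).
        replace (6 / PI / (2 * PI)) with (3 / PI ^ 2) by (field; lra). rewrite sqrt_div by nra. f_equal. apply sqrt_pow2. lra. }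
      unfold q, c1. transitivity (X * s ^ 4 * (M - 1) / (16 * PI) * (sqrt (6 / PI) / sqrt (2 * PI))); [field; lra|rewrite Q; field; lra]. }
  assert (PX : 0 < X) by apply exp_pos.
  replace (X * q * (exp eps * I) - X * q * (c1 * s ^ 3)) with (X * q * ((exp eps - 1) * I + (I - c1 * s ^ 3))) by ring.
  rewrite Rabs_mult, (Rabs_right (X * q)) by nra.
  assert (P3 : 0 < s ^ 3) by (apply pow_lt; lra). assert (P4 : s ^ 4 = s ^ 3 * s) by ring. 
  assert (B1 : Rabs (I - c1 * s ^ 3) <= K * s ^ 4).
  { unfold c1. rewrite Rmult_assoc. exact HI. }
  assert (B2 : Rabs I <= (c1 + K) * s ^ 3).
  { replace I with (c1 * s ^ 3 + (I - c1 * s ^ 3)) by ring. eapply Rle_trans; [apply Rabs_triang|].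
    rewrite Rabs_right by nra. assert (K * s ^ 4 <= K * s ^ 3) by (apply Rmult_le_compat_l; nra). lra. }
  assert (B3 : Rabs (exp eps - 1) <= 44 * exp 44 * s).
  { eapply Rle_trans; [apply exp_minus_1_abs|].
    assert (Rabs eps <= 44 * s) by (unfold t in *; simpl in *; nra).
    replace (44 * exp 44 * s) with (44 * s * exp 44) by ring.
    apply Rmult_le_compat; [apply Rabs_pos|left; apply exp_pos|easy|]. apply exp_le_mono. lra. }
  assert (B4 : Rabs ((exp eps - 1) * I + (I - c1 * s ^ 3)) <= (44 * exp 44 * (c1 + K) + K) * s ^ 4).
  { eapply Rle_trans; [apply Rabs_triang|]. rewrite Rabs_mult.
    assert (Rabs (exp eps - 1) * Rabs I <= 44 * exp 44 * s * ((c1 + K) * s ^ 3)) by (apply Rmult_le_compat; auto using Rabs_pos).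
    replace (44 * exp 44 * s * ((c1 + K) * s ^ 3)) with (44 * exp 44 * (c1 + K) * s ^ 4) in * by ring. lra. }
  set (KK := 44 * exp 44 * (c1 + K) + K) in *.
  assert (P4' : 0 < s ^ 4) by (apply pow_lt; lra).
  assert (B5 : 0 <= KK * s ^ 4) by (eapply Rle_trans; [apply Rabs_pos|exact B4]).
  apply Rle_trans with (X * q * (KK * s ^ 4)).
  - apply Rmult_le_compat_l; [nra|easy].
  - replace (KK * s ^ 5 * X) with (X * s * (KK * s ^ 4)) by ring. apply Rmult_le_compat_r; [easy|]. apply Rmult_le_compat_l; lra.
Qed.

Lemma Rpower_scaled (s e : R) : 0 < s -> Rpower (PI ^ 2 / (6 * (s ^ 2) ^ 2)) e = Rpower (PI ^ 2 / 6) e * Rpower s (- (4 * e)).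
Proof.
  intros Hs. assert (Hpi := PI_RGT_0). assert (0 < PI ^ 2) by (apply pow_lt; lra).
  replace (Rpower s (- (4 * e))) with (Rpower (/ s ^ 4) e).
  - rewrite Rpower_mult_distr.
    + f_equal. field. lra.
    + lra.
    + apply Rinv_0_lt_compat, pow_lt. lra.
  - unfold Rpower. f_equal. rewrite ln_Rinv by (apply pow_lt; lra). rewrite ln_pow by lra. simpl. ring.
Qed.

(** The constant 54 fits: 6^(3/4) / 54^(1/4) = 4^(1/4) = sqrt 2. *)
Lemma bessel_prefactor (s : R) : 0 < s ->
  Rpower (PI ^ 2 / (6 * (s ^ 2) ^ 2)) (- (3 / 4)) / Rpower 54 (1 / 4) = sqrt 2 * s ^ 3 / (PI * sqrt PI).
Proof.
  intros Hs. assert (Hpi := PI_RGT_0). assert (P2 : 0 < PI ^ 2) by (apply pow_lt; lra).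
  rewrite Rpower_scaled by easy.
  replace (- (4 * - (3 / 4))) with (INR 3) by (simpl; field). rewrite Rpower_pow by easy.
  replace (54) with (6 * 3 ^ 2) by ring.
  rewrite <- (Rpower_sqrt 2), <- (Rpower_sqrt PI) by lra.
  assert (E : Rpower (PI ^ 2 / 6) (- (3 / 4)) * PI * Rpower PI (/ 2) = Rpower 2 (/ 2) * Rpower (6 * 3 ^ 2) (1 / 4)).
  { replace PI with (exp (ln PI)) at 2 by (apply exp_ln; lra). unfold Rpower. rewrite <- !exp_plus. f_equal.
    rewrite (ln_div (PI ^ 2)), ln_mult, !ln_pow by lra. replace 6 with (2 * 3) by ring. rewrite ln_mult by lra. simpl. field. }
  assert (N1 : Rpower (6 * 3 ^ 2) (1 / 4) <> 0) by (unfold Rpower; generalize (exp_pos (1 / 4 * ln (6 * 3 ^ 2))); lra).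
  assert (N2 : Rpower PI (/ 2) <> 0) by (unfold Rpower; generalize (exp_pos (/ 2 * ln PI)); lra).
  apply Rmult_eq_reg_r with (Rpower (6 * 3 ^ 2) (1 / 4) * (PI * Rpower PI (/ 2))).
  2:{ apply Rmult_integral_contrapositive_currified; [exact N1|]. apply Rmult_integral_contrapositive_currified; [lra|exact N2]. }
  transitivity (s ^ 3 * (Rpower (PI ^ 2 / 6) (- (3 / 4)) * PI * Rpower PI (/ 2))); [field; easy|].
  rewrite E. field. split; [easy|lra].
Qed.

(** For x = PI^2 / (3 s^2) the Bessel error e^x / x^(3/2) is O(s^3 e^x); the prefactor contributes
    another s^3, which leaves room below s^5. *)
Lemma bessel_main_term (s : R) : 0 < s <= 1 / 2 ->
  Rabs (PI / (16 * Rpower 54 (1 / 4)) * Rpower (PI ^ 2 / (6 * (s ^ 2) ^ 2)) (- (3 / 4)) * BesselI (- (3 / 2)) (PI ^ 2 / (3 * s ^ 2))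
    - sqrt 3 / (16 * PI ^ 2) * s ^ 4 * exp (PI ^ 2 / (3 * s ^ 2))) <= s ^ 5 * exp (PI ^ 2 / (3 * s ^ 2)).
Proof.
  intros Hs. assert (Hpi := PI2_3_2). set (x := PI ^ 2 / (3 * s ^ 2)).
  assert (Ps2 : 0 < s ^ 2) by (apply pow_lt; lra).
  assert (Hx : / s ^ 2 <= x).
  { unfold x. replace (PI ^ 2 / (3 * s ^ 2)) with (PI ^ 2 / 3 * / s ^ 2) by (field; lra).
    assert (0 < / s ^ 2) by (now apply Rinv_0_lt_compat). assert (1 <= PI ^ 2 / 3) by nra. nra. }
  assert (Hx1 : 1 <= x).
  { apply Rle_trans with (/ s ^ 2); [|easy]. rewrite <- Rinv_1. apply Rinv_le_contravar; [easy|]. simpl. nra. }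
  assert (N : Rpower 54 (1 / 4) <> 0) by (unfold Rpower; generalize (exp_pos (1 / 4 * ln 54)); lra).
  assert (S1 : 1 <= sqrt PI) by (rewrite <- sqrt_1 at 1; apply sqrt_le_1; lra).
  assert (S2 : 0 < sqrt 2) by (apply sqrt_lt_R0; lra). assert (S2' : sqrt 2 * sqrt 2 = 2) by (apply sqrt_sqrt; lra).
  replace (PI / (16 * Rpower 54 (1 / 4)) * Rpower (PI ^ 2 / (6 * (s ^ 2) ^ 2)) (- (3 / 4))) with (sqrt 2 * s ^ 3 / (16 * sqrt PI)).
  2:{ transitivity (PI / 16 * (Rpower (PI ^ 2 / (6 * (s ^ 2) ^ 2)) (- (3 / 4)) / Rpower 54 (1 / 4))); [|field; easy].
      rewrite bessel_prefactor by lra. field. lra. }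
  assert (B := BesselI_asymptotic x Hx1).
  assert (E : sqrt 2 * s ^ 3 / (16 * sqrt PI) * (exp x / sqrt (2 * PI * x)) = sqrt 3 / (16 * PI ^ 2) * s ^ 4 * exp x).
  { replace (2 * PI * x) with (2 * PI * (PI ^ 2 / 3) / s ^ 2) by (unfold x; field; lra).
    rewrite sqrt_div by nra. rewrite sqrt_pow2 by lra. rewrite sqrt_mult, sqrt_mult, sqrt_div, sqrt_pow2 by nra.
    assert (S3 : 0 < sqrt 3) by (apply sqrt_lt_R0; lra). assert (Sp : sqrt PI * sqrt PI = PI) by (apply sqrt_sqrt; lra).
    set (p := sqrt PI) in *. rewrite <- Sp. field. repeat split; lra. }
  rewrite <- E, <- Rmult_minus_distr_l, Rabs_mult.
  assert (P3 : 0 < s ^ 3) by (apply pow_lt; lra). assert (Pe := exp_pos x).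
  rewrite Rabs_right by (apply Rle_ge, Rdiv_le_0_compat; nra).
  assert (Sx : / s <= sqrt x).
  { replace (/ s) with (sqrt (/ s ^ 2)); [apply sqrt_le_1; [left; now apply Rinv_0_lt_compat|lra|easy]|].
    rewrite <- (sqrt_pow2 (/ s)) by (left; apply Rinv_0_lt_compat; lra). f_equal. field. lra. }
  assert (P1 : 0 < / s) by (apply Rinv_0_lt_compat; lra). assert (P2 : 0 < / s ^ 2) by (now apply Rinv_0_lt_compat).
  assert (B2 : 2 * exp x / (x * sqrt x) <= 2 * exp x * s ^ 3).
  { apply Rmult_le_compat_l; [lra|]. replace (s ^ 3) with (/ (/ s ^ 2 * / s)) by (field; lra).
    apply Rinv_le_contravar; [nra|]. apply Rmult_le_compat; lra. }
  apply Rle_trans with (s ^ 3 / 8 * (2 * exp x * s ^ 3)).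
  - apply Rmult_le_compat; [apply Rdiv_le_0_compat; nra|apply Rabs_pos| |lra].
    apply Rmult_le_reg_r with (16 * sqrt PI); [lra|].
    replace (sqrt 2 * s ^ 3 / (16 * sqrt PI) * (16 * sqrt PI)) with (s ^ 3 * sqrt 2) by (field; lra).
    replace (s ^ 3 / 8 * (16 * sqrt PI)) with (s ^ 3 * (2 * sqrt PI)) by field.
    apply Rmult_le_compat_l; nra.
  - replace (s ^ 3 / 8 * (2 * exp x * s ^ 3)) with (s ^ 5 * exp x * (s / 4)) by field.
    assert (0 < s ^ 5) by (apply pow_lt; lra). assert (0 < s ^ 5 * exp x) by nra. nra.
Qed.

Theorem theorem2p9 (m : nat) (hm : (2 <= m)%nat) :
  exists K : R, exists N0 : nat, forall N : nat, (N0 <= N)%nat ->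
    Rabs (INR (Cm 1 N) - INR m * INR (Cm m N)
          - (INR m - 1) * (PI / (16 * Rpower 54 (1 / 4)))
            * Rpower (INR N) (- (3 / 4))
            * BesselI (- (3 / 2)) (PI * sqrt (2 * INR N / 3)))
    <= K * (Rpower (INR N) (- (5 / 4)) * exp (PI * sqrt (2 * INR N / 3))).
Proof.
  destruct (Cm_diff_asymptotic m) as [K [HK H]]; [lia|].
  set (M := INR m) in *. assert (HM : 1 <= M) by (apply (le_INR 1); lia).
  set (c := Rpower (PI ^ 2 / 6) (- (5 / 4))).
  assert (Hc : 0 < c) by apply exp_pos.
  (* From N >= 43 follow 6 N >= 256, r >= 16, PI / r <= 1/4 and s <= 1/2. The division by [c] is due
     to N^(-5/4) = c s^5, and [M] pays for replacing the Bessel function by its leading term. *)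
  exists ((K + M) / c), 43%nat. intros N HN.
  assert (HN' : 43 <= INR N) by (replace 43 with (INR 43) by (simpl; ring); now apply le_INR).
  assert (Hpi := PI2_3_2). assert (Hpi4 := PI_4).
  set (r := sqrt (6 * INR N)). assert (Hr : 0 < r) by (apply sqrt_lt_R0; lra).
  assert (Er : r * r = 6 * INR N) by (apply sqrt_sqrt; lra).
  assert (Hr16 : 16 <= r) by nra.
  set (s := sqrt (PI / r)).
  assert (Hs : 0 < s) by (apply sqrt_lt_R0, Rdiv_lt_0_compat; lra).
  assert (Es : s ^ 2 = PI / r) by (apply pow2_sqrt; left; apply Rdiv_lt_0_compat; lra).
  assert (Hs2 : s <= 1 / 2).
  { assert (PI / r <= 1 / 4); [|simpl in Es; nra].
    apply Rmult_le_reg_r with r; [easy|]. replace (PI / r * r) with PI by (field; lra). lra. }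
  assert (EN : INR N = PI ^ 2 / (6 * (s ^ 2) ^ 2)).
  { rewrite Es. replace (PI ^ 2 / (6 * (PI / r) ^ 2)) with (r * r / 6) by (field; lra). lra. }
  assert (Ex : PI * sqrt (2 * INR N / 3) = PI ^ 2 / (3 * s ^ 2)).
  { replace (2 * INR N / 3) with ((r / 3) ^ 2) by (transitivity (r * r / 9); [field|rewrite Er; field]).
    rewrite sqrt_pow2 by lra. rewrite Es. field. lra. }
  assert (A := H N s ltac:(lra) EN). assert (B := bessel_main_term s ltac:(lra)).
  rewrite Ex, EN.
  rewrite (Rpower_scaled s (- (5 / 4))) by easy. fold c.
  replace (- (4 * - (5 / 4))) with (INR 5) by (simpl; field). rewrite Rpower_pow by easy.
  set (X := exp (PI ^ 2 / (3 * s ^ 2))) in *.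
  set (b := PI / (16 * Rpower 54 (1 / 4)) * Rpower (PI ^ 2 / (6 * (s ^ 2) ^ 2)) (- (3 / 4)) * BesselI (- (3 / 2)) (PI ^ 2 / (3 * s ^ 2))) in *.
  replace ((K + M) / c * (c * s ^ 5 * X)) with (K * s ^ 5 * X + M * (s ^ 5 * X)) by (field; lra).
  set (d := INR (Cm 1 N) - M * INR (Cm m N)) in *.
  set (v := sqrt 3 / (16 * PI ^ 2) * s ^ 4 * X) in *.
  replace ((M - 1) * sqrt 3 / (16 * PI ^ 2) * s ^ 4 * X) with ((M - 1) * v) in A by (unfold v; field; lra).
  match goal with |- Rabs (d - ?z) <= _ => replace (d - z) with ((d - (M - 1) * v) + (M - 1) * (v - b)) by (unfold b; ring) end.
  eapply Rle_trans; [apply Rabs_triang|]. apply Rplus_le_compat; [exact A|].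
  rewrite Rabs_mult, (Rabs_right (M - 1)), Rabs_minus_sym by lra.
  apply Rmult_le_compat; [lra|apply Rabs_pos|lra|exact B].
Qed.
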